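(* Let $Q:\mathbb R^{d_L}\times\mathbb R^{d_R}\to\mathbb R^{\ell}$ be a bilinear map with $d_L+d_R\ge\ell$. For a compact set $\Omega\subset\mathbb R^{d_L}\times\mathbb R^{d_R}\times\mathbb R^\ell$ let $$B_Q(f,g):=\int_\Omega f(y,z+Q(x,y))\,g(x,z)\,dx\,dy\,dz ,$$ where $f$ is a function on $\mathbb R^{d_R}\times\mathbb R^\ell$ and $g$ a function on $\mathbb R^{d_L}\times\mathbb R^\ell$. Let $\mathrm{Vol}_Q(x,y)$ be the largest possible volume of a parallelepiped in $\mathbb R^\ell$ generated by $\ell$ vectors from the collection $\{Q(e_i,y)\}_{i=1}^{d_L}\cup\{Q(x,e_j)\}_{j=1}^{d_R}$, let $$\Phi_Q(x,y):=\frac{\mathrm{Vol}_Q(x,y)}{(|x|^2+|y|^2)^{\frac{d_L+d_R-\ell}{2}}},$$ and for $\alpha>0$ let $$W_{Q,\alpha}(g,f):=\int_{\{(x,y)\in\mathbb R^{d_L}\times\mathbb R^{d_R}:\ \Phi_Q(x,y)\le\alpha\}} g(x)\,f(y)\,dx\,dy .$$ Suppose there exist $s>0$, $p_l,p_r\in[1,\infty]$ and a finite constant $C_0$ such that $$W_{Q,\alpha}(\chi_{E^l},\chi_{E^r})\le C_0\,\alpha^s\,|E^l|^{\frac1{p_l}}\,|E^r|^{\frac1{p_r}}\qquad(\ast)$$ for all measurable sets $E^l\subset\mathbb R^{d_L}$ and $E^r\subset\mathbb R^{d_R}$ and all $\alpha>0$. Then for every $(q_L^{-1},q_R^{-1})$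 in the interior of the triangle with vertices $(1,0)$, $(0,1)$ and $$\left(\frac{2+(sp_l')^{-1}}{3+(sp_l')^{-1}+(sp_r')^{-1}},\ \frac{2+(sp_r')^{-1}}{3+(sp_l')^{-1}+(sp_r')^{-1}}\right)$$ there is a finite constant $C$ such that $|B_Q(f,g)|\le C\,\|f\|_{L^{q_L}}\|g\|_{L^{q_R}}$ for all measurable functions $f$ and $g$. If $(\ast)$ is only assumed to hold for all $\alpha>0$ and all measurable $E^l$, $E^r$ contained in fixed neighborhoods of the origins in $\mathbb R^{d_L}$ and $\mathbb R^{d_R}$ respectively, then the same conclusion remains true provided that the diameter of $\Omega$ is sufficiently small.
   Context: $e_i$ and $e_j$ denote the standard basis vectors of $\mathbb R^{d_L}$ and $\mathbb R^{d_R}$ respectively. $|E|$ denotes Lebesgue measure, $\chi_E$ the characteristic function of $E$, and $p'$ the dual exponent, $\frac1p+\frac1{p'}=1$. The $L^{q}$ norms are with respect to Lebesgue measure on $\mathbb R^{d_R}\times\mathbb R^\ell$ (for $f$) and $\mathbb R^{d_L}\times\mathbb R^\ell$ (for $g$). *)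

(* Defs.v *)
From HB Require Import structures.
From mathcomp Require Import all_boot all_order all_algebra.
From mathcomp Require Import sesquilinear complex.
From mathcomp Require Import all_classical all_reals all_analysis.
Set Implicit Arguments. Unset Strict Implicit. Unset Printing Implicit Defensive.
Import Order.TTheory GRing.Theory Num.Theory.
Import numFieldNormedType.Exports.
Local Open Scope classical_set_scope.
Local Open Scope ring_scope.

Section mx_borel.
Context {R : realType} {m n : nat}.

(* generated by the entries; this is the Borel sigma-algebra of 'M[R]_(m, n) *)
Definition mx_borel : set (set 'M[R]_(m, n)) :=
  <<s \bigcup_(ij in [set: 'I_m * 'I_n])
        preimage_set_system setT (fun M : 'M[R]_(m, n) => M ij.1 ij.2)
                            measurable >>.

Let mx_borel0 : mx_borel set0.
Proof. exact: sigma_algebra0. Qed.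

Let mx_borelC A : mx_borel A -> mx_borel (~` A).
Proof. exact: sigma_algebraC. Qed.

Let mx_borel_bigcup (F : (set 'M[R]_(m, n))^nat) :
  (forall i, mx_borel (F i)) -> mx_borel (\bigcup_i F i).
Proof. exact: sigma_algebra_bigcup. Qed.

HB.instance Definition _ := @isMeasurable.Build default_measure_display
  'M[R]_(m, n) mx_borel mx_borel0 mx_borelC mx_borel_bigcup.
End mx_borel.

Section lebesgue_rV.
Context {R : realType}.

Lemma measurable_mx_coord m n (i : 'I_m) (j : 'I_n) :
  measurable_fun [set: 'M[R]_(m, n)] (fun M : 'M[R]_(m, n) => M i j).
Proof.
move=> _ Y mY; rewrite setTI; apply: sub_sigma_algebra.
by exists (i, j) => //; exists Y => //; rewrite setTI.
Qed.

Lemma measurable_fun_mxP d (T : measurableType d) m n (f : T -> 'M[R]_(m, n)) :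
  (forall i j, measurable_fun setT (fun t => f t i j)) ->
  measurable_fun setT f.
Proof.
move=> mf _ A; rewrite setTI.
rewrite -[measurable A]/(mx_borel A) => mA.
have : <<s \bigcup_(ij in [set: 'I_m * 'I_n])
        preimage_set_system setT (fun M : 'M[R]_(m, n) => M ij.1 ij.2)
                            measurable >> `<=` [set B | measurable (f @^-1` B)].
  apply: smallest_sub.
    split => /=.
    - by rewrite preimage_set0.
    - by move=> B mB; rewrite setTD preimage_setC; exact: measurableC.
    - by move=> F mF; rewrite preimage_bigcup; exact: bigcup_measurable.
  move=> _ [[i j] _ [B mB <-]] /=; rewrite setTI.
  by rewrite -[X in measurable X]setTI; exact: mf.
exact.
Qed.

Definition cons_rV n (p : R * 'rV[R]_n) : 'rV[R]_n.+1 := row_mx p.1%:M p.2.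

Lemma cons_rV0 n p : @cons_rV n p 0 0 = p.1.
Proof.
rewrite /cons_rV (_ : (0 : 'I_n.+1) = lshift n (0 : 'I_1)); last exact/val_inj.
by apply: etrans (row_mxEl _ _ _ _) _; rewrite mxE eqxx.
Qed.

Lemma cons_rVS n p j : @cons_rV n p 0 (lift ord0 j) = p.2 0 j.
Proof.
rewrite /cons_rV (_ : lift ord0 j = rshift 1 j); last exact/val_inj.
exact: row_mxEr.
Qed.

Lemma measurable_cons_rV n :
  measurable_fun [set: measurableTypeR R * 'rV[R]_n] (@cons_rV n).
Proof.
apply: measurable_fun_mxP => i j; rewrite ord1 {i}.
have [->|] := eqVneq j 0.
  by under eq_fun do rewrite cons_rV0; exact: measurable_fst.
case: (unliftP 0 j) => [k ->|-> /eqP//] _.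
under eq_fun do rewrite cons_rVS.
by apply: (@measurableT_comp _ _ _ _ _ _ (fun M : 'rV[R]_n => M 0 k)) => //;
  exact: measurable_mx_coord.
Qed.


Section cons_measure.
Context {n : nat} (mu : {sigma_finite_measure set 'rV[R]_n -> \bar R}).
Local Open Scope ereal_scope.

Definition cons_measure : set 'rV[R]_n.+1 -> \bar R :=
  pushforward (@lebesgue_measure R \x mu) (@cons_rV n).

Let mcons A : measurable A -> measurable (@cons_rV n @^-1` A).
Proof.
by move=> mA; rewrite -[X in measurable X]setTI; exact: measurable_cons_rV.
Qed.

Let cons_measure0 : cons_measure set0 = 0.
Proof. by rewrite /cons_measure /pushforward preimage_set0 measure0. Qed.

Let cons_measure_ge0 A : 0 <= cons_measure A.
Proof. by rewrite /cons_measure /pushforward measure_ge0. Qed.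

Let cons_measure_sigma_additive : semi_sigma_additive cons_measure.
Proof.
move=> F mF tF mUF; rewrite /cons_measure /pushforward preimage_bigcup.
apply: measure_semi_sigma_additive.
- by move=> i; exact: mcons.
- apply/trivIsetP => i j _ _ ij; rewrite -preimage_setI.
  by move/trivIsetP : tF => /(_ _ _ _ _ ij) ->//; rewrite preimage_set0.
- by rewrite -preimage_bigcup; exact: mcons.
Qed.

HB.instance Definition _ := isMeasure.Build _ _ _ cons_measure
  cons_measure0 cons_measure_ge0 cons_measure_sigma_additive.

Let u (x : 'rV[R]_n.+1) : measurableTypeR R * 'rV[R]_n :=
  (x 0%R 0%R, (\row_j x 0%R (lift ord0 j))%R).

Let measurable_u : measurable_fun [set: 'rV[R]_n.+1] u.
Proof.
apply/measurable_fun_pairP; split; first exact: measurable_mx_coord.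
apply: measurable_fun_mxP => i j /=.
by under eq_fun do rewrite mxE; exact: measurable_mx_coord.
Qed.

Let cons_measure_sigma_finite : sigma_finite setT cons_measure.
Proof.
have /sigma_finiteP[F [TF ndF Foo]] := sigma_finiteT (@lebesgue_measure R).
have /sigma_finiteP[G [TG ndG Goo]] := sigma_finiteT mu.
have uK p : u (cons_rV p) = p.
  rewrite /u cons_rV0; case: p => a v; congr pair; apply/rowP => j.
  by rewrite mxE cons_rVS.
exists (fun k => u @^-1` (F k `*` G k)).
  apply/seteqP; split => // x _.
  have [i _ Fi] : (\bigcup_i F i) (u x).1 by rewrite -TF.
  have [j _ Gj] : (\bigcup_i G i) (u x).2 by rewrite -TG.
  exists (maxn i j) => //; split => /=.
    exact: (subsetPset _ _ (ndF _ _ (leq_maxl i j))).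
  exact: (subsetPset _ _ (ndG _ _ (leq_maxr i j))).
move=> k; have [mF Fk] := Foo k; have [mG Gk] := Goo k; split.
  by rewrite -[X in measurable X]setTI; apply: measurable_u => //; exact: measurableX.
rewrite /cons_measure /pushforward -comp_preimage.
rewrite (_ : u \o _ = id) ?funeqE// preimage_id product_measure1E//.
by rewrite lte_mul_pinfty// ge0_fin_numE.
Qed.

HB.instance Definition _ := Measure_isSigmaFinite.Build _ _ _ cons_measure
  cons_measure_sigma_finite.

End cons_measure.

Fixpoint leb n : {sigma_finite_measure set 'rV[R]_n -> \bar R} :=
  match n with
  | 0 => \d_(0 : 'rV[R]_0)
  | n.+1 => cons_measure (leb n)
  end.

Lemma leb_box n (A : 'I_n -> set (measurableTypeR R)) :
  (forall i, measurable (A i)) ->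
  leb n [set x | forall i, A i (x 0 i)] = (\prod_i lebesgue_measure (A i))%E.
Proof.
elim: n A => [|n IHn] A mA.
  by rewrite big_ord0 /= diracE mem_set// => -[].
rewrite big_ord_recl -IHn => [|i]; last exact: mA.
rewrite -product_measure1E//; last first.
  rewrite [X in measurable X](_ : _ =
    \bigcap_(i in [set: 'I_n]) (fun x : 'rV[R]_n => x 0 i) @^-1` A (lift ord0 i)).
    apply: fin_bigcap_measurable => // i _.
    have := @measurable_mx_coord 1 n 0 i measurableT _ (mA (lift ord0 i)).
    by rewrite setTI.
  by apply/seteqP; split => [x xA i _|x xA i]; [exact: xA|exact: (xA i)].
rewrite /= /cons_measure /pushforward; congr (_ _).
apply/seteqP; split => [[a v] /= vA|[a v] /= [Aa vA] i].
  split=> [|i]; first by have := vA ord0; rewrite cons_rV0.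
  by have := vA (lift ord0 i); rewrite cons_rVS.
by case: (unliftP ord0 i) => [j|] ->; rewrite (cons_rVS, cons_rV0).
Qed.

End lebesgue_rV.

(* On a sigma-finite measure this is the completion, so that
   completed (leb n) and completed (leb m \x leb n) are Lebesgue measure
   together with the Lebesgue (not merely Borel) measurable sets. *)
Notation completed mu := (@completed_measure_extension _ _ _ mu).

Definition completed_measurable {d} {T : measurableType d} {R : realType}
    (mu : {measure set T -> \bar R}) (A : set T) : Prop :=
  (mu^*)%mu.-cara.-measurable A.

Definition completed_measurable_fun {d} {T : measurableType d} {R : realType}
    (mu : {measure set T -> \bar R}) (f : T -> R[i]) : Prop :=
  measurable_fun [set: caratheodory_type (mu^*)%mu]
    (fun x => complex.Re (f x)) /\
  measurable_fun [set: caratheodory_type (mu^*)%mu]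
    (fun x => complex.Im (f x)).

Section complex_valued.
Context {d} {T : measurableType d} {R : realType}.
Variables (mu : {measure set T -> \bar R}).
Implicit Types (D : set T) (f : T -> R[i]).

Definition cintegrable D f :=
  mu.-integrable D (fun x => (complex.Re (f x))%:E) /\
  mu.-integrable D (fun x => (complex.Im (f x))%:E).

Definition cintegral D f : R[i] :=
  Complex (\int[mu]_(x in D) complex.Re (f x))
          (\int[mu]_(x in D) complex.Im (f x)).

Definition cLnorm (p : \bar R) f : \bar R :=
  Lnorm mu p (fun x => (Normc.normc (f x))%:E).

End complex_valued.

Section radon_like.
Context {R : realType} {dL dR l : nat}.
Variable Q : {bilinear 'rV[R]_dL -> 'rV[R]_dR -> 'rV[R]_l}.
Implicit Types (x : 'rV[R]_dL) (y : 'rV[R]_dR) (z : 'rV[R]_l).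

Definition sqnorm n (v : 'rV[R]_n) : R := \sum_i v 0 i ^+ 2.

Definition generators x y (k : 'I_dL + 'I_dR) : 'rV[R]_l :=
  match k with
  | inl i => Q (delta_mx 0 i) y
  | inr j => Q x (delta_mx 0 j)
  end.

Definition Vol x y : R :=
  \big[Num.max/0]_(s : {ffun 'I_l -> 'I_dL + 'I_dR} | injectiveb s)
    `|\det (\matrix_k generators x y (s k))|.

(* Division by zero occurs only at the origin, a Lebesgue null set when
   0 < dL + dR; when dL + dR = 0 the exponent is 0 and the denominator is 1. *)
Definition Phi x y : R :=
  Vol x y / ((sqnorm x + sqnorm y) `^ (((dL + dR)%:R - l%:R) / 2)).

Definition W (alpha : R) (g : 'rV[R]_dL -> R) (f : 'rV[R]_dR -> R) : \bar R :=
  (\int[completed (leb dL \x leb dR)]_(w in [set w | (Phi w.1 w.2 <= alpha)%R])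
     (g w.1 * f w.2)%:E)%E.

(* fine p^-1 is 1/p, with 1/p = 0 when p = +oo *)
Definition sublevel_estimate (U : set 'rV[R]_dL) (V : set 'rV[R]_dR)
    (s : R) (pl pr : \bar R) (C0 : R) : Prop :=
  forall (El : set 'rV[R]_dL) (Er : set 'rV[R]_dR) (alpha : R),
    completed_measurable (leb dL) El -> completed_measurable (leb dR) Er ->
    El `<=` U -> Er `<=` V -> 0 < alpha ->
    (W alpha \1_El \1_Er <=
     C0%:E * (alpha `^ s)%:E * completed (leb dL) El `^ fine pl^-1
                             * completed (leb dR) Er `^ fine pr^-1)%E.

Definition triangle (A B C : R * R) : set (R * R) :=
  [set P | exists a b c : R, [/\ 0 <= a, 0 <= b, 0 <= c, a + b + c = 1 &
    P = (a * A.1 + b * B.1 + c * C.1, a * A.2 + b * B.2 + c * C.2)]].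

(* hoelder_conjugate 1 = +oo and (+oo)^-1 = 0, so a = 0 when pl = 1 *)
Definition third_vertex (s : R) (pl pr : \bar R) : R * R :=
  let a := fine (s%:E * hoelder_conjugate pl)^-1%E in
  let b := fine (s%:E * hoelder_conjugate pr)^-1%E in
  ((2 + a) / (3 + a + b), (2 + b) / (3 + a + b)).

Definition exponent_triangle (s : R) (pl pr : \bar R) : set (R * R) :=
  triangle (1, 0) (0, 1) (third_vertex s pl pr).

Definition BQ_integrand (f : 'rV[R]_dR * 'rV[R]_l -> R[i])
    (g : 'rV[R]_dL * 'rV[R]_l -> R[i]) (w : 'rV[R]_dL * 'rV[R]_dR * 'rV[R]_l) :
    R[i] :=
  let: (x, y, z) := w in f (y, z + Q x y) * g (x, z).

Definition BQ (Omega : set ('rV[R]_dL * 'rV[R]_dR * 'rV[R]_l)) f g : R[i] :=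
  cintegral (completed (leb dL \x leb dR \x leb l))%E Omega (BQ_integrand f g).

(* The integrability clause says that BQ Omega f g is an honest Lebesgue
   integral, rather than a default value, for f in L^qL and g in L^qR. *)
Definition Lp_bounded (Omega : set ('rV[R]_dL * 'rV[R]_dR * 'rV[R]_l))
    (qL qR : R) : Prop :=
  exists C : R,
    forall (f : 'rV[R]_dR * 'rV[R]_l -> R[i]) (g : 'rV[R]_dL * 'rV[R]_l -> R[i]),
    completed_measurable_fun (leb dR \x leb l)%E f ->
    completed_measurable_fun (leb dL \x leb l)%E g ->
    let Nf := cLnorm (completed (leb dR \x leb l))%E qL%:E f in
    let Ng := cLnorm (completed (leb dL \x leb l))%E qR%:E g in
    ((Nf < +oo)%E -> (Ng < +oo)%E ->
      cintegrable (completed (leb dL \x leb dR \x leb l))%E Omega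
        (BQ_integrand f g)) /\
    ((Normc.normc (BQ Omega f g))%:E <= C%:E * Nf * Ng)%E.

Definition dist3 (v w : 'rV[R]_dL * 'rV[R]_dR * 'rV[R]_l) : R :=
  Num.sqrt (sqnorm (v.1.1 - w.1.1) + sqnorm (v.1.2 - w.1.2)
            + sqnorm (v.2 - w.2)).

Definition diameter (Omega : set ('rV[R]_dL * 'rV[R]_dR * 'rV[R]_l)) : \bar R :=
  ereal_sup [set (dist3 p.1 p.2)%:E | p in Omega `*` Omega].

End radon_like.

(* Main.v *)
Require Import Defs.
From HB Require Import structures.
From mathcomp Require Import finmap perm.
From mathcomp Require Import all_boot all_order all_algebra.
From mathcomp Require Import sesquilinear complex.
From mathcomp Require Import all_classical all_reals all_analysis.
From mathcomp Require Import measurable_realfun.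
From mathcomp Require Import ring lra zify.
Import Order.TTheory GRing.Theory Num.Theory.
Import numFieldNormedType.Exports.
Local Open Scope classical_set_scope.
Local Open Scope ring_scope.
Set Implicit Arguments. Unset Strict Implicit. Unset Printing Implicit Defensive.

(** Let f and g first be indicators of sets F and G.  Let Sigma be the set of
    incidences, the points (x, y, z) of Omega with (y, z + Q(x, y)) in F and
    (x, z) in G, and put sigma = |Sigma|, alpha = sigma / |G| and
    beta = sigma / |F|; the last two are the average sizes of the fibres of
    Sigma over G and over F.

    Paths.  A path consists of a point (x1, y1, z1) of Sigma, a second point of
    Sigma with the same y1 and the same point of F, whose first coordinate is
    x0, and a third point of Sigma with the same (x1, z1), whose second
    coordinate is y2.  After the points with thin fibres are discarded, half of
    Sigma remains ([popular_half]), and over each remaining point the pair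
    (x0, y2) ranges over a product of two sets of measures at least beta / 4 and
    alpha / 4.  Put u = x0 - x1 and v = y2 - y1.  The sublevel hypothesis,
    applied to the two sets translated by -x1 and -y1, says that
    Phi_Q(u, v) > lambda for most (u, v), where lambda^s is of the order of
    beta^(1/p_l') alpha^(1/p_r') ([good_pairs]).  Hence the paths with
    Phi_Q(u, v) > lambda have measure at least c sigma alpha beta
    ([path_set_ge]).

    On the other hand a path is determined by its end (x0, z0) in G, by y2 and
    by (u, v), and its other end is (y2, z0 + Q(x0, y2) - Q(u, v)), which lies
    in F.  For fixed x0, z0 and y2 the admissible (u, v) have measure at most
    C log(1/rho) / lambda times that of a fibre of F, provided |(u, v)| >= rho
    ([core_estimate]).  So the paths have measure at most
    C log(1/rho) lambda^-1 |F| |G| ([path_set_le]).  The logarithm costs an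
    arbitrarily small power, and with a = 1/(s p_l') and b = 1/(s p_r') the two
    bounds together read

      sigma^(3 + a + b + 2 eps) <= K |F|^(2 + a + eps) |G|^(2 + b + eps)

    ([path_estimate]), the restricted estimate near the third vertex of the
    triangle.  The vertices (1, 0) and (0, 1) are the trivial bounds
    sigma <= C |F| and sigma <= C |G|, and geometric means of the three fill the
    open triangle ([restricted_estimate], [interior_exponents]).

    The core estimate.  On a shell |(u, v)| ~ t with Vol_Q(u, v) > mu some
    l x l minor of the generators exceeds mu.  Its rows are derivatives of Q in
    l of the coordinates of (u, v), so that along these l coordinates Q becomes
    a quadratic map Psi from R^l to R^l whose Jacobian is that minor
    ([minor_slice]).  For such a map the set where the Jacobian is at least mu
    and Psi takes values in A has measure at most C_l |A| / mu
    ([quadratic_sublevel]): on small cubes Psi is close to its linearization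
    ([leb_patch]), and almost every value is taken at a number of points bounded
    in terms of l only, because each coordinate of a preimage is a root of a
    polynomial whose coefficients are polynomials in the value
    ([generic_fiber]).  Integration over the l-dimensional slices and summation
    over the shells gives the core estimate.

    From indicators to functions.  The restricted estimate holds with the same
    constant for all exponents near the given ones.  Splitting |f| and |g| into
    dyadic level sets and moving the exponents by d to one side for levels above
    the norm, to the other side for levels below it, leaves a product of two
    geometric series ([strong_type_of_levels]).  Level sets are Lebesgue
    measurable; they are replaced by Borel hulls of the same measure
    ([borel_hull]), and the integrand is measurable because the maps
    (x, y, z) |-> (y, z + Q(x, y)) and (x, y, z) |-> (x, z) pull null sets back
    to null sets ([completed_preimage]).

    Omega enters through the differences of its points only.  If its diameter is
    small these lie in the given neighbourhoods of the origin, so the local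
    statement has the same proof. *)

(** * Invariance of Lebesgue measure under translations, reflections and shears *)

Section lebesgue_invariance.
Context {R : realType}.
Local Open Scope ereal_scope.
Notation mu := (@lebesgue_measure R).

Lemma measurable_affine1 (e c : R) :
  measurable_fun [set: measurableTypeR R]
    (fun a : measurableTypeR R => (c + e * a)%R : measurableTypeR R).
Proof.
apply: measurable_funD; first exact: measurable_cst.
exact: mulrl_measurable.
Qed.

(** The hypothesis e * e = 1 covers translations and reflections at once; both maps
    are needed, since paths involve the differences x0 - x1 as functions of x1. *)
Lemma lebesgue_measure_affine1 (e c : R) (A : set (measurableTypeR R)) :
  (e * e = 1)%R -> measurable A ->
  mu ((fun a => c + e * a)%R @^-1` A) = mu A.
Proof.
move=> ee mA.
pose f : measurableTypeR R -> measurableTypeR R := fun a => (c + e * a)%R.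
have mf : measurable_fun setT f by exact: measurable_affine1.
pose F : {mfun measurableTypeR R >-> measurableTypeR R} :=
  HB.pack f (isMeasurableFun.Build _ _ _ _ _ mf).
apply/esym/(@lebesgue_measure_unique R (pushforward mu F)) => // _ [[a b] /= _ <-].
rewrite /pushforward/= /f.
have [->|->] : (e = 1 \/ e = -1)%R.
  have /eqP := ee; rewrite -expr2 -subr_eq0 subr_sqr_1 mulf_eq0 subr_eq0 addr_eq0.
  by move=> /orP[] /eqP ->; [left|right].
- rewrite (_ : _ @^-1` _ = `](a - c)%R, (b - c)%R]%classic); last first.
    by apply/seteqP; split => x /=; rewrite !in_itv/=; lra.
  rewrite !lebesgue_measure_itv/= !lte_fin ltrD2r; case: ifPn => // _.
  by rewrite -!EFinB; congr EFin; lra.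
- rewrite (_ : _ @^-1` _ = `[(c - b)%R, (c - a)%R[%classic); last first.
    by apply/seteqP; split => x /=; rewrite !in_itv/=; lra.
  rewrite !lebesgue_measure_itv/= !lte_fin ltrD2l ltrN2; case: ifPn => // _.
  by rewrite -!EFinB; congr EFin; lra.
Qed.

Lemma ge0_integral_affine1 (e c : R) (h : R -> \bar R) :
  (e * e = 1)%R -> measurable_fun [set: R] h -> (forall a, 0 <= h a) ->
  \int[mu]_a h (c + e * a)%R = \int[mu]_a h a.
Proof.
move=> ee mh h0.
have := @ge0_integral_pushforward _ _ _ _ R _ (measurable_affine1 e c) mu setT h
  measurableT mh (fun y _ => h0 y).
rewrite preimage_setT => <-.
apply: eq_measure_integral => [|? A mA _]; first exact: measurable_affine1.
exact: lebesgue_measure_affine1.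
Qed.

End lebesgue_invariance.

Section leb_invariance.
Context {R : realType}.
Local Open Scope ereal_scope.
Notation mu := (@lebesgue_measure R).

Lemma lebSE n (A : set 'rV[R]_n.+1) :
  leb n.+1 A = \int[mu]_a leb n [set v | A (cons_rV (a, v))].
Proof.
rewrite /= /cons_measure /pushforward /product_measure1.
apply: eq_integral => a _ /=; congr (leb n _).
by apply/seteqP; split => v; rewrite /xsection/= inE.
Qed.

Lemma measurable_cons_rV_section n (A : set 'rV[R]_n.+1) (a : R) :
  measurable A -> measurable [set v | A (cons_rV (a, v))].
Proof.
move=> mA; have mf : measurable_fun setT (fun v : 'rV[R]_n => cons_rV (a, v)).
  apply: (measurableT_comp (@measurable_cons_rV R n)).
  exact: measurable_pair1.
by have := mf measurableT A mA; rewrite setTI.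
Qed.

Lemma measurable_leb_section n (A : set 'rV[R]_n.+1) : measurable A ->
  measurable_fun [set: R] (fun a : R => leb n [set v | A (cons_rV (a, v))]).
Proof.
move=> mA.
have mB : measurable (@cons_rV R n @^-1` A).
  by have := @measurable_cons_rV R n measurableT A mA; rewrite setTI.
have := measurable_fun_xsection (leb n) mB.
apply: eq_measurable_fun => a _ /=; congr (leb n _).
by apply/seteqP; split => v; rewrite /xsection/= inE.
Qed.

Lemma cons_rV_affine n (e a c0 : R) (v c : 'rV[R]_n) :
  (cons_rV (c0, c) + e *: cons_rV (a, v) = cons_rV (c0 + e * a, c + e *: v))%R.
Proof.
apply/rowP => i; rewrite [LHS]mxE [X in (_ + X)%R]mxE.
case: (unliftP ord0 i) => [j|] ->.
  by rewrite !cons_rVS/= !mxE.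
by rewrite !cons_rV0.
Qed.

Lemma cons_rVK n (v : 'rV[R]_n.+1) :
  v = cons_rV (v 0 0, \row_j v 0 (lift ord0 j))%R.
Proof.
apply/rowP => i; case: (unliftP ord0 i) => [j|] ->.
  by rewrite cons_rVS mxE.
by rewrite cons_rV0.
Qed.

Lemma measurable_affine n (e : R) (c : 'rV[R]_n) :
  measurable_fun setT (fun v : 'rV[R]_n => c + e *: v)%R.
Proof.
apply: measurable_fun_mxP => i j.
under eq_fun do rewrite !mxE.
apply: measurable_funD; first exact: measurable_cst.
apply: measurable_funM; first exact: measurable_cst.
exact: measurable_mx_coord.
Qed.

Lemma leb_affine n (e : R) (c : 'rV[R]_n) (A : set 'rV[R]_n) :
  (e * e = 1)%R -> measurable A ->
  leb n [set v | A (c + e *: v)%R] = leb n A.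
Proof.
move=> ee; elim: n c A => [|n IHn] c A mA.
  by congr (leb 0 _); apply/seteqP; split => v /=; rewrite (thinmx0 v) (thinmx0 (_ + _)%R).
rewrite !lebSE (cons_rVK c); set c0 := c _ _; set c' := \row_j _.
transitivity (\int[mu]_a leb n [set v | A (cons_rV (c0 + e * a, v))]%R).
  apply: eq_integral => a _; rewrite -[RHS](IHn c').
    by congr (leb n _); apply/funext => v /=; rewrite cons_rV_affine.
  exact: measurable_cons_rV_section.
apply: (@ge0_integral_affine1 _ e c0 (fun a => leb n [set v | A (cons_rV (a, v))])) => //.
exact: measurable_leb_section.
Qed.

End leb_invariance.

Lemma product_measureEy d1 d2 (T1 : measurableType d1) (T2 : measurableType d2)
  (R : realType) (m1 : {sigma_finite_measure set T1 -> \bar R})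
  (m2 : {sigma_finite_measure set T2 -> \bar R}) (A : set (T1 * T2)) :
  measurable A -> (m1 \x m2)%E A = (\int[m2]_y m1 (ysection A y))%E.
Proof.
move=> mA; suff -> : (m1 \x m2)%E A = (m1 \x^ m2)%E A by [].
apply: (@product_measure_unique _ _ _ _ _ m1 m2 (m1 \x^ m2)%E _ A mA).
move=> B C mB mC; exact: product_measure2E.
Qed.

Section leb_shear.
Context {R : realType}.
Local Open Scope ereal_scope.
Notation mu := (@lebesgue_measure R).

Lemma lebSEy n (A : set 'rV[R]_n.+1) : measurable A ->
  leb n.+1 A = \int[leb n]_v mu [set a | A (cons_rV (a, v))].
Proof.
move=> mA; rewrite /= /cons_measure /pushforward product_measureEy; last first.
  by have := @measurable_cons_rV R n measurableT A mA; rewrite setTI.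
apply: eq_integral => v _; congr (mu _).
by apply/seteqP; split => a; rewrite /ysection/= inE.
Qed.

Lemma measurable_mulmxr m n p (D : 'M[R]_(n, p)) :
  measurable_fun setT (fun v : 'M[R]_(m, n) => v *m D).
Proof.
apply: measurable_fun_mxP => i j.
under eq_fun do rewrite !mxE.
apply: measurable_sum => k.
apply: measurable_funM; last exact: measurable_cst.
exact: measurable_mx_coord.
Qed.

Lemma measurable_preimage_mulmxr n p (D : 'M[R]_(n, p)) (A : set 'rV[R]_p) :
  measurable A -> measurable [set v : 'rV[R]_n | A (v *m D)].
Proof. by move=> mA; rewrite -[X in measurable X]setTI; exact: measurable_mulmxr. Qed.

(** Tonelli: for a fixed first coordinate the shear is a translation of the others. *)
Lemma leb_shear_row n (r : 'rV[R]_n) (A : set 'rV[R]_n.+1) : measurable A ->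
  leb n.+1 [set w | A (w *m block_mx 1%:M r 0%R 1%:M)] = leb n.+1 A.
Proof.
move=> mA; rewrite !lebSE; apply: eq_integral => a _.
rewrite -[RHS](@leb_affine R n 1 (a *: r)%R) ?mulr1//; last first.
  exact: measurable_cons_rV_section.
congr (leb n _); apply/funext => v /=; congr A.
by rewrite /cons_rV/= mul_row_block !mulmx0 !mulmx1 addr0 scale1r mul_scalar_mx.
Qed.

(** Tonelli in the other order: for fixed last coordinates the shear is a
    translation of the first one. *)
Lemma leb_shear_col n (c : 'cV[R]_n) (A : set 'rV[R]_n.+1) : measurable A ->
  leb n.+1 [set w | A (w *m block_mx 1%:M 0%R c 1%:M)] = leb n.+1 A.
Proof.
move=> mA; rewrite !lebSEy//; last exact: measurable_preimage_mulmxr.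
apply: eq_integral => v _.
rewrite -[RHS](@lebesgue_measure_affine1 R 1 ((v *m c) 0 0)%R) ?mulr1//; last first.
  have mf : measurable_fun setT (fun a : measurableTypeR R => cons_rV (a, v)).
    exact: (measurableT_comp (@measurable_cons_rV R n)).
  by have := mf measurableT A mA; rewrite setTI.
congr (mu _); apply/funext => a /=; congr A.
rewrite /cons_rV/= mul_row_block !mulmx0 !mulmx1 add0r mul1r.
suff -> : (a%:M + v *m c = ((v *m c) 0 0 + a)%:M)%R by [].
by apply/matrixP => i j; rewrite !ord1 [LHS]mxE !mxE/= !mulr1n addrC.
Qed.

Lemma measurable_cube n (c : 'rV[R]_n) (h : R) :
  measurable [set v : 'rV[R]_n | forall i, (`|v 0 i - c 0 i| <= h)%R].
Proof.
rewrite [X in measurable X](_ : _ = \bigcap_(i in [set: 'I_n])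
  (fun v : 'rV[R]_n => v 0%R i) @^-1` [set a | (`|a - c 0%R i| <= h)%R]).
  apply: fin_bigcap_measurable => // i _.
  have := @measurable_mx_coord R 1 n 0%R i measurableT [set a | (`|a - c 0%R i| <= h)%R].
  rewrite setTI; apply.
  rewrite (_ : [set a | _] = `[(c 0 i - h)%R, (c 0 i + h)%R]%classic)//.
  by apply/seteqP; split => x /=; rewrite in_itv/= ler_distl.
by apply/seteqP; split => [v H i _|v H i]; [exact: H|exact: (H i)].
Qed.

End leb_shear.

Section leb_linear.
Context {R : realType}.
Notation mu := (@lebesgue_measure R).

(** Gaussian elimination.  A row shear makes the corner entry d of D nonzero and a
    column shear clears the entries below it; neither changes the measure or the
    determinant.  Then the first coordinate is confined to an interval of length
    2h/|d|, and the others are handled by induction with the Schur complement. *)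
Lemma leb_linear_preimage_cube n (D : 'M[R]_n) (c : 'rV[R]_n) (h : R) :
  0 <= h -> \det D != 0 ->
  (leb n [set v | forall i, (`|(v *m D) 0 i - c 0 i| <= h)%R] <=
    ((2 * h) ^+ n / `|\det D|)%:E)%E.
Proof.
move=> h0; elim: n D c => [|n IHn] D c detD.
  by rewrite det_mx00 expr0 normr1 divr1 /= diracE lee_fin; case: (_ \in _).
move: D c detD; rewrite -[n.+1]/(1 + n)%N => D c detD.
pose C p (c : 'rV[R]_p) := [set v : 'rV[R]_p | forall i, (`|v 0 i - c 0 i| <= h)].
have mC p (c' : 'rV[R]_p) : measurable (C p c') by exact: measurable_cube.
rewrite -[X in leb _ X]/[set v | C _ c (v *m D)].
wlog D00 : D detD / (D 0 0 != 0) => [hw|].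
  have [D00|D00] := eqVneq (D 0 0) 0; last exact: hw.
  have [j Dj] : exists j : 'I_n, (D (lift ord0 j) 0 != 0).
    apply: contrapT => /forallNP H; move/eqP: detD; apply.
    rewrite (expand_det_col D 0) big1// => i _.
    case: (unliftP ord0 i) => [j ->|->]; last by rewrite D00 mul0r.
    by have /negP := H j; rewrite negbK => /eqP ->; rewrite mul0r.
  (* adds row j of the lower block to the first row, making the corner nonzero *)
  pose T : 'M[R]_(1 + n) := block_mx 1%:M (delta_mx 0 j) 0 1%:M.
  have detT : \det T = 1 by rewrite /T det_ublock !det1 mulr1.
  have detTD : \det (T *m D) = \det D by rewrite det_mulmx detT mul1r.
  rewrite -(@leb_shear_row R n (delta_mx 0 j)) /=; last exact: measurable_preimage_mulmxr.
  under eq_set do rewrite -mulmxA.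
  rewrite -detTD; apply: hw; first by rewrite detTD.
  rewrite /T -(submxK D) mulmx_block !mul1mx.
  rewrite (_ : 0 = lshift n (0 : 'I_1)); last exact/val_inj.
  rewrite block_mxEul !mxE (bigD1 j)//= big1 ?addr0; last first.
    by move=> k kj; rewrite !mxE eqxx (negbTE kj) mul0r.
  rewrite !mxE !eqxx mul1r.
  rewrite (_ : lshift n (0 : 'I_1) = 0); last exact/val_inj.
  by rewrite (_ : rshift 1 j = lift ord0 j) ?D00 ?add0r//; exact/val_inj.
pose d := D 0 0.
pose ul := ulsubmx D; pose ur := ursubmx D.
pose dl := dlsubmx D; pose dr := drsubmx D.
have ulE : ul = d%:M.
  rewrite /ul (mx11_scalar (ulsubmx _)); congr (_%:M).
  by rewrite /ulsubmx !mxE /d; congr (D _ _); exact/val_inj.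
(* clears the first column below the corner; D' is the Schur complement *)
pose T : 'M[R]_(1 + n) := block_mx 1%:M 0 (- d^-1 *: dl) 1%:M.
pose D' := (dr - d^-1 *: (dl *m ur)).
have detT : \det T = 1 by rewrite /T det_lblock !det1 mulr1.
have TD : T *m D = block_mx d%:M ur 0 D'.
  rewrite /T -[in LHS](submxK D) mulmx_block !mul1mx.
  rewrite -/ul -/ur -/dl -/dr !mul0mx !addr0 ulE; congr block_mx.
    by rewrite -scalemxAl mul_mx_scalar scalerA mulNr mulVf// scaleN1r addNr.
  by rewrite /D' addrC -scalemxAl scaleNr.
have detE : \det D = (d * \det D').
  by rewrite -[LHS]mul1r -detT -det_mulmx TD det_ublock det_scalar1.
have detD' : (\det D' != 0) by move: detD; rewrite detE mulf_eq0 negb_or => /andP[].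
rewrite -(@leb_shear_col R n (- d^-1 *: dl)) /=; last exact: measurable_preimage_mulmxr.
under eq_set do rewrite -mulmxA.
rewrite -/T TD (cons_rVK c) lebSE; set c0 := c _ _; set c' := \row_j _.
pose K := ((2 * h) ^+ n / `|\det D'|).
have K0 : (0 <= K) by rewrite divr_ge0// exprn_ge0// mulr_ge0.
pose I := [set a : R | (`|a * d - c0| <= h)].
have IE : I = `[((c0 - Num.sg d * h) / d), ((c0 + Num.sg d * h) / d)]%classic.
  apply/seteqP; split => a; rewrite /I/= in_itv/=.
    case: (ltrgt0P d) D00 => //; rewrite -/d => d0 _.
      rewrite gtr0_sg// !mul1r ler_pdivrMr// ler_pdivlMr//. rewrite ler_distl//.
    by rewrite ltr0_sg// !mulN1r ler_ndivrMr// ler_ndivlMr// opprK ler_distl andbC.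
  case: (ltrgt0P d) D00 => //; rewrite -/d => d0 _.
    by rewrite gtr0_sg// !mul1r ler_pdivrMr// ler_pdivlMr// ler_distl.
  by rewrite ltr0_sg// !mulN1r ler_ndivrMr// ler_ndivlMr// opprK ler_distl andbC.
have mI : measurable I by rewrite IE.
apply: (@le_trans _ _ (\int[mu]_a (K%:E * (\1_I a)%:E))%E).
  apply: ge0_le_integral => //.
  - by apply: measurable_leb_section; exact: measurable_preimage_mulmxr.
  - apply: measurable_funeM; apply/measurable_EFinP; exact: measurable_indic.
  move=> a _; rewrite indicE.
  have E v : cons_rV (a, v) *m block_mx d%:M ur 0 D' =
      cons_rV (a * d, a *: ur + v *m D') :> 'rV[R]_(1 + n).
    rewrite [LHS](_ : _ = row_mx a%:M v *m block_mx d%:M ur 0 D')//.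
    by rewrite mul_row_block !mulmx0 addr0 -scalar_mxM mul_scalar_mx.
  have [aI|aI] := boolP (a \in I).
    rewrite mule1; apply: le_trans (IHn D' (c' - a *: ur) detD').
    apply: le_measure; rewrite ?inE.
    - by apply: measurable_cons_rV_section; exact: measurable_preimage_mulmxr.
    - by apply: (@measurable_preimage_mulmxr R n n D' (C n (c' - a *: ur)) (mC _ _)).
    move=> v /=; rewrite E => H i; have := H (lift ord0 i).
    by rewrite !cons_rVS/= !mxE opprB addrCA addrA.
  rewrite mule0 [X in leb n X](_ : _ = set0) ?measure0//.
  apply/seteqP; split => // v /=; rewrite E => /(_ ord0); rewrite !cons_rV0/= => H.
  by move/negP: aI; rewrite inE.
rewrite ge0_integralZl_EFin//; last first.
  by apply/measurable_EFinP; exact: measurable_indic.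
have muI : (mu I <= (2 * h / `|d|)%:E)%E.
  rewrite IE lebesgue_measure_itv/= lte_fin; case: ifPn => _; last first.
    by rewrite lee_fin divr_ge0// mulr_ge0.
  rewrite -EFinB lee_fin; rewrite le_eqVlt; apply/orP; left; apply/eqP; rewrite [in RHS]normrEsg invfM.
  case: (ltrgt0P d) D00 => //; rewrite -/d => d0 _.
    by rewrite gtr0_sg// invr1; ring.
  by rewrite ltr0_sg// invrN invr1; ring.
rewrite integral_indic// setIT.
have -> : (2 * h) ^+ n.+1 / `|\det D| = K * (2 * h / `|d|).
  by rewrite detE normrM exprS /K invfM; ring.
by rewrite (EFinM K) lee_wpmul2l// lee_fin.
Qed.

End leb_linear.

(** * Polynomial functions and their zero sets *)

Section polynomial_functions.
Context {R : realType} {n : nat}.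

(** Polynomial functions given by their construction, with an upper bound for the
    degree: all that is used of them is proved by induction on this derivation. *)
Inductive polyle : nat -> ('rV[R]_n -> R) -> Prop :=
| polyle_cst d c : polyle d (fun=> c)
| polyle_coord d i : (0 < d)%N -> polyle d (fun v => v 0 i)
| polyleD d f g : polyle d f -> polyle d g -> polyle d (fun v => f v + g v)
| polyleM d e f g : polyle d f -> polyle e g -> polyle (d + e) (fun v => f v * g v).

Definition monom (m : 'I_n -> nat) (v : 'rV[R]_n) : R := \prod_i v 0 i ^+ m i.

(** The index set bounds the degree in each variable by d, which makes the space of
    these functions of dimension at most (d + 1)^n. *)
Definition expansion d (f : 'rV[R]_n -> R) :=
  exists c : {ffun 'I_n -> 'I_d.+1} -> R, forall v, f v = \sum_m c m * monom (fun i => m i) v.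

Lemma expansion_monom d m c : (forall i, m i <= d)%N -> expansion d (fun v => c * monom m v).
Proof.
move=> md; pose m0 := [ffun i => inord (m i)] : {ffun 'I_n -> 'I_d.+1}.
exists (fun m' => if m' == m0 then c else 0) => v.
rewrite (bigD1 m0)//= eqxx big1 ?addr0; last by move=> m' /negbTE ->; rewrite mul0r.
by congr (_ * _); apply: eq_bigr => i _; rewrite ffunE inordK// ltnS.
Qed.

Lemma expansion_sum d (I : finType) (F : I -> 'rV[R]_n -> R) :
  (forall i, expansion d (F i)) -> expansion d (fun v => \sum_i F i v).
Proof.
move=> /choice[c cE]; exists (fun m => \sum_i c i m) => v.
under eq_bigr do rewrite cE.
by rewrite exchange_big/=; apply: eq_bigr => m _; rewrite mulr_suml.
Qed.

Lemma polyle_expansion d f : polyle d f -> expansion d f.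
Proof.
elim=> [e c|e i e0|e f1 f2 _ [c1 c1E] _ [c2 c2E]|e1 e2 f1 f2 _ [c1 c1E] _ [c2 c2E]].
- rewrite (_ : (fun=> c) = (fun v => c * monom (fun=> 0%N) v)); first exact: expansion_monom.
  by apply/funext => v; rewrite /monom big1 ?mulr1// => i _; rewrite expr0.
- rewrite (_ : (fun v => _) = (fun v => 1 * monom (fun j => (j == i) : nat) v)).
    by apply: expansion_monom => j; case: (j == i).
  apply/funext => v; rewrite /monom mul1r (bigD1 i)//= eqxx expr1 big1 ?mulr1//.
  by move=> j /negbTE ->; rewrite expr0.
- exists (fun m => c1 m + c2 m) => v; rewrite c1E c2E -big_split/=.
  by apply: eq_bigr => m _; rewrite mulrDl.
- rewrite (_ : (fun v => _) = (fun v => \sum_m1 \sum_m2 (c1 m1 * c2 m2) *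
      monom (fun i => m1 i + m2 i)%N v)).
    apply: expansion_sum => m1; apply: expansion_sum => m2; apply: expansion_monom => i.
    by apply: leq_add; rewrite -ltnS.
  apply/funext => v; rewrite c1E c2E mulr_suml; apply: eq_bigr => m1 _.
  rewrite mulr_sumr; apply: eq_bigr => m2 _; rewrite mulrACA; congr (_ * _).
  by rewrite /monom -big_split/=; apply: eq_bigr => i _; rewrite exprD.
Qed.

(** More than (d + 1)^n functions in a space spanned by (d + 1)^n monomials. *)
Lemma linear_dependence (T : finType) d (F : T -> 'rV[R]_n -> R) :
  (forall t, polyle d (F t)) -> ((d.+1) ^ n < #|T|)%N ->
  exists c : T -> R, (exists t, c t != 0) /\ forall v, \sum_t c t * F t v = 0.
Proof.
move=> /(_ _)/polyle_expansion eF dT; have [b bE] := choice eF.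
pose E := {ffun 'I_n -> 'I_d.+1}.
pose M : 'M[R]_(#|T|, #|{: E}|) := \matrix_(i, j) b (enum_val i) (enum_val j).
have : kermx M != 0.
  rewrite kermx_eq0 /row_free; apply/negP => /eqP rM.
  have := rank_leq_col M; rewrite rM card_ffun !card_ord leqNgt => /negP; exact.
move=> /rowV0Pn[u /sub_kermxP uM /rV0Pn[j uj]].
exists (fun t => u 0 (enum_rank t)); split; first by exists (enum_val j); rewrite enum_valK.
move=> v; under eq_bigr do rewrite bE mulr_sumr.
rewrite exchange_big/= big1// => m _.
under eq_bigr do rewrite mulrA.
rewrite -mulr_suml (_ : \sum_t _ = 0) ?mul0r//.
have /matrixP/(_ 0 (enum_rank m)) := uM; rewrite !mxE; apply: etrans.
rewrite (reindex (@enum_val T T))/=; last by apply: onW_bij; exact: enum_val_bij.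
by apply: eq_bigr => i _; rewrite !mxE enum_valK enum_rankK.
Qed.

Lemma polyle_sum d (I : Type) (s : seq I) (F : I -> 'rV[R]_n -> R) :
  (forall i, polyle d (F i)) -> polyle d (fun v => \sum_(i <- s) F i v).
Proof.
move=> dF; elim: s => [|i s IHs].
  by under eq_fun do rewrite big_nil; exact: polyle_cst.
by under eq_fun do rewrite big_cons; exact: polyleD.
Qed.

Lemma polyleX d k f : polyle d f -> polyle (k * d) (fun v => f v ^+ k).
Proof.
move=> df; elim: k => [|k IHk]; first exact: polyle_cst.
by under eq_fun do rewrite exprS; rewrite mulSn; exact: polyleM.
Qed.

Lemma polyle_prod d (I : Type) (s : seq I) (F : I -> 'rV[R]_n -> R) :
  (forall i, polyle d (F i)) -> polyle (size s * d) (fun v => \prod_(i <- s) F i v).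
Proof.
move=> dF; elim: s => [|i s IHs].
  by under eq_fun do rewrite big_nil; exact: polyle_cst.
by under eq_fun do rewrite big_cons; rewrite /= mulSn; exact: polyleM.
Qed.

Lemma polyleW d e f : (d <= e)%N -> polyle d f -> polyle e f.
Proof.
move=> de df; have := polyleM (polyle_cst (e - d) 1) df; rewrite subnK//.
by under eq_fun do rewrite mul1r.
Qed.

Lemma measurable_polyle d f : polyle d f -> measurable_fun setT f.
Proof.
elim=> [e c|e i _|e f1 f2 _ m1 _ m2|e1 e2 f1 f2 _ m1 _ m2].
- exact: measurable_cst.
- exact: measurable_mx_coord.
- exact: measurable_funD.
- exact: measurable_funM.
Qed.

Lemma continuous_polyle d f : polyle d f -> continuous f.
Proof.
elim=> [e c|e i _|e f1 f2 _ m1 _ m2|e1 e2 f1 f2 _ m1 _ m2] v.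
- exact: cst_continuous.
- exact: coord_continuous.
- exact: (continuousD (m1 v) (m2 v)).
- exact: (continuousM (m1 v) (m2 v)).
Qed.

End polynomial_functions.

Section polyle_null.
Context {R : realType}.

Lemma polyle_slice n d (f : 'rV[R]_n.+1 -> R) a :
  polyle d f -> polyle d (fun v => f (cons_rV (a, v))).
Proof.
elim=> [e c|e i e0|e f1 f2 _ m1 _ m2|e1 e2 f1 f2 _ m1 _ m2].
- exact: polyle_cst.
- case: (unliftP ord0 i) => [j|] ->.
    by under eq_fun do rewrite cons_rVS; exact: polyle_coord.
  by under eq_fun do rewrite cons_rV0; exact: polyle_cst.
- exact: polyleD.
- exact: polyleM.
Qed.

Lemma polyle_poly1 n d (f : 'rV[R]_n.+1 -> R) v :
  polyle d f -> exists p : {poly R}, forall a, f (cons_rV (a, v)) = p.[a].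
Proof.
elim=> [e c|e i e0|e f1 f2 _ [p1 E1] _ [p2 E2]|e1 e2 f1 f2 _ [p1 E1] _ [p2 E2]].
- by exists c%:P => a; rewrite hornerC.
- case: (unliftP ord0 i) => [j|] ->.
    by exists (v 0 j)%:P => a; rewrite cons_rVS hornerC.
  by exists 'X => a; rewrite cons_rV0 hornerX.
- by exists (p1 + p2) => a; rewrite hornerD E1 E2.
- by exists (p1 * p2) => a; rewrite hornerM E1 E2.
Qed.

Lemma poly_roots_seq (p : {poly R}) : p != 0 ->
  exists2 s : seq R, (size s < size p)%N & forall a, root p a -> a \in s.
Proof.
elim: (size p) {-2}p (leqnn (size p)) => [|k IHk] q qk q0.
  by move: qk; rewrite leqn0 size_poly_eq0 (negbTE q0).
have [[x qx]|nq] := pselect (exists x, root q x); last first.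
  exists [::]; first by rewrite size_poly_gt0.
  by move=> a qa; exfalso; apply: nq; exists a.
have [r rE] := factor_theorem _ _ qx; move: (qx).
have r0 : r != 0 by apply: contra_neq q0 => r0; rewrite rE r0 mul0r.
have sq : size q = (size r).+1 by rewrite rE size_Mmonic ?monicXsubC// size_XsubC addn2.
have [|s ss sE] := IHk r _ r0; first by rewrite -ltnS -sq.
exists (x :: s); first by rewrite sq.
by move=> a; rewrite rE rootM root_XsubC inE => /orP[/sE ->|->//]; rewrite orbT.
Qed.

Lemma lebesgue_measure_roots (p : {poly R}) : p != 0 ->
  lebesgue_measure [set a : R | p.[a] = 0] = 0%E.
Proof.
move=> p0; apply: countable_lebesgue_measure0; apply: finite_set_countable.
have [s _ sE] := poly_roots_seq p0.
by apply: sub_finite_set (finite_seq s) => a /= pa; apply: sE; apply/rootP.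
Qed.

Lemma measurable_cons_rV_preimage n (A : set 'rV[R]_n.+1) :
  measurable A -> measurable (@cons_rV R n @^-1` A).
Proof. by move=> mA; have := @measurable_cons_rV R n measurableT A mA; rewrite setTI. Qed.

(** By induction the slice of f through v0 vanishes on a null set only.  Along a line
    in the first direction that meets this slice at a point where f does not vanish,
    f is a nonzero polynomial in one variable. *)
Lemma polyle_null n d (f : 'rV[R]_n -> R) (v0 : 'rV[R]_n) : polyle d f -> f v0 != 0 ->
  leb n [set v | f v = 0] = 0%E.
Proof.
elim: n f v0 => [|n IHn] f v0 df fv0.
  rewrite /= diracE memNset//= => f0; move: fv0.
  by rewrite (thinmx0 v0) f0 eqxx.
have mZ m (g : 'rV[R]_m -> R) : polyle d g -> measurable [set v | g v = 0].
  move=> dg; have := measurable_polyle dg measurableT (measurable_set1 (0 : R)).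
  by rewrite setTI.
rewrite lebSEy; last exact: mZ.
have dg := polyle_slice (v0 0 0) df.
have gv0 : f (cons_rV (v0 0 0, \row_j v0 0 (lift ord0 j))) != 0 by rewrite -cons_rVK.
have N0 := IHn _ _ dg gv0.
rewrite (ge0_negligible_integral (mZ _ _ dg))//; last first.
  have := measurable_fun_ysection (@lebesgue_measure R) (measurable_cons_rV_preimage (mZ _ _ df)).
  apply: eq_measurable_fun => v _ /=; congr (lebesgue_measure _).
  by apply/seteqP; split => a; rewrite /ysection/= inE.
apply: integral0_eq => v [_ /= /eqP gv].
have [p pE] := polyle_poly1 v df.
under eq_set do rewrite pE.
apply: lebesgue_measure_roots; apply: contra_neq gv.
by rewrite pE => ->; rewrite horner0.
Qed.

End polyle_null.

(** * Generic fibres of polynomial maps *)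

Section generic_fibers.
Context {R : realType} {l e : nat}.
Variable Psi : 'rV[R]_l -> 'rV[R]_l.
Hypothesis dPsi : forall k, polyle e (fun v => Psi v 0 k).

(** For maps of degree e on R^l, this D makes (D + 1)^(l + 1), the number of products
    of a power of v_i and a basis function of Psi(v), larger than the dimension of
    the space of polynomials that contains them. *)
Definition fiber_bound (l e : nat) := ((e * l).+1 ^ l)%N.
Let D := fiber_bound l e.

(* Lagrange basis up to scalars for the grid {0, ..., D}^l: a combination of these
   functions with a nonzero coefficient at m is nonzero at node m *)
Let basis (m : {ffun 'I_l -> 'I_D.+1}) (w : 'rV[R]_l) : R :=
  \prod_(k <- enum 'I_l) \prod_(j <- rem (m k) (enum 'I_D.+1)) (w 0 k - j%:R).

Let node (m : {ffun 'I_l -> 'I_D.+1}) : 'rV[R]_l := \row_k (m k)%:R.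

Let basis_node m m' : (basis m (node m') == 0) = (m != m').
Proof.
rewrite /basis prodf_seq_eq0; apply/hasP/idP => [[k _ /=]|].
  rewrite prodf_seq_eq0 => /hasP[j]; rewrite mem_rem_uniq ?enum_uniq// inE mem_enum andbT.
  move=> jm /=; rewrite mxE subr_eq0 eqr_nat => /eqP/val_inj E.
  by apply: contra_neq jm => ->; rewrite E.
move=> mm'; have [k km] : exists k, m k != m' k.
  apply: contrapT => /forallNP H; move/eqP: mm'; apply; apply/ffunP => k.
  by apply/eqP; have /negP := H k; rewrite negbK.
exists k; rewrite ?mem_enum//= prodf_seq_eq0; apply/hasP; exists (m' k).
  by rewrite mem_rem_uniq ?enum_uniq// inE mem_enum andbT eq_sym.
by rewrite /= mxE subrr.
Qed.

Let polyle_basis m k (f : 'I_l -> 'rV[R]_l -> R) : (forall j, polyle k (f j)) ->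
  polyle (l * (D * k)) (fun v => basis m (\row_j f j v)).
Proof.
move=> df; rewrite (_ : (l * _ = size (enum 'I_l) * (D * k))%N); last by rewrite size_enum_ord.
apply: polyle_prod => i.
rewrite (_ : (D * k = size (rem (m i) (enum 'I_D.+1)) * k)%N); last by rewrite size_rem ?mem_enum// size_enum_ord.
apply: polyle_prod => j.
under eq_fun do rewrite mxE.
by apply: polyleD => //; exact: polyle_cst.
Qed.

(** There are more functions v_i^j basis_m(Psi(v)) than the dimension of a space of
    polynomials in v that contains them, so there is a relation
    sum_j p_j(Psi(v)) v_i^j = 0 with some p_a not identically zero.  Off the null set
    where p_a = 0, the i-th coordinate of a preimage of w is a root of the nonzero
    polynomial with coefficients p_j(w). *)
Lemma generic_fiber_coord (i : 'I_l) :
  exists N : set 'rV[R]_l, [/\ measurable N, leb l N = 0%E & forall w, ~ N w ->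
    exists2 s : seq R, (size s <= D)%N & forall v, Psi v = w -> v 0 i \in s].
Proof.
have rowE (w : 'rV[R]_l) : \row_j w 0 j = w by apply/rowP => j; rewrite mxE.
have l0 : (0 < l)%N by case: (i) => k; case: (l).
pose T := ('I_D.+1 * {ffun 'I_l -> 'I_D.+1})%type.
pose F (t : T) (v : 'rV[R]_l) := v 0 i ^+ t.1 * basis t.2 (Psi v).
pose d := (D + l * (D * e))%N.
have dF t : polyle d (F t).
  apply: polyleM.
    apply: (@polyleW _ _ (t.1 * 1)%N); first by rewrite muln1 -ltnS.
    by apply: polyleX; exact: polyle_coord.
  have := polyle_basis t.2 dPsi.
  by under eq_fun do rewrite rowE.
have dT : (d.+1 ^ l < #|{: T}|)%N.
  rewrite card_prod card_ffun !card_ord.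
  apply: (@leq_ltn_trans (((e * l).+1 * D.+1) ^ l)%N).
    rewrite leq_exp2r// /d; lia.
  by rewrite expnMn ltn_pmul2r ?expn_gt0.
have [c [[[a m] cam] cF]] := linear_dependence dF dT.
pose p b (w : 'rV[R]_l) := \sum_m c (b, m) * basis m w.
have dp b : polyle (l * (D * 1)) (p b).
  apply: polyle_sum => m'; rewrite -[X in polyle X]add0n; apply: polyleM; first exact: polyle_cst.
  have := @polyle_basis m' 1 (fun j v => v 0 j) (fun j => polyle_coord j (ltn0Sn 0)).
  by under eq_fun do rewrite rowE.
exists [set w | p a w = 0]; split.
- by have := measurable_polyle (dp a) measurableT (measurable_set1 (0 : R)); rewrite setTI.
- apply: (@polyle_null _ _ _ _ (node m) (dp a)).
  rewrite /p (bigD1 m)//= big1 ?addr0.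
    by rewrite mulf_neq0// basis_node eqxx.
  move=> m' mm'; rewrite (_ : basis _ _ = 0) ?mulr0//.
  by apply/eqP; rewrite basis_node.
move=> w paw; pose P := \poly_(b < D.+1) p (inord b) w.
have P0 : P != 0.
  apply/eqP => /polyP/(_ a); rewrite coef_poly ltn_ord inord_val coef0.
  by move=> /= ?; apply: paw.
have [s ss sE] := poly_roots_seq P0.
exists s; first by rewrite -ltnS (leq_trans ss)// size_poly.
move=> v Pv; apply: sE; apply/rootP; rewrite horner_poly.
rewrite -[RHS](cF v) /p.
under eq_bigr do rewrite inord_val mulr_suml.
rewrite pair_big/=; apply: eq_bigr => -[b m'] _ /=.
by rewrite /F/= Pv; ring.
Qed.

Lemma generic_fiber : exists N : set 'rV[R]_l,
  [/\ measurable N, leb l N = 0%E & forall w, ~ N w ->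
    exists2 s : 'I_l -> seq R, (forall i, size (s i) <= D)%N &
      forall v, Psi v = w -> forall i, v 0 i \in s i].
Proof.
have /choice[N NP] := generic_fiber_coord.
pose F k := if insub k is Some i then N i else set0.
have : (leb l).-negligible (\bigcup_k F k).
  apply: negligible_bigcup => k; rewrite /F; case: insubP => [i _ _|_]; last exact: negligible_set0.
  by have [mN N0 _] := NP i; exists (N i); split.
move=> [N' [mN' N'0 FN']]; exists N'; split => // w Nw.
have /choice[s sP] : forall i, exists s : seq R, (size s <= D)%N /\
    forall v, Psi v = w -> v 0 i \in s.
  move=> i; have [_ _ /(_ w)[]] := NP i.
    by move=> Niw; apply/Nw/FN'; exists (val i) => //; rewrite /F valK.
  by move=> s ? ?; exists s.
exists s => [i|v Pv i]; first by have [] := sP i.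
by have [_] := sP i; exact.
Qed.

End generic_fibers.

(** * Comparison of measures on dyadic cubes *)

Section algebra_approximation.
Local Open Scope ereal_scope.
Context d (T : measurableType d) (R : realType).
Variables (G : set (set T)) (nu : {measure set T -> \bar R}).
Hypothesis (nufin : nu setT < +oo) (mG : G `<=` measurable).
Hypotheses (GC : forall A, G A -> G (~` A)) (GU : forall A B, G A -> G B -> G (A `|` B)).
Hypothesis (G0 : G set0).

Let symd (A B : set T) := (A `\` B) `|` (B `\` A).

Let approx := [set A | measurable A /\ forall e : R, (0 < e)%R ->
  exists2 B, G B & nu (symd A B) <= e%:E].

Let msymd A B : measurable A -> measurable B -> measurable (symd A B).
Proof. by move=> mA mB; apply: measurableU; exact: measurableD. Qed.

Let approxC A : approx A -> approx (~` A).
Proof.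
move=> [mA aA]; split; first exact: measurableC.
move=> e e0; have [B GB AB] := aA _ e0; exists (~` B); first exact: GC.
rewrite (_ : symd _ _ = symd A B)//.
by rewrite /symd; apply/seteqP; split => x /=; have [] := pselect (A x); have [] := pselect (B x); tauto.
Qed.

Let approxU A A' : approx A -> approx A' -> approx (A `|` A').
Proof.
move=> [mA aA] [mA' aA']; split; first exact: measurableU.
move=> e e0; have e20 : (0 < e / 2)%R by rewrite divr_gt0.
have [B GB AB] := aA _ e20; have [B' GB' AB'] := aA' _ e20.
exists (B `|` B'); first exact: GU.
apply: (@le_trans _ _ (nu (symd A B `|` symd A' B'))).
  apply: le_measure; rewrite ?inE.
  - by apply: msymd; apply: measurableU => //; exact: mG.
  - by apply: measurableU; apply: msymd => //; exact: mG.
  - by rewrite /symd => x /=; tauto.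
rewrite [e]splitr EFinD; apply: le_trans (leeD AB AB').
by apply: measureU2; apply: msymd => //; exact: mG.
Qed.

Let approx_bigcup (F : (set T)^nat) : (forall i, approx (F i)) -> approx (\bigcup_i F i).
Proof.
move=> aF; have mF i : measurable (F i) by have [] := aF i.
split; first exact: bigcupT_measurable.
move=> e e0; have e20 : (0 < e / 2)%R by rewrite divr_gt0.
pose H n := \big[setU/set0]_(i < n) F i.
have mH n : measurable (H n) by apply: bigsetU_measurable.
have aH n : approx (H n).
  elim: n => [|n IHn]; rewrite /H.
    rewrite big_ord0; split => // r r0; exists set0 => //.
    by rewrite /symd !setDv setU0 measure0 lee_fin ltW.
  by rewrite big_ord_recr/=; exact: approxU.
set A := \bigcup_i F i.
have mA : measurable A by exact: bigcupT_measurable.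
have cvgH : nu (A `\` H n) @[n --> \oo] --> 0.
  rewrite -(measure0 nu) (_ : set0 = \bigcap_n (A `\` H n)); last first.
    apply/seteqP; split => // x HA; have [_ [[i _ Fix] _]] := (I, HA 0%N I).
    have [_] := HA i.+1 I; apply; rewrite /H -bigcup_mkord; exists i => //=.
  apply: nonincreasing_cvg_mu.
  - by rewrite (le_lt_trans _ nufin)// le_measure ?inE//; exact: measurableD.
  - by move=> n; exact: measurableD.
  - by apply: bigcapT_measurable => n; exact: measurableD.
  - move=> m n mn; apply/subsetPset; apply: setDS.
    by apply/subset_bigsetU.
have [n nuAn] : exists n, nu (A `\` H n) <= (e / 2)%:E.
  have : \forall n \near \oo, nu (A `\` H n) < (e / 2)%:E.
    apply: (cvgH [set x | x < (e / 2)%:E]); apply: open_nbhs_nbhs; split; first exact: open_ereal_lt_ereal.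
    by rewrite /= lte_fin.
  by move=> [n _ /(_ n (leqnn n)) /ltW]; exists n.
have [B GB HB] := (aH n).2 _ e20.
have HA : H n `<=` A by rewrite /H -bigcup_mkord; exact: bigcup_subset.
exists B => //; apply: (@le_trans _ _ (nu (symd (H n) B `|` (A `\` H n)))).
  apply: le_measure; rewrite ?inE.
  - by apply: msymd => //; exact: mG.
  - by apply: measurableU; [apply: msymd => //; exact: mG|exact: measurableD].
  - move=> x; have := @HA x; rewrite /symd/=; have [] := pselect (H n x); tauto.
rewrite [e]splitr EFinD; apply: le_trans (leeD HB nuAn).
by apply: measureU2; [apply: msymd => //; exact: mG|exact: measurableD].
Qed.

(** The sets that can be approximated by members of the algebra G, up to small
    measure, form a sigma-algebra. *)
Lemma algebra_approximation A (e : R) : <<s G >> A -> (0 < e)%R ->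
  exists2 B, G B & nu (A `\` B) <= e%:E /\ nu (B `\` A) <= e%:E.
Proof.
move=> GA e0; have : <<s G >> `<=` approx.
  apply: smallest_sub; last first.
    move=> B GB; split => [|r r0]; first exact: mG.
    by exists B => //; rewrite /symd !setDv setU0 measure0 lee_fin ltW.
  split => [|B|F]; [|by rewrite setTD; exact: approxC|exact: approx_bigcup].
  split => // r r0; exists set0 => //.
  by rewrite /symd !setDv setU0 measure0 lee_fin ltW.
move=> /(_ _ GA)[mA /(_ _ e0)[B GB AB]]; exists B => //.
have mB := mG GB.
by split; apply: le_trans AB; apply: le_measure; rewrite ?inE//;
  (try exact: msymd); (try exact: measurableD); rewrite /symd => x/=; tauto.
Qed.

End algebra_approximation.

(** Approximate A by a member of G for the measure m1 + m2. *)
Lemma le_measure_generated d (T : measurableType d) (R : realType) (G : set (set T))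
  (m1 m2 : {measure set T -> \bar R}) (C : R) :
  (m1 setT < +oo)%E -> (m2 setT < +oo)%E -> G `<=` measurable ->
  (forall A, G A -> G (~` A)) -> (forall A B, G A -> G B -> G (A `|` B)) -> G set0 ->
  0 <= C -> (forall A, G A -> m1 A <= C%:E * m2 A)%E ->
  forall A, <<s G >> A -> (m1 A <= C%:E * m2 A)%E.
Proof.
move=> m1f m2f mG GC GU G0 C0 GC12 A sA.
have mA : measurable A by apply: smallest_sub sA => //; exact: sigma_algebra_measurable.
have nufin : (measure_add m1 m2 setT < +oo)%E by rewrite measure_addE lte_add_pinfty.
apply/lee_addgt0Pr => e e0.
have d0 : 0 < e / (1 + C) by rewrite divr_gt0// ltr_pwDl.
have [B GB [AB BA]] := algebra_approximation nufin mG GC GU G0 sA d0.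
have mB := mG _ GB.
have {}AB : (m1 (A `\` B) + m2 (A `\` B) <= (e / (1 + C))%:E)%E by rewrite -measure_addE.
have {}BA : (m1 (B `\` A) + m2 (B `\` A) <= (e / (1 + C))%:E)%E by rewrite -measure_addE.
have h1 : (m1 A <= m1 B + (e / (1 + C))%:E)%E.
  apply: (@le_trans _ _ (m1 (B `|` (A `\` B)))).
    by apply: le_measure; rewrite ?inE//; [apply: measurableU => //; exact: measurableD|by move=> x Ax; have [] := pselect (B x); [left|right]].
  apply: le_trans (measureU2 _ _ _) _ => //; first exact: measurableD.
  by rewrite leeD2l//; apply: le_trans AB; rewrite leeDl.
have h2 : (m2 B <= m2 A + (e / (1 + C))%:E)%E.
  apply: (@le_trans _ _ (m2 (A `|` (B `\` A)))).
    by apply: le_measure; rewrite ?inE//; [apply: measurableU => //; exact: measurableD|by move=> x Bx; have [] := pselect (A x); [left|right]].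
  apply: le_trans (measureU2 _ _ _) _ => //; first exact: measurableD.
  by rewrite leeD2l//; apply: le_trans BA; rewrite leeDr.
apply: (le_trans h1); apply: (@le_trans _ _ (C%:E * (m2 A + (e / (1 + C))%:E) + (e / (1 + C))%:E)%E).
  by rewrite leeD2r//; apply: le_trans (GC12 _ GB) _; rewrite lee_wpmul2l// lee_fin.
rewrite ge0_muleDr//; last by rewrite lee_fin ltW.
rewrite -addeA leeD2l// -EFinM -EFinD lee_fin.
rewrite -[X in _ + X]mul1r -mulrDl addrC mulrC divfK//.
by rewrite gt_eqF// ltr_pwDl.
Qed.

Section dyadic_grid.
Context {R : realType} {n : nat}.

Definition dyadic (j : nat) (v : 'rV[R]_n) : 'rV[int]_n :=
  \row_i Num.floor (v 0 i * 2 ^+ j).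

Definition dcube j (k : 'rV[int]_n) : set 'rV[R]_n := [set v | dyadic j v = k].

Lemma dcubeP j k v :
  dcube j k v <-> forall i, (k 0 i)%:~R / 2 ^+ j <= v 0 i < (k 0 i + 1)%:~R / 2 ^+ j.
Proof.
have j0 : 0 < 2 ^+ j :> R by rewrite exprn_gt0.
split => [<- i|H]; last apply/rowP => i; rewrite mxE.
  by rewrite ler_pdivrMr// ltr_pdivlMr// floor_itv.
by apply/eqP; rewrite floor_eq -ler_pdivrMr// -ltr_pdivlMr.
Qed.

Lemma leb_dcube j k : leb n (dcube j k) = ((2 ^- j) ^+ n)%:E.
Proof.
pose A (i : 'I_n) : set (measurableTypeR R) :=
  `[(k 0 i)%:~R / 2 ^+ j, (k 0 i + 1)%:~R / 2 ^+ j[%classic.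
rewrite (_ : dcube j k = [set v | forall i, A i (v 0 i)]); last first.
  apply/seteqP; split => v; first by move/dcubeP => H i; rewrite /A/= in_itv/=; exact: H.
  by move=> H; apply/dcubeP => i; have := H i; rewrite /A/= in_itv.
rewrite leb_box; last by move=> i; exact: measurable_itv.
transitivity (\prod_(i < n) (2 ^- j : R)%:E)%E; last first.
  by rewrite prodEFin prodr_const card_ord.
apply: eq_bigr => i _; rewrite lebesgue_measure_itv/= lte_fin.
rewrite ltr_pM2r ?invr_gt0 ?exprn_gt0// ltr_int ltzD1 lexx.
by rewrite -EFinB -mulrBl intrD addrAC subrr add0r mul1r.
Qed.

Lemma measurable_dcube j k : measurable (dcube j k).
Proof.
rewrite (_ : dcube j k = \bigcap_(i in [set: 'I_n]) (fun v : 'rV[R]_n => v 0 i) @^-1`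
   `[(k 0 i)%:~R / 2 ^+ j, (k 0 i + 1)%:~R / 2 ^+ j[%classic); last first.
  apply/seteqP; split => v; first by move/dcubeP => H i _; rewrite /= in_itv/=; exact: H.
  by move=> H; apply/dcubeP => i; have := H i I; rewrite /= in_itv.
apply: fin_bigcap_measurable => // i _.
rewrite -[X in measurable X]setTI; exact: measurable_mx_coord.
Qed.

Definition dgrid j (T : set 'rV[int]_n) : set 'rV[R]_n := [set v | T (dyadic j v)].

Let piece j p : set 'rV[R]_n := dgrid j [set k | pickle k = p].

Let pieceP j p : (exists k, piece j p = dcube j k) \/ piece j p = set0.
Proof.
have [[v vp]|nv] := pselect (exists v, piece j p v); [left|right].
  exists (dyadic j v); apply/seteqP; split => w; rewrite /piece/dgrid/dcube/=.
    by move=> wp; apply: (pcan_inj pickleK); rewrite wp; exact/esym/vp.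
  by move=> ->; exact: vp.
by apply/seteqP; split => // v vp; apply: nv; exists v.
Qed.

Let mpiece j p : measurable (piece j p).
Proof. by case: (pieceP j p) => [[k ->]|->]; [exact: measurable_dcube|exact: measurable0]. Qed.

Let trivIset_piece j (D : set nat) (A : set 'rV[R]_n) : trivIset D (fun p => A `&` piece j p).
Proof. by move=> p q _ _ [v [[_ <-] [_ <-]]]. Qed.

Let dgrid_bigcup j T : dgrid j T =
  \bigcup_(p in [set p | exists2 k, T k & pickle k = p]) (setT `&` piece j p).
Proof.
apply/seteqP; split => v.
  by move=> Tv; exists (pickle (dyadic j v)) => //; exists (dyadic j v).
move=> [p [k Tk <-]] [_ /(pcan_inj pickleK) kv].
by rewrite /dgrid/= kv.
Qed.

Lemma measurable_dgrid j T : measurable (dgrid j T).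
Proof. by rewrite dgrid_bigcup; apply: bigcup_measurable => p _; rewrite setTI. Qed.

Lemma dyadic_refine j j' v v' : (j <= j')%N -> dyadic j' v = dyadic j' v' ->
  dyadic j v = dyadic j v'.
Proof.
move=> jj' /rowP vv'; apply/rowP => i; have := vv' i; rewrite !mxE => E.
have H (x : R) (m : int) : (m <= Num.floor (x * 2 ^+ j)) =
    (m * 2 ^+ (j' - j) <= Num.floor (x * 2 ^+ j') :> int).
  rewrite !floor_ge_int intrM rmorphXn/= -{2}(subnKC jj') exprD mulrA.
  by rewrite ler_pM2r// exprn_gt0.
by apply/eqP; rewrite eq_le !H E -{1}E -!H !lexx.
Qed.

Lemma dgridW j j' T : (j <= j')%N ->
  dgrid j T = dgrid j' [set k | exists2 v, T (dyadic j v) & dyadic j' v = k].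
Proof.
move=> jj'; apply/seteqP; split => v; first by exists v.
by move=> [v' Tv' /(dyadic_refine jj') E]; rewrite /dgrid/= -E.
Qed.

Definition dgrids : set (set 'rV[R]_n) := [set A | exists j T, A = dgrid j T].

Lemma dgridsC A : dgrids A -> dgrids (~` A).
Proof. by move=> [j [T ->]]; exists j, (~` T). Qed.

Lemma dgridsU A B : dgrids A -> dgrids B -> dgrids (A `|` B).
Proof.
move=> [j [T ->]] [j' [T' ->]].
rewrite (dgridW T (leq_maxl j j')) (dgridW T' (leq_maxr j j')).
by exists (maxn j j'); eexists (_ `|` _).
Qed.

Lemma dgridsI A B : dgrids A -> dgrids B -> dgrids (A `&` B).
Proof.
by move=> gA gB; rewrite -(setCK (A `&` B)) setCI; apply/dgridsC/dgridsU; exact: dgridsC.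
Qed.

(** An open half-space in a coordinate direction is the union, over all scales, of
    the dyadic cubes whose lower corner lies in it. *)
Lemma sub_measurable_dgrids : measurable `<=` <<s dgrids >>.
Proof.
have sD : sigma_algebra setT <<s dgrids >> by exact: smallest_sigma_algebra.
have [s0 sC sU] := sD.
apply: smallest_sub => // _ [[i0 i] _ [Y mY <-]] /=; rewrite setTI ord1 {i0}.
move: mY; rewrite -[measurable]/((ocitv (R:=R)).-sigma.-measurable) RGenOInfty.measurableE => mY.
suff : <<s RGenOInfty.G (R:=R) >> `<=` [set Y | <<s dgrids >> ((fun v : 'rV[R]_n => v 0 i) @^-1` Y)].
  by apply.
apply: smallest_sub.
  split => [|A|F] /=.
  - by rewrite preimage_set0.
  - by move=> /sC; rewrite !setTD preimage_setC.
  - by move=> /sU; rewrite preimage_bigcup.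
move=> _ [x ->] /=.
rewrite (_ : _ @^-1` _ = \bigcup_j dgrid j [set k | x < (k 0 i)%:~R / 2 ^+ j]); last first.
  apply/seteqP; split => v /=; rewrite in_itv/= andbT.
    move=> xv; have vx0 : 0 < v 0 i - x by rewrite subr_gt0.
    pose N := Num.bound (v 0 i - x)^-1.
    exists N => //; rewrite /dgrid/= mxE ltr_pdivlMr ?exprn_gt0//.
    have := floorD1_gt (v 0 i * 2 ^+ N); rewrite intrD -ltrBlDr; apply: le_lt_trans.
    rewrite lerBrDr -lerBrDl -mulrBl mulrC -ler_pdivrMr// div1r.
    apply: (@le_trans _ _ N%:R).
      by apply/ltW; have := archi_boundP (ltW (_ : 0 < (v 0 i - x)^-1)); apply; rewrite invr_gt0.
    by rewrite -natrX ler_nat ltnW// ltn_expl.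
  move=> [j _]; rewrite /dgrid/= mxE => /lt_le_trans; apply.
  by rewrite ler_pdivrMr ?exprn_gt0// floor_le.
apply: sU => j; apply: sub_sigma_algebra; by exists j, [set k | x < (k 0 i)%:~R / 2 ^+ j].
Qed.

(** Unions of dyadic cubes of one scale form an algebra that generates the Borel
    sets, and on it the comparison follows from the cubes by additivity.  The
    general comparison of measures is applied on each cube of side 1, where both
    measures are finite. *)
Lemma le_leb_dcube (m : {measure set 'rV[R]_n -> \bar R}) (C : R) : 0 <= C ->
  (forall j k, m (dcube j k) <= C%:E * leb n (dcube j k))%E ->
  forall A, measurable A -> (m A <= C%:E * leb n A)%E.
Proof.
move=> C0 mC.
have mgrid j T : (m (dgrid j T) <= C%:E * leb n (dgrid j T))%E.
  rewrite dgrid_bigcup !measure_bigcup.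
  - rewrite -nneseriesZl//; apply: lee_nneseries => // p _; rewrite setTI.
    by case: (pieceP j p) => [[k ->]|->]; rewrite ?mC// !measure0 mule0.
  - by move=> p _; rewrite setTI.
  - exact: trivIset_piece.
  - by move=> p _; rewrite setTI.
  - exact: trivIset_piece.
have piece_fin p : (leb n (piece 0 p) < +oo)%E.
  by case: (pieceP 0 p) => [[k ->]|->]; rewrite ?leb_dcube ?measure0 ?ltry.
have mle p A : measurable A -> (m (A `&` piece 0 p) <= C%:E * leb n (A `&` piece 0 p))%E.
  move=> mA.
  have := @le_measure_generated _ _ R dgrids (mrestr m (mpiece 0 p)) (mrestr (leb n) (mpiece 0 p)) C.
  apply => //.
  - rewrite /= /mrestr/= setTI; apply: le_lt_trans (mgrid _ _) _.
    by rewrite lte_mul_pinfty// ?lee_fin//; exact: piece_fin.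
  - rewrite /= /mrestr/= setTI; exact: piece_fin.
  - by move=> _ [j [T ->]]; exact: measurable_dgrid.
  - exact: dgridsC.
  - exact: dgridsU.
  - by exists 0%N, set0.
  - move=> B gB; rewrite /= /mrestr/=.
    have [j [T ->]] : dgrids (B `&` piece 0 p).
      by apply: dgridsI => //; exists 0%N, [set k | pickle k = p].
    exact: mgrid.
  - exact: sub_measurable_dgrids.
move=> A mA.
have -> : A = \bigcup_(p in setT) (A `&` piece 0 p).
  apply/seteqP; split => [v Av|v [p _ []]//].
  by exists (pickle (dyadic 0 v)).
rewrite !measure_bigcup; try exact: trivIset_piece; try by move=> p _; exact: measurableI.
rewrite -nneseriesZl//; apply: lee_nneseries => // p _; exact: mle.
Qed.

End dyadic_grid.

(** * Compact sets and bounds for polynomial functions *)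

(** This makes a compact set Borel as soon as balls are, whatever sigma-algebra the
    space carries. *)
Lemma compact_bigcap_balls (R : realType) (V : normedModType R) (K : set V) :
  compact K -> exists F : nat -> set V, (forall n, finite_set (F n)) /\
    K = \bigcap_n \bigcup_(x in F n) ball x n.+1%:R^-1.
Proof.
move=> cK; have clK : closed K by apply: compact_closed => //; exact: norm_hausdorff.
have H n : exists F : set V, [/\ finite_set F, F `<=` K &
    K `<=` \bigcup_(x in F) ball x n.+1%:R^-1].
  have e0 : 0 < n.+1%:R^-1 :> R by rewrite invr_gt0.
  move: cK; rewrite compact_cover => /(_ V K (fun x => ball x n.+1%:R^-1)).
  case => [x _|x Kx|D' sD' KD']; first exact: ball_open.
    by exists x => //; exact: ballxx.
  by exists [set` D']; split => // x /sD' /set_mem.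
have [F FP] := choice H; exists F; split => [n|]; first by have [] := FP n.
apply/seteqP; split => x; first by move=> Kx n _; have [_ _] := FP n; exact.
move=> xF; apply: clK => B /nbhs_ballP[e /= e0 xeB].
pose n := Num.bound e^-1.
have ne : n.+1%:R^-1 <= e.
  rewrite -[leRHS]invrK lef_pV2 ?posrE ?invr_gt0//.
  rewrite ltW// (lt_trans (archi_boundP _)) ?invr_ge0 1?ltW// ltr_nat//.
have [y Fy yx] := xF n I; have [_ /(_ _ Fy) Ky _] := FP n.
exists y; split => //; apply: xeB; apply: le_ball ne _ _.
exact: ball_sym.
Qed.

Lemma measurable_ball_mx (R : realType) m n (x : 'M[R]_(m, n)) e : measurable (ball x e).
Proof.
have [e0|e0] := ltP 0 e; last first.
  by rewrite (_ : ball x e = set0)//; apply/seteqP; split => // y [/lt_le_trans/(_ e0)]; rewrite ltxx.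
rewrite (_ : ball x e = \bigcap_(ij in [set: 'I_m * 'I_n])
    (fun M : 'M[R]_(m, n) => M ij.1 ij.2) @^-1` (ball (x ij.1 ij.2) e)); last first.
  apply/seteqP; split => y; first by move=> [_ xy] [i j] _; exact: xy.
  by move=> xy; split => // i j; exact: (xy (i, j) I).
apply: fin_bigcap_measurable => // -[i j] _.
rewrite -[X in measurable X]setTI; apply: measurable_mx_coord => //.
exact: measurable_ball.
Qed.

Lemma compact_measurable_rV (R : realType) n (K : set 'rV[R]_n) : compact K -> measurable K.
Proof.
move=> /compact_bigcap_balls[F [finF ->]]; apply: bigcapT_measurable => k.
by apply: fin_bigcup_measurable => // x _; exact: measurable_ball_mx.
Qed.

Section polyle_bounds.
Context {R : realType} {n : nat}.

Lemma polyle_det k d (M : 'rV[R]_n -> 'M[R]_k) :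
  (forall i j, polyle d (fun v => M v i j)) -> polyle (k * d) (fun v => \det (M v)).
Proof.
move=> dM; apply: polyle_sum => s; rewrite -[(k * d)%N]add0n.
apply: polyleM; first exact: polyle_cst.
have := @polyle_prod R n d _ (enum 'I_k) (fun i v => M v i (s i)) (fun i => dM i (s i)).
by rewrite size_enum_ord; under eq_fun do rewrite big_enum.
Qed.

Lemma polyle_adj k d (M : 'rV[R]_n -> 'M[R]_k) i j :
  (forall i j, polyle d (fun v => M v i j)) -> polyle (k.-1 * d) (fun v => (\adj (M v)) i j).
Proof.
move=> dM; under eq_fun do rewrite mxE /cofactor.
rewrite -[(k.-1 * d)%N]add0n; apply: polyleM; first exact: polyle_cst.
apply: polyle_det => i' j'; under eq_fun do rewrite !mxE; exact: dM.
Qed.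

Lemma polyle_bounded d (f : 'rV[R]_n -> R) t : polyle d f ->
  exists2 B : R, 0 <= B & forall v : 'rV[R]_n, (forall i, `|v 0 i| <= t) -> `|f v| <= B.
Proof.
elim=> [e c|e i _|e f1 f2 _ [B1 B10 b1] _ [B2 B20 b2]|e1 e2 f1 f2 _ [B1 B10 b1] _ [B2 B20 b2]].
- by exists `|c|.
- by exists `|t| => // v vt; apply: le_trans (vt i) _; exact: ler_norm.
- exists (B1 + B2); first exact: addr_ge0.
  by move=> v vt; apply: le_trans (ler_normD _ _) _; rewrite lerD ?b1 ?b2.
- exists (B1 * B2); first exact: mulr_ge0.
  by move=> v vt; rewrite normrM ler_pM ?b1 ?b2.
Qed.

End polyle_bounds.

(** * Quadratic maps with a large Jacobian *)

Definition cbox {R : realType} {n} (a b : 'I_n -> R) : set 'rV[R]_n :=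
  [set v | forall i, `[a i, b i]%classic (v 0 i)].

Section quadratic_map.
Context {R : realType} {l : nat}.
Variables (Psi H : 'rV[R]_l -> 'rV[R]_l) (D : 'rV[R]_l -> 'M[R]_l) (c : R).
Hypothesis Taylor : forall v w, Psi (v + w) = Psi v + w *m D v + H w.
Hypothesis dPsi : forall k, polyle 2 (fun v => Psi v 0 k).
Hypothesis dD : forall i j, polyle 1 (fun v => D v i j).
Hypothesis c0 : 0 <= c.
Hypothesis Hc : forall (w : 'rV[R]_l) (h : R), 0 <= h -> (forall j, `|w 0 j| <= h) ->
  forall i, `|H w 0 i| <= c * h ^+ 2.
Variables (t lam : R).
Hypotheses (t0 : 0 < t) (lam0 : 0 < lam).

Let S := [set v : 'rV[R]_l | (forall i, `|v 0 i| <= t) /\ lam <= `|\det (D v)|].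

(** Cramer: the entries of the adjugate are polynomials, bounded on the box, and the
    determinant is bounded below on S. *)
Lemma uniform_inverse_bound : exists2 K : R, 0 <= K & forall (v w : 'rV[R]_l) (h : R), S v -> 0 <= h ->
  (forall i, `|(w *m D v) 0 i| <= h) -> forall j, `|w 0 j| <= K * h.
Proof.
have /choice[B BP] : forall ij : 'I_l * 'I_l, exists B : R, 0 <= B /\
    forall v : 'rV[R]_l, (forall i, `|v 0 i| <= t) -> `|(\adj (D v)) ij.1 ij.2| <= B.
  by move=> ij; have [b b0 bP] := polyle_bounded t (polyle_adj ij.1 ij.2 dD); exists b.
pose K := lam^-1 * \sum_i \sum_k B (i, k).
have sB0 : 0 <= \sum_i \sum_k B (i, k) by apply: sumr_ge0 => i _; apply: sumr_ge0 => k _; have [] := BP (i, k).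
exists K; first by rewrite mulr_ge0// invr_ge0 ltW.
move=> v w h [vt vlam] h0 wD j.
have det0 : \det (D v) != 0 by rewrite -normr_gt0 (lt_le_trans lam0).
have E : \det (D v) * w 0 j = \sum_i (w *m D v) 0 i * (\adj (D v)) i j.
  have := congr1 (fun M : 'rV_l => M 0 j) (mulmxA w (D v) (\adj (D v))).
  by rewrite mul_mx_adj mul_mx_scalar [LHS]mxE => ->; rewrite mxE.
have dpos : 0 < `|\det (D v)| by rewrite normr_gt0.
rewrite -(ler_pM2l dpos) -normrM E.
apply: le_trans (ler_norm_sum _ _ _) _.
apply: (@le_trans _ _ (h * \sum_i \sum_k B (i, k))); last first.
  rewrite /K mulrA [X in _ <= X * _](_ : _ = `|\det (D v)| / lam * \sum_i \sum_k B (i, k)); last by rewrite mulrA.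
  rewrite mulrC ler_wpM2r// -[leLHS]mul1r ler_wpM2r// ler_pdivlMr// mul1r//.
rewrite mulr_sumr; apply: (@le_trans _ _ (\sum_i h * B (i, j))).
  by apply: ler_sum => i _; rewrite normrM ler_pM//; have [_] := BP (i, j); exact.
rewrite -!mulr_sumr ler_wpM2l// ler_sum// => i _.
by rewrite (bigD1 j)//= lerDl sumr_ge0// => k _; have [] := BP (i, k).
Qed.

(** If w is small compared with the bound K of the inverse, the quadratic term is at
    most a third of the largest entry of w D, hence can be absorbed. *)
Lemma local_linearization : exists2 eta : R, 0 < eta & forall (v w : 'rV[R]_l) (h : R), S v -> 0 <= h ->
  (forall j, `|w 0 j| <= eta) -> (forall i, `|(Psi (v + w) - Psi v) 0 i| <= h) ->
  forall i, `|(w *m D v) 0 i| <= 3 / 2 * h.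
Proof.
have [K K0 KP] := uniform_inverse_bound.
have cK : 0 < 3 * (c * K + 1) by rewrite mulr_gt0// ltr_wpDl// mulr_ge0.
exists (3 * (c * K + 1))^-1; first by rewrite invr_gt0.
set eta := _^-1; have eta0 : 0 <= eta by rewrite invr_ge0 ltW.
move=> v w h Sv h0 weta Psih.
pose E := \big[Num.max/0]_i `|(w *m D v) 0 i|.
have leE i : `|(w *m D v) 0 i| <= E by exact: le_bigmax.
have E0 : 0 <= E by exact: bigmax_ge_id.
have wE := KP _ _ _ Sv E0 leE.
pose m := Num.min eta (K * E).
have wm j : `|w 0 j| <= m by rewrite le_min weta wE.
have m0 : 0 <= m by rewrite le_min eta0 mulr_ge0.
have HE i : `|H w 0 i| <= E / 3.
  apply: le_trans (Hc m0 wm i) _.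
  apply: (@le_trans _ _ (c * (eta * (K * E)))).
    by rewrite ler_wpM2l// expr2 ler_pM// /m ge_min lexx ?orbT.
  rewrite (_ : c * _ = (c * K * eta) * E); last by ring.
  rewrite mulrC ler_wpM2l// -[leRHS]mul1r /eta invfM mulrA.
  rewrite ler_pdivrMr; last by rewrite ltr_wpDl// mulr_ge0.
  lra.
have EhE : E <= h + E / 3.
  apply: bigmax_le => [|i _]; first by rewrite addr_ge0// divr_ge0.
  have -> : (w *m D v) 0 i = (Psi (v + w) - Psi v) 0 i - H w 0 i.
    by rewrite Taylor !mxE; ring.
  by apply: le_trans (ler_normB _ _) _; rewrite lerD.
move=> i; apply: le_trans (leE i) _; lra.
Qed.

Lemma measurable_Psi : measurable_fun setT Psi.
Proof. by apply: measurable_fun_mxP => i j; rewrite ord1; exact: measurable_polyle (dPsi j). Qed.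

Lemma continuous_Psi : continuous Psi.
Proof.
move=> v A /nbhs_ballP[e /= e0 eA].
have : \forall x \near v, forall j, ball (Psi v 0 j) e (Psi x 0 j).
  apply: (@filter_forall _ _ (fun j x => ball (Psi v 0 j) e (Psi x 0 j)) (nbhs v)) => j.
  by apply: (continuous_polyle (dPsi j)); exact: nbhsx_ballx.
by apply: filterS => x vx; apply: eA; split => // i j; rewrite ord1.
Qed.

Lemma compact_box (a b : 'I_l -> R) :
  compact (cbox a b).
Proof.
by apply: (rV_compact (A := fun i => `[a i, b i]%classic)) => i; exact: segment_compact.
Qed.

Lemma compact_patch (a b : 'I_l -> R) :
  compact (S `&` cbox a b).
Proof.
pose T := [set v : 'rV[R]_l | lam <= `|\det (D v)|].
rewrite (_ : S = cbox (fun=> - t) (fun=> t) `&` T); last first.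
  apply/seteqP; split => v [vt vT]; split => // i; have := vt i; rewrite /= in_itv/= ler_norml//.
rewrite -setIA; apply: compact_closedI; first exact: compact_box.
apply: closedI.
  have cdet := continuous_polyle (polyle_det dD).
  rewrite (_ : T = (fun v => \det (D v)) @^-1` [set x | lam <= x] `|`
                   (fun v => \det (D v)) @^-1` [set x | x <= - lam]); last first.
    apply/seteqP; split => v; rewrite /T/= ler_normr lerNr.
      by move=> /orP[]; [left|right].
    by move=> [->//|->]; rewrite orbT.
  by apply: closedU; move/continuous_closedP: cdet; apply; [exact: closed_ge|exact: closed_le].
by apply: compact_closed; [exact: norm_hausdorff|exact: compact_box].
Qed.

(** By comparison of measures it suffices to take a dyadic cube for A.  Two points
    of the patch with values in that cube differ by a vector w for which w D is at
    most 3/2 times the side of the cube, so the points lie in a linear preimage of a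
    cube of three times its side. *)
Lemma leb_patch (eta : R) (a b : 'I_l -> R) (A : set 'rV[R]_l) : measurable A ->
  (forall (v w : 'rV[R]_l) (h : R), S v -> 0 <= h -> (forall j, `|w 0 j| <= eta) ->
    (forall i, `|(Psi (v + w) - Psi v) 0 i| <= h) ->
    forall i, `|(w *m D v) 0 i| <= 3 / 2 * h) ->
  (forall i, b i - a i <= eta) ->
  (leb l (S `&` cbox a b `&` Psi @^-1` A) <=
    (3 ^+ l / lam)%:E * leb l A)%E.
Proof.
move=> mA lin abeta.
set K := S `&` _.
have mK : measurable K by apply: compact_measurable_rV; exact: compact_patch.
pose P : {mfun 'rV[R]_l >-> 'rV[R]_l} :=
  HB.pack Psi (isMeasurableFun.Build _ _ _ _ _ measurable_Psi).
pose m := pushforward (mrestr (leb l) mK) P.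
have mE B : m B = leb l (K `&` Psi @^-1` B) by rewrite /m /pushforward/= /mrestr setIC.
rewrite -mE; apply: le_leb_dcube => //; first by rewrite divr_ge0// ?exprn_ge0// ltW.
move=> j k; rewrite -[X in (X <= _)%E]/(m _) mE leb_dcube.
have h0 : 0 <= 2 ^- j :> R by rewrite invr_ge0 exprn_ge0.
have [[v [Kv Pv]]|nv] := pselect (exists v, (K `&` Psi @^-1` dcube j k) v); last first.
  rewrite (_ : _ `&` _ = set0) ?measure0.
    by rewrite mule_ge0// lee_fin ?divr_ge0 ?exprn_ge0// ltW.
  by apply/seteqP; split => // v vK; apply: nv; exists v.
have Sv : S v by case: Kv.
have det0 : \det (D v) != 0 by rewrite -normr_gt0 (lt_le_trans lam0)//; case: Sv.
apply: (@le_trans _ _ (leb l [set v' | forall i,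
   (`|(v' *m D v) 0 i - (v *m D v) 0 i| <= 3 / 2 * 2 ^- j)%R])).
  apply: le_measure.
  - apply/mem_set; apply: measurableI => //; rewrite -[X in measurable X]setTI; apply: measurable_Psi => //.
    exact: measurable_dcube.
  - apply/mem_set; exact: (measurable_preimage_mulmxr (D v) (measurable_cube (v *m D v) (3 / 2 * 2 ^- j))).
  move=> v' [Kv' Pv'] i.
  rewrite -[X in `|X|](_ : ((v' - v) *m D v) 0 i = _); last by rewrite mulmxBl !mxE.
  apply: lin => //.
    move=> i'; rewrite !mxE; apply: le_trans (abeta i').
    have [_ /(_ i')] := Kv; have [_ /(_ i')] := Kv'; rewrite /= !in_itv/= ler_distl; lra.
  move=> i'; rewrite [v + _]addrC subrK !mxE.
  move: Pv Pv' => /dcubeP/(_ i') + /dcubeP/(_ i').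
  rewrite ler_distl intrD mulrDl mul1r; set x := _ / _ => /andP[? ?] /andP[? ?]; lra.
apply: le_trans (leb_linear_preimage_cube _ _ det0) _; first by rewrite mulr_ge0.
rewrite -EFinM lee_fin mulrA [_ * (3 / 2)](_ : _ = 3); last by rewrite mulrC divfK.
rewrite exprMn mulrAC ler_wpM2r ?exprn_ge0// ler_wpM2l ?exprn_ge0// lef_pV2 ?posrE//.
  by case: Sv.
by rewrite normr_gt0.
Qed.

End quadratic_map.

Section finite_covers.
Context d (T : measurableType d) (R : realType) (mu : {measure set T -> \bar R}).
Variables (I : finType) (F : I -> set T).
Hypothesis mF : forall i, measurable (F i).
Local Open Scope ereal_scope.

Lemma le_measure_cover (A : set T) : measurable A ->
  A `<=` \bigcup_i F i -> mu A <= \sum_i mu (F i).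
Proof.
move=> mA AF.
have mU (s : seq I) : measurable (\big[setU/set0]_(i <- s) F i) by apply: bigsetU_measurable.
have le_s (s : seq I) : mu (\big[setU/set0]_(i <- s) F i) <= \sum_(i <- s) mu (F i).
  elim: s => [|i s IHs]; first by rewrite !big_nil measure0.
  by rewrite !big_cons; apply: le_trans (measureU2 _ _ _) _ => //; rewrite leeD2l.
apply: le_trans (le_s _); apply: le_measure; [exact/mem_set|exact/mem_set/mU|].
move=> x /AF[i _ Fix]; rewrite (bigD1 i)//=; by left.
Qed.

Lemma sum_measure_overlap (A N : set T) (M : nat) : measurable A -> measurable N ->
  mu N = 0 -> (forall x, ~ N x -> (#|[pred i | `[< F i x >]]| <= M)%N) ->
  \sum_i mu (A `&` F i) <= M%:R%:E * mu A.
Proof.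
move=> mA mN N0 NM.
have -> : \sum_i mu (A `&` F i) = \int[mu]_(x in A) \sum_i (\1_(F i) x)%:E.
  rewrite ge0_integral_sum//.
  - by apply: eq_bigr => i _; rewrite integral_indic// setIC.
  - by move=> i; apply/measurable_EFinP; exact: measurable_indic.
rewrite -integral_cst//; apply: ae_ge0_le_integral => //.
- by move=> x _; apply: sume_ge0.
- by apply: emeasurable_sum => i; apply/measurable_EFinP; exact: measurable_indic.
- by move=> x _; rewrite lee_fin.
exists N; split => // x /= H; apply: contrapT => Nx; apply: H => _.
rewrite sumEFin lee_fin.
apply: le_trans (_ : (#|[pred i | `[< F i x >]]|%:R <= _)%R); last by rewrite ler_nat NM.
rewrite -sum1_card natr_sum [leRHS]big_mkcond/= ler_sum// => i _.
rewrite indicE inE; case: asboolP => Fix; first by rewrite mem_set.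
by rewrite memNset.
Qed.

End finite_covers.

Definition quadratic_constant (l : nat) : nat := ((2 * fiber_bound l 2) ^ l * 3 ^ l)%N.

(** Cut the box into cubes of side eta, on each of which the bound of [leb_patch]
    holds with A replaced by its intersection with the image of the cube.  These
    images overlap at most (2 D)^l times almost everywhere, D bounding the number of
    values of each coordinate on a generic fibre: a coordinate that is known lies in
    at most two of the closed intervals of the subdivision. *)
Lemma quadratic_sublevel (R : realType) (l : nat) (Psi H : 'rV[R]_l -> 'rV[R]_l)
  (D : 'rV[R]_l -> 'M[R]_l) (c t lam : R) (A : set 'rV[R]_l) :
  (forall v w, Psi (v + w) = Psi v + w *m D v + H w) ->
  (forall k, polyle 2 (fun v => Psi v 0 k)) ->
  (forall i j, polyle 1 (fun v => D v i j)) ->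
  0 <= c ->
  (forall (w : 'rV[R]_l) (h : R), 0 <= h -> (forall j, `|w 0 j| <= h) ->
    forall i, `|H w 0 i| <= c * h ^+ 2) ->
  0 < t -> 0 < lam -> measurable A ->
  (leb l [set v : 'rV[R]_l | [/\ forall i, (`|v 0 i| <= t)%R, (lam <= `|\det (D v)|)%R & A (Psi v)]] <=
    ((quadratic_constant l)%:R / lam)%:E * leb l A)%E.
Proof.
move=> Taylor dPsi dD c0 Hc t0 lam0 mA.
have [eta eta0 lin] := local_linearization Taylor dD c0 Hc t lam0.
set S := [set v : 'rV[R]_l | (forall i, `|v 0 i| <= t) /\ lam <= `|\det (D v)|] in lin.
(* N intervals of length eta cover [-t, t] *)
pose N := (Num.bound (2 * t / eta)).+1.
pose a (k : {ffun 'I_l -> 'I_N}) (i : 'I_l) : R := - t + (k i)%:R * eta.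
pose b (k : {ffun 'I_l -> 'I_N}) (i : 'I_l) : R := - t + (k i).+1%:R * eta.
pose K k := S `&` cbox (a k) (b k).
have cK k : compact (K k) by exact: (compact_patch dD).
have mPsi : measurable_fun setT Psi.
  by apply: measurable_fun_mxP => i j; rewrite ord1; exact: measurable_polyle (dPsi j).
have mE k : measurable (Psi @` K k).
  apply: compact_measurable_rV; apply: continuous_compact => //.
  by apply: continuous_subspaceT; exact: (continuous_Psi dPsi).
have mPA : measurable (Psi @^-1` A) by rewrite -[X in measurable X]setTI; exact: mPsi.
have mK k : measurable (K k) by exact: compact_measurable_rV.
have [Nl [mNl Nl0 Nlfib]] := generic_fiber dPsi.
set M := fiber_bound l 2 in Nlfib.
have count w : ~ Nl w -> (#|[pred k | `[< (Psi @` K k) w >]]| <= (2 * M) ^ l)%N.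
  move=> /Nlfib[s ss sP].
  pose tr (r : R) := Num.trunc ((r + t) / eta).
  (* the closed intervals that can contain r *)
  pose near_root (r : R) := [:: tr r; (tr r).-1].
  pose C (i : 'I_l) : pred 'I_N := [pred k : 'I_N | (k : nat) \in flatten [seq near_root r | r <- s i]].
  have Ccard i : (#|C i| <= 2 * M)%N.
    have sz : size (flatten [seq near_root r | r <- s i]) = (2 * size (s i))%N.
      by elim: (s i) => //= r u ->; rewrite mulnS.
    rewrite cardE -(size_map val).
    apply: (@leq_trans (size (flatten [seq near_root r | r <- s i]))); last first.
      by rewrite sz leq_mul2l ss.
    apply: uniq_leq_size.
      by rewrite map_inj_uniq ?enum_uniq//; exact: val_inj.
    by move=> x /mapP[k]; rewrite mem_enum => kC ->.
  apply: (@leq_trans #|family C|).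
    apply: subset_leq_card; apply/fintype.subsetP => k /asboolP[v [[vt _] vk] Psiv].
    apply/familyP => i; rewrite inE; apply/flattenP.
    exists (near_root (v 0 i)); first by apply: map_f; exact: sP.
    have := vk i; rewrite /= in_itv/= /a /b => /andP[lek ltk].
    have vt0 : 0 <= v 0 i + t by have := vt i; rewrite ler_norml; lra.
    have k1 : (k i)%:R <= (v 0 i + t) / eta by rewrite ler_pdivlMr//; lra.
    have k2 : (v 0 i + t) / eta <= (k i).+1%:R by rewrite ler_pdivrMr//; lra.
    have [lt2|ge2] := ltP ((v 0 i + t) / eta) (k i).+1%:R.
      by rewrite /near_root /tr (@truncn_def _ _ (k i)) ?k1// !inE eqxx.
    rewrite /near_root /tr (@truncn_def _ _ (k i).+1) ?inE ?eqxx ?orbT//.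
    by rewrite ge2 (le_lt_trans k2)// ltr_nat.
  rewrite card_family.
  have : forall u : seq 'I_l, (foldr muln 1 [seq #|C i| | i <- u] <= (2 * M) ^ size u)%N.
    by elim=> //= i u IHu; rewrite expnS leq_mul.
  by move=> /(_ (enum 'I_l)); rewrite size_enum_ord.
set B := [set v | _].
have BE : B = S `&` Psi @^-1` A.
  by apply/seteqP; split => v; [case=> ? ? ?|case=> -[]].
have cover : B `<=` \bigcup_k (K k `&` Psi @^-1` A).
  move=> v; rewrite BE => -[Sv Av]; have [vt _] := Sv.
  have vt0 i : 0 <= (v 0 i + t) / eta.
    by have := vt i; rewrite ler_norml => ?; rewrite divr_ge0 ?(ltW eta0)//; lra.
  have kN i : (Num.trunc ((v 0 i + t) / eta)%R < N)%N.
    rewrite ltnS -(ler_nat R); have /andP[+ _] := truncn_itv (vt0 i).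
    move=> /le_trans; apply.
    have h2 : 0 <= 2 * t / eta by rewrite divr_ge0 ?(ltW eta0)// mulr_ge0// ltW.
    apply: le_trans (ltW (archi_boundP h2)).
    by rewrite ler_wpM2r ?invr_ge0 ?(ltW eta0)//; have := vt i; rewrite ler_norml; lra.
  exists [ffun i => Ordinal (kN i)] => //; split => //; split => // i.
  rewrite /= in_itv/= /a /b ffunE/=.
  have /andP[h1 h2] := truncn_itv (vt0 i).
  by move: h1 (ltW h2); rewrite ler_pdivlMr// ler_pdivrMr// => h1' h2'; apply/andP; split; lra.
have mS : measurable S.
  rewrite (_ : S = S `&` cbox (fun=> - t) (fun=> t)).
    by apply: compact_measurable_rV; exact: (compact_patch dD).
  apply/seteqP; split => [v Sv|v []//]; split => // i; have [/(_ i)] := Sv.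
  by rewrite /= in_itv/= ler_norml.
apply: (@le_trans _ _ (\sum_k leb l (K k `&` Psi @^-1` A))%E).
  apply: le_measure_cover => //; first by move=> k; exact: measurableI.
  by rewrite BE; exact: measurableI.
apply: (@le_trans _ _ (\sum_k (3 ^+ l / lam)%:E * leb l (A `&` Psi @` K k))%E).
  apply: lee_sum => k _.
  rewrite (_ : K k `&` Psi @^-1` A = K k `&` Psi @^-1` (A `&` Psi @` K k)); last first.
    apply/seteqP; split => v [Kv Av].
      by split => //; split => //; exists v.
    by split => //; case: Av.
  have mAk : measurable (A `&` Psi @` K k) by exact: measurableI.
  have LP := @leb_patch R l Psi D dPsi dD t lam lam0 eta (a k) (b k) _ mAk lin.
  rewrite -/S in LP. apply LP.
  by move=> i; rewrite /a /b -natr1; lra.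
rewrite -ge0_sume_distrr//.
apply: (@le_trans _ _ ((3 ^+ l / lam)%:E * (((2 * M) ^ l)%:R%:E * leb l A)))%E.
  rewrite lee_wpmul2l//; first by rewrite lee_fin divr_ge0 ?exprn_ge0// ltW.
  exact: (sum_measure_overlap mE mA mNl Nl0 count).
rewrite muleA -EFinM /quadratic_constant natrM !natrX -/M.
by rewrite mulrAC [3 ^+ l * _]mulrC.
Qed.

(** * Slices of the bilinear map *)

Section product_affine.
Context {R : realType} {m n : nat}.
Local Open Scope ereal_scope.

Lemma ge0_integral_leb_affine k (e : R) (c : 'rV[R]_k) (h : 'rV[R]_k -> \bar R) :
  (e * e = 1)%R -> measurable_fun setT h -> (forall a, 0 <= h a) ->
  \int[leb k]_a h (c + e *: a)%R = \int[leb k]_a h a.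
Proof.
move=> ee mh h0.
have := @ge0_integral_pushforward _ _ _ _ R _ (@measurable_affine R k e c) (leb k) setT h
  measurableT mh (fun y _ => h0 y).
rewrite preimage_setT => <-.
apply: eq_measure_integral => [|? A mA _]; first exact: measurable_affine.
exact: leb_affine.
Qed.

Lemma product_leb_affine (e1 e2 : R) (c1 : 'rV[R]_m) (c2 : 'rV[R]_n)
    (A : set ('rV[R]_m * 'rV[R]_n)) :
  (e1 * e1 = 1)%R -> (e2 * e2 = 1)%R -> measurable A ->
  (leb m \x leb n) [set p | A (c1 + e1 *: p.1, c2 + e2 *: p.2)%R] = (leb m \x leb n) A.
Proof.
move=> ee1 ee2 mA.
transitivity (\int[leb m]_x (leb n \o xsection A) (c1 + e1 *: x)%R).
  apply: eq_integral => x _ /=.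
  rewrite -[RHS](@leb_affine R n e2 c2)//; last exact: measurable_xsection.
by apply: ge0_integral_leb_affine => //; exact: measurable_fun_xsection.
Qed.

End product_affine.

Section bilinear_forms.
Context {R : realType} {dL dR l : nat}.
Variable Q : {bilinear 'rV[R]_dL -> 'rV[R]_dR -> 'rV[R]_l}.

Definition coefQ i j : 'rV[R]_l := Q (delta_mx 0 i) (delta_mx 0 j).

Lemma bilinearDl x x' y : Q (x + x') y = Q x y + Q x' y. Proof. exact: linearDl. Qed.
Lemma bilinearDr x y y' : Q x (y + y') = Q x y + Q x y'. Proof. exact: linearDr. Qed.
Lemma bilinearZl a x y : Q (a *: x) y = a *: Q x y. Proof. exact: linearZl_LR. Qed.
Lemma bilinearZr a x y : Q x (a *: y) = a *: Q x y. Proof. by rewrite linearZr_LR. Qed.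
Lemma bilinear0l y : Q 0 y = 0. Proof. by rewrite -(scale0r (0 : 'rV[R]_dL)) bilinearZl scale0r. Qed.
Lemma bilinear0r x : Q x 0 = 0. Proof. by rewrite -(scale0r (0 : 'rV[R]_dR)) bilinearZr scale0r. Qed.
Lemma bilinear_suml (I : Type) (s : seq I) F y : Q (\sum_(i <- s) F i) y = \sum_(i <- s) Q (F i) y.
Proof. by elim: s => [|i s IH]; rewrite ?big_nil ?bilinear0l// !big_cons bilinearDl IH. Qed.
Lemma bilinear_sumr (I : Type) (s : seq I) F x : Q x (\sum_(i <- s) F i) = \sum_(i <- s) Q x (F i).
Proof. by elim: s => [|i s IH]; rewrite ?big_nil ?bilinear0r// !big_cons bilinearDr IH. Qed.

Lemma bilinearE x y k : Q x y 0 k = \sum_i \sum_j x 0 i * y 0 j * coefQ i j 0 k.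
Proof.
rewrite [in LHS](row_sum_delta x) [in LHS](row_sum_delta y) bilinear_suml summxE.
apply: eq_bigr => i _; rewrite bilinear_sumr summxE; apply: eq_bigr => j _.
by rewrite bilinearZl bilinearZr !mxE mulrA.
Qed.

Lemma generator_inl i x y k : generators Q x y (inl i) 0 k = \sum_j y 0 j * coefQ i j 0 k.
Proof.
rewrite /= [in LHS](row_sum_delta y) bilinear_sumr summxE.
by apply: eq_bigr => j _; rewrite bilinearZr mxE.
Qed.

Lemma generator_inr j x y k : generators Q x y (inr j) 0 k = \sum_i x 0 i * coefQ i j 0 k.
Proof.
rewrite /= [in LHS](row_sum_delta x) bilinear_suml summxE.
by apply: eq_bigr => i _; rewrite bilinearZl mxE.
Qed.

Definition minor_mx (s : 'I_l -> 'I_dL + 'I_dR) x y : 'M[R]_l := \matrix_k generators Q x y (s k).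

Lemma polyleMr (n d : nat) (f : 'rV[R]_n -> R) a : polyle d f -> polyle d (fun v => f v * a).
Proof. by move=> df; rewrite -[d]addn0; apply: polyleM => //; exact: polyle_cst. Qed.

Section minor.
Variable s : 'I_l -> 'I_dL + 'I_dR.

(** Row k of these matrices is the standard basis vector that occurs in the generator
    s k, on the side where it lives, and zero on the other side: w in R^l moves (x, y)
    to (x + w embL, y + w embR). *)
Definition embL : 'M[R]_(l, dL) := \matrix_(k, i) (s k == inl i)%:R.
Definition embR : 'M[R]_(l, dR) := \matrix_(k, j) (s k == inr j)%:R.

(** The minor is the differential of Q at (x, y) in the direction of the slice. *)
Lemma minor_mxE (w : 'rV[R]_l) x y : w *m minor_mx s x y = Q (w *m embL) y + Q x (w *m embR).
Proof.
rewrite !mulmx_sum_row bilinear_suml bilinear_sumr -big_split/=.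
apply: eq_bigr => k _; rewrite bilinearZl bilinearZr -scalerDr; congr (_ *: _).
rewrite rowK; have [[i|j] sk] : exists a, s k = a by exists (s k).
  rewrite sk/= (_ : row k embL = delta_mx 0 i); last first.
    by apply/rowP => i'; rewrite !mxE sk eqxx/= eq_sym.
  by rewrite (_ : row k embR = 0) ?bilinear0r ?addr0//; apply/rowP => i'; rewrite !mxE sk.
rewrite sk/= (_ : row k embR = delta_mx 0 j); last first.
  by apply/rowP => i'; rewrite !mxE sk eqxx/= eq_sym.
by rewrite (_ : row k embL = 0) ?bilinear0l ?add0r//; apply/rowP => i'; rewrite !mxE sk.
Qed.

Let Psi x y (v : 'rV[R]_l) := Q (x + v *m embL) (y + v *m embR).
Let D x y (v : 'rV[R]_l) := minor_mx s (x + v *m embL) (y + v *m embR).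
Let H (w : 'rV[R]_l) := Q (w *m embL) (w *m embR).

Let polyle_affine n (M : 'M[R]_(l, n)) (x : 'rV[R]_n) i : polyle 1 (fun v : 'rV[R]_l => (x + v *m M) 0 i).
Proof.
under eq_fun do rewrite !mxE.
apply: polyleD; first exact: polyle_cst.
apply: polyle_sum => k; by apply: polyleMr; exact: polyle_coord.
Qed.

Let Taylor x y v w : Psi x y (v + w) = Psi x y v + w *m D x y v + H w.
Proof.
rewrite /Psi /D /H minor_mxE !mulmxDl !addrA [x + _ + _]addrC [y + _ + _]addrC.
set X := x + _; set Y := y + _; rewrite bilinearDl !bilinearDr.
by apply/rowP => k; rewrite !mxE; ring.
Qed.

Lemma norm_mul_emb_le n (M : 'M[R]_(l, n)) (w : 'rV[R]_l) h i : 
  (forall k j, `|M k j| <= 1) -> (forall k, `|w 0 k| <= h) -> `|(w *m M) 0 i| <= l%:R * h.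
Proof.
move=> M1 wh; rewrite mxE; apply: le_trans (ler_norm_sum _ _ _) _.
rewrite -[X in X%:R * _](card_ord l) mulr_natl -sumr_const; apply: ler_sum => k _.
by rewrite normrM -[leRHS]mulr1 ler_pM.
Qed.

Lemma embL1 k j : `|embL k j| <= 1.
Proof. by rewrite mxE ger0_norm//; case: (_ == _). Qed.
Lemma embR1 k j : `|embR k j| <= 1.
Proof. by rewrite mxE ger0_norm//; case: (_ == _). Qed.

Let cH : R := l%:R ^+ 2 * \sum_k \sum_i \sum_j `|coefQ i j 0 k|.

Let Hle (w : 'rV[R]_l) (h : R) : 0 <= h -> (forall j, `|w 0 j| <= h) ->
  forall i, `|H w 0 i| <= cH * h ^+ 2.
Proof.
move=> h0 wh k; rewrite /H bilinearE.
rewrite /cH mulrAC -exprMn mulr_sumr (bigD1 k)//= -[leLHS]addr0 lerD//; last first.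
  by apply: sumr_ge0 => k' _; rewrite mulr_ge0 ?sqr_ge0//; do 2 (apply: sumr_ge0 => ? _).
rewrite mulr_sumr; apply: le_trans (ler_norm_sum _ _ _) _; apply: ler_sum => i _.
rewrite mulr_sumr; apply: le_trans (ler_norm_sum _ _ _) _; apply: ler_sum => j _.
rewrite normrM ler_wpM2r// normrM expr2 ler_pM//; apply: norm_mul_emb_le => //.
  exact: embL1.
exact: embR1.
Qed.

Let dPsi x y k : polyle 2 (fun v => Psi x y v 0 k).
Proof.
under eq_fun do rewrite /Psi bilinearE.
apply: polyle_sum => i; apply: polyle_sum => j; apply: polyleMr.
by rewrite -[2%N]/(1 + 1)%N; apply: polyleM; exact: polyle_affine.
Qed.

Let dD x y k k' : polyle 1 (fun v => D x y v k k').
Proof.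
under eq_fun do rewrite mxE.
case: (s k) => [i|j].
  under eq_fun do rewrite generator_inl.
  apply: polyle_sum => j; apply: polyleMr.
  exact: polyle_affine.
under eq_fun do rewrite generator_inr.
apply: polyle_sum => j'; apply: polyleMr.
exact: polyle_affine.
Qed.

(** Along the slice, Q(x + v embL, y + v embR) is a quadratic map with differential
    [minor_mx]; the estimate for quadratic maps does not depend on (x, y). *)
Lemma minor_slice (x : 'rV[R]_dL) (y : 'rV[R]_dR) (t lam : R) (A : set 'rV[R]_l) :
  0 < t -> 0 < lam -> measurable A ->
  (leb l [set v : 'rV[R]_l | [/\ forall i, (`|v 0 i| <= t)%R,
     (lam <= `|\det (minor_mx s (x + v *m embL) (y + v *m embR))|)%R &
     A (Q (x + v *m embL) (y + v *m embR))%R]] <=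
  ((quadratic_constant l)%:R / lam)%:E * leb l A)%E.
Proof.
move=> t0 lam0 mA.
have cH0 : 0 <= cH.
  by rewrite mulr_ge0 ?sqr_ge0//; do 3 (apply: sumr_ge0 => ? _).
exact: (quadratic_sublevel (Taylor x y) (dPsi x y) (dD x y) cH0 Hle t0 lam0 mA).
Qed.

End minor.
End bilinear_forms.

Lemma xsection_set (T1 T2 : Type) (A : set (T1 * T2)) x : xsection A x = [set y | A (x, y)].
Proof. by apply/seteqP; split => y; [move=> /set_mem|move=> /mem_set]. Qed.

Lemma ysection_set (T1 T2 : Type) (A : set (T1 * T2)) y : ysection A y = [set x | A (x, y)].
Proof. by apply/seteqP; split => x; [move=> /set_mem|move=> /mem_set]. Qed.

Section product_sigma_finite.
Local Open Scope ereal_scope.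
Context d1 d2 (T1 : measurableType d1) (T2 : measurableType d2) (R : realType).
Variable m1 : {sigma_finite_measure set T1 -> \bar R}.
Variable m2 : {sigma_finite_measure set T2 -> \bar R}.

Lemma product_sigma_finite : sigma_finite setT (m1 \x m2).
Proof.
have /sigma_finiteP[F [TF ndF Foo]] := sigma_finiteT m1.
have /sigma_finiteP[G [TG ndG Goo]] := sigma_finiteT m2.
exists (fun n => F n `*` G n).
  apply/seteqP; split => // -[x y] _.
  have [i _ Fi] : (\bigcup_i F i) x by rewrite -TF.
  have [j _ Gj] : (\bigcup_i G i) y by rewrite -TG.
  exists (maxn i j) => //; split => /=.
    exact: (subsetPset _ _ (ndF _ _ (leq_maxl i j))).
  exact: (subsetPset _ _ (ndG _ _ (leq_maxr i j))).
move=> k; have [? ?] := Foo k; have [? ?] := Goo k.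
split; first exact: measurableX.
by rewrite product_measure1E// lte_mul_pinfty// ge0_fin_numE.
Qed.

End product_sigma_finite.
(** The product measure with its sigma-finiteness attached, so that Tonelli applies
    to further products. *)
Definition product_sf d1 d2 (T1 : measurableType d1) (T2 : measurableType d2) (R : realType)
  (m1 : {sigma_finite_measure set T1 -> \bar R}) (m2 : {sigma_finite_measure set T2 -> \bar R})
  : {sigma_finite_measure set (T1 * T2)%type -> \bar R} :=
  HB.pack_for {sigma_finite_measure set (T1 * T2)%type -> \bar R} (m1 \x m2)%E
    (@Measure_isSigmaFinite.Build _ _ _ (m1 \x m2)%E (product_sigma_finite m1 m2)).

Section measurable_forms.
Context {R : realType} {dL dR l : nat} {d : measure_display} {T : measurableType d}.
Variable Q : {bilinear 'rV[R]_dL -> 'rV[R]_dR -> 'rV[R]_l}.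
Variables (f : T -> 'rV[R]_dL) (g : T -> 'rV[R]_dR).
Hypotheses (mf : measurable_fun setT f) (mg : measurable_fun setT g).

Lemma measurable_coord n (h : T -> 'rV[R]_n) i : measurable_fun setT h ->
  measurable_fun setT (fun x => h x 0 i).
Proof. move=> mh; apply: (measurableT_comp (@measurable_mx_coord R 1 n 0 i)) => //. Qed.

Lemma measurable_bilinear : measurable_fun setT (fun x => Q (f x) (g x)).
Proof.
apply: measurable_fun_mxP => i k; rewrite ord1.
under eq_fun do rewrite bilinearE.
apply: measurable_sum => i'; apply: measurable_sum => j.
apply: measurable_funM; last exact: measurable_cst.
by apply: measurable_funM; exact: measurable_coord.
Qed.

Lemma measurable_generators k j : measurable_fun setT (fun x => generators Q (f x) (g x) k 0 j).
Proof.
case: k => [i|i].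
  under eq_fun do rewrite generator_inl.
  apply: measurable_sum => j'; apply: measurable_funM; last exact: measurable_cst.
  exact: measurable_coord.
under eq_fun do rewrite generator_inr.
apply: measurable_sum => j'; apply: measurable_funM; last exact: measurable_cst.
exact: measurable_coord.
Qed.

Lemma measurable_det n (M : T -> 'M[R]_n) :
  (forall i j, measurable_fun setT (fun x => M x i j)) -> measurable_fun setT (fun x => \det (M x)).
Proof.
move=> mM; apply: measurable_sum => s; apply: measurable_funM; first exact: measurable_cst.
by apply: measurable_prod => i _; exact: mM.
Qed.

Lemma measurable_minor s : measurable_fun setT (fun x => \det (minor_mx Q s (f x) (g x))).
Proof.
apply: measurable_det => i j; under eq_fun do rewrite mxE; exact: measurable_generators.
Qed.

Lemma measurable_Vol : measurable_fun setT (fun x => Vol Q (f x) (g x)).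
Proof.
rewrite /Vol; elim: (index_enum _) => [|s u IHu].
  by under eq_fun do rewrite big_nil; exact: measurable_cst.
under eq_fun do rewrite big_cons.
case: (injectiveb s); last exact: IHu.
apply: measurable_maxr => //.
by apply: (measurableT_comp (@normr_measurable R setT)); exact: measurable_minor.
Qed.

Lemma measurable_sqnorm n (h : T -> 'rV[R]_n) : measurable_fun setT h ->
  measurable_fun setT (fun x => sqnorm (h x)).
Proof.
move=> mh; apply: measurable_sum => i; apply: measurable_funX; exact: measurable_coord.
Qed.

Lemma measurable_Phi : measurable_fun setT (fun x => Phi Q (f x) (g x)).
Proof.
rewrite /Phi; under eq_fun do rewrite -powRN.
apply: measurable_funM; first exact: measurable_Vol.
apply: (measurableT_comp (measurable_powR _)).
by apply: measurable_funD; exact: measurable_sqnorm.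
Qed.

End measurable_forms.

Lemma leb_cube (R : realType) n (h : R) : 0 <= h ->
  leb n [set v : 'rV[R]_n | forall i, (`|v 0 i| <= h)%R] = ((2 * h) ^+ n)%:E.
Proof.
move=> h0; pose A (i : 'I_n) : set (measurableTypeR R) := `[- h, h]%classic.
rewrite [X in leb n X](_ : _ = [set v : 'rV[R]_n | forall i, A i (v 0 i)]); last first.
  by apply/seteqP; split => v H i; have := H i; rewrite /A/= in_itv/= ler_norml.
rewrite leb_box; last by move=> i; exact: measurable_itv.
transitivity (\prod_(i < n) (2 * h : R)%:E)%E; last by rewrite prodEFin prodr_const card_ord.
apply: eq_bigr => i _; rewrite lebesgue_measure_itv/= lte_fin.
case: ifPn => hh; first by rewrite -EFinB; congr EFin; ring.
by congr EFin; rewrite -leNgt in hh; lra.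
Qed.

Lemma measurable_cube0 (R : realType) n (h : R) :
  measurable [set v : 'rV[R]_n | forall i, (`|v 0 i| <= h)%R].
Proof.
have := measurable_cube (0 : 'rV[R]_n) h.
congr (measurable _).
by apply/seteqP; split => v H i; have := H i; rewrite mxE subr0.
Qed.

Section minor_sublevel.
Context {R : realType} {dL dR l : nat}.
Variable Q : {bilinear 'rV[R]_dL -> 'rV[R]_dR -> 'rV[R]_l}.

Definition minor_set (s : 'I_l -> 'I_dL + 'I_dR) (t lam : R) (A : set 'rV[R]_l) :
    set ('rV[R]_dL * 'rV[R]_dR) :=
  [set p : 'rV[R]_dL * 'rV[R]_dR | [/\ forall i, `|p.1 0 i| <= t, forall j, `|p.2 0 j| <= t,
    lam <= `|\det (minor_mx Q s p.1 p.2)| & A (Q p.1 p.2)]].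

Lemma measurable_minor_set s t lam A : measurable A -> measurable (minor_set s t lam A).
Proof.
move=> mA.
rewrite (_ : minor_set _ _ _ _ = (fst @^-1` [set v : 'rV[R]_dL | forall i, `|v 0 i| <= t]) `&`
  (snd @^-1` [set v : 'rV[R]_dR | forall i, `|v 0 i| <= t]) `&`
  (fun p => `|\det (minor_mx Q s p.1 p.2)|) @^-1` `[lam, +oo[ `&` (fun p => Q p.1 p.2) @^-1` A); last first.
  apply/seteqP; split => p; rewrite /minor_set/= in_itv/= andbT; first by case.
  by move=> [[[]]].
apply: measurableI; last first.
  by rewrite -[X in measurable X]setTI; apply: measurable_bilinear.
apply: measurableI; last first.
  rewrite -[X in measurable X]setTI.
  have : measurable_fun setT (fun p : 'rV[R]_dL * 'rV[R]_dR => `|\det (minor_mx Q s p.1 p.2)|).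
    by apply: (measurableT_comp (@normr_measurable R setT)); exact: measurable_minor.
  by apply => //; exact: measurable_itv.
apply: measurableI; rewrite -[X in measurable X]setTI.
  by apply: measurable_fst => //; exact: measurable_cube0.
by apply: measurable_snd => //; exact: measurable_cube0.
Qed.

Definition minor_constant : R :=
  (2 * (l.+1)%:R) ^+ (dL + dR) * (quadratic_constant l)%:R / 2 ^+ l.

(** The set S has the same measure as its translate along the slice through any v,
    so |S| (2t)^l is the integral over the box |v| <= t of the measures of these
    translates.  In the other order of integration each slice contributes at most
    C |A| / lambda, and only base points in a box of side 2(l + 1)t contribute. *)
Lemma minor_sublevel s t lam A : 0 < t -> 0 < lam -> measurable A ->
  ((leb dL \x leb dR) (minor_set s t lam A) <=
    (minor_constant * t ^+ (dL + dR) / t ^+ l / lam)%:E * leb l A)%E.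
Proof.
move=> t0 lam0 mA.
set S := minor_set s t lam A.
have mS : measurable S by exact: measurable_minor_set.
(* U is the set of (p, v), |v| <= t, such that p moved by v along the slice is in S *)
pose sh (q : 'rV[R]_dL * 'rV[R]_dR * 'rV[R]_l) :=
  (q.1.1 + q.2 *m embL s, q.1.2 + q.2 *m embR s).
have msh : measurable_fun setT sh.
  apply/measurable_fun_pairP; split => /=; apply: measurable_fun_mxP => i j; under eq_fun do rewrite mxE.
    apply: measurable_funD.
      by apply: (measurableT_comp (measurable_mx_coord i j)); exact: measurableT_comp.
    apply: (measurableT_comp (measurable_mx_coord i j)).
    by apply: (measurableT_comp (measurable_mulmxr _)).
  apply: measurable_funD.
    by apply: (measurableT_comp (measurable_mx_coord i j)); exact: measurableT_comp.
  apply: (measurableT_comp (measurable_mx_coord i j)).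
  by apply: (measurableT_comp (measurable_mulmxr _)).
pose box n (h : R) := [set v : 'rV[R]_n | forall i, `|v 0 i| <= h].
pose U := (snd @^-1` box l t) `&` (sh @^-1` S).
have mU : measurable U.
  apply: measurableI; rewrite -[X in measurable X]setTI.
    by apply: measurable_snd => //; exact: measurable_cube0.
  exact: msh.
have UE1 : (((leb dL \x leb dR) \x leb l) U = (leb dL \x leb dR) S * ((2 * t) ^+ l)%:E)%E.
  transitivity (\int[leb l]_v (leb dL \x leb dR) (ysection U v))%E.
    exact: (@product_measureEy _ _ _ _ R (product_sf (leb dL) (leb dR)) (leb l) U mU).
  rewrite -(leb_cube l (ltW t0)) -[X in (_ * leb l X)%E]setIT -integral_indic//; last exact: measurable_cube0.
  rewrite -ge0_integralZl//; last first.
    by apply/measurable_EFinP; apply: measurable_indic; exact: measurable_cube0.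
  apply: eq_integral => v _; rewrite indicE.
  have [vb|vb] := boolP (v \in _).
    rewrite mule1 -[RHS](@product_leb_affine R dL dR 1 1 (v *m embL s) (v *m embR s))//; try by rewrite mulr1.
    rewrite ysection_set; apply: (congr1 (leb dL \x leb dR)%E).
    apply/seteqP; split => p; rewrite /U/sh/= !scale1r ![_ *m _ + _]addrC; first by case.
    by move=> pS; split => //; exact: (set_mem vb).
  rewrite mule0 (_ : ysection U v = set0) ?measure0// ysection_set.
  by apply/seteqP; split => // p [vb' _]; move/negP: vb; apply; exact/mem_set.
(* if |v| <= t moves p into the box of size t, then p is in the box of size t' *)
pose t' := l.+1%:R * t.
have t'0 : 0 <= t' by rewrite mulr_ge0 ?(ltW t0).
pose B := box dL t' `*` box dR t'.
have mB : measurable B by apply: measurableX; exact: measurable_cube0.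
pose K := ((quadratic_constant l)%:R / lam)%R.
have K0 : 0 <= K by rewrite divr_ge0 ?(ltW lam0).
have UE2 : (((leb dL \x leb dR) \x leb l) U <= (K%:E * leb l A) * (leb dL \x leb dR) B)%E.
  apply: (@le_trans _ _ (\int[(leb dL \x leb dR)%E]_p leb l (xsection U p))%E); first by [].
  rewrite -[X in (_ * _ X)%E]setIT -integral_indic// -ge0_integralZl//; last 2 first.
  - by apply/measurable_EFinP; exact: measurable_indic.
  - by rewrite mule_ge0.
  apply: ge0_le_integral => //.
  - exact: measurable_fun_xsection.
  - by apply: measurable_funeM; apply/measurable_EFinP; exact: measurable_indic.
  move=> p _ /=; rewrite indicE.
  have [pB|pB] := boolP (p \in B).
    rewrite mule1; apply: le_trans (minor_slice Q s p.1 p.2 t0 lam0 mA).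
    apply: le_measure; [exact/mem_set/measurable_xsection| |].
      apply/mem_set; rewrite [X in measurable X](_ : _ = [set v : 'rV[R]_l | forall i, (`|v 0 i| <= t)%R] `&`
        (fun v : 'rV[R]_l => `|\det (minor_mx Q s (p.1 + v *m embL s) (p.2 + v *m embR s))|) @^-1` `[lam, +oo[ `&`
        (fun v => Q (p.1 + v *m embL s) (p.2 + v *m embR s)) @^-1` A); last first.
        by apply/seteqP; split => v /=; rewrite in_itv/= andbT; [case|move=> [[]]].
      have mL n (M : 'M[R]_(l, n)) c : measurable_fun setT (fun v : 'rV[R]_l => c + v *m M).
        apply: measurable_fun_mxP => i j; under eq_fun do rewrite mxE.
        apply: measurable_funD; first exact: measurable_cst.
        by apply: (measurableT_comp (measurable_mx_coord i j)); exact: measurable_mulmxr.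
      apply: measurableI; last by rewrite -[X in measurable X]setTI; apply: measurable_bilinear.
      apply: measurableI; first exact: measurable_cube0.
      rewrite -[X in measurable X]setTI.
      have : measurable_fun setT (fun v : 'rV[R]_l =>
          `|\det (minor_mx Q s (p.1 + v *m embL s) (p.2 + v *m embR s))|).
        by apply: (measurableT_comp (@normr_measurable R setT)); exact: measurable_minor.
      by apply => //; exact: measurable_itv.
    by rewrite xsection_set => v; rewrite /U/sh/= => -[vt [_ _ h1 h2]].
  rewrite mule0 (_ : xsection U p = set0) ?measure0// xsection_set.
  apply/seteqP; split => // v; rewrite /U/sh/= => -[vt [h1 h2 _ _]].
  move/negP: pB; apply; apply/mem_set; split => i.
    have -> : p.1 0 i = (p.1 + v *m embL s) 0 i - (v *m embL s) 0 i by rewrite [(p.1 + _) 0 i]mxE addrK.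
    apply: le_trans (ler_normB _ _) _; rewrite /t' -natr1 mulrDl mul1r addrC.
    by rewrite lerD//; apply: norm_mul_emb_le => //; exact: embL1.
  have -> : p.2 0 i = (p.2 + v *m embR s) 0 i - (v *m embR s) 0 i by rewrite [(p.2 + _) 0 i]mxE addrK.
  apply: le_trans (ler_normB _ _) _; rewrite /t' -natr1 mulrDl mul1r addrC.
  by rewrite lerD//; apply: norm_mul_emb_le => //; exact: embR1.
have muB : (leb dL \x leb dR)%E B = ((2 * t') ^+ (dL + dR))%:E.
  rewrite product_measure1E; [|exact: measurable_cube0|exact: measurable_cube0].
  apply: (etrans (congr2 mule (leb_cube dL t'0) (leb_cube dR t'0))).
  by rewrite exprD EFinM.
rewrite UE1 muB in UE2.
have t20 : 0 < (2 * t) ^+ l by rewrite exprn_gt0// mulr_gt0.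
move: UE2; rewrite -lee_pdivlMr// => /le_trans; apply.
rewrite muleC muleA muleC !muleA -!EFinM lee_wpmul2r// lee_fin le_eqVlt; apply/orP; left; apply/eqP.
rewrite /minor_constant /K /t' !exprMn !invfM; ring.
Qed.

End minor_sublevel.

Section core_estimate.
Context {R : realType} {dL dR l : nat}.
Variable Q : {bilinear 'rV[R]_dL -> 'rV[R]_dR -> 'rV[R]_l}.
Hypothesis hl : (l <= dL + dR)%N.

(** The squared length of (x, y), whose power is the denominator of Phi. *)
Definition psq (p : 'rV[R]_dL * 'rV[R]_dR) : R := sqnorm p.1 + sqnorm p.2.

Lemma sqnorm_ge0 n (v : 'rV[R]_n) : 0 <= sqnorm v.
Proof. by apply: sumr_ge0 => i _; exact: sqr_ge0. Qed.

Lemma psq_ge0 p : 0 <= psq p. Proof. by rewrite addr_ge0// sqnorm_ge0. Qed.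

Lemma coord_le_sqnorm n (v : 'rV[R]_n) i : v 0 i ^+ 2 <= sqnorm v.
Proof. by rewrite /sqnorm (bigD1 i)//= lerDl sumr_ge0// => j _; exact: sqr_ge0. Qed.

Lemma norm_coord_le (v t : R) : 0 <= t -> v ^+ 2 <= t ^+ 2 -> `|v| <= t.
Proof. by move=> t0 vt; rewrite -(@ler_pXn2r _ 2) ?nnegrE// real_normK// num_real. Qed.

Lemma Vol_gt x y (a : R) : 0 <= a -> a < Vol Q x y ->
  exists s : {ffun 'I_l -> 'I_dL + 'I_dR}, a < `|\det (minor_mx Q s x y)|.
Proof.
move=> a0 aV; apply: contrapT => /forallNP H; move: aV; apply/negP; rewrite -leNgt.
by apply: bigmax_le => // s _; have /negP := H s; rewrite -leNgt.
Qed.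

Lemma Phi_gt p (t lam : R) : 0 < t -> 0 <= lam -> t ^+ 2 <= psq p -> lam < Phi Q p.1 p.2 ->
  lam * t ^+ (dL + dR - l) < Vol Q p.1 p.2.
Proof.
move=> t0 lam0 tp; rewrite /Phi -/(psq p).
have p0 : 0 < psq p by rewrite (lt_le_trans _ tp)// exprn_gt0.
rewrite ltr_pdivlMr ?powR_gt0//; apply: le_lt_trans.
rewrite ler_wpM2l//.
have -> : ((dL + dR)%:R - l%:R) / 2 = (dL + dR - l)%:R / 2 :> R by rewrite natrB.
have -> : t ^+ (dL + dR - l) = (t ^+ 2) `^ ((dL + dR - l)%:R / 2).
  rewrite -[t ^+ 2]powR_mulrn ?(ltW t0)// -powRrM mulrCA divff// mulr1 powR_mulrn// ltW//.
by apply: ge0_ler_powR; rewrite ?nnegrE ?divr_ge0 ?sqr_ge0 ?psq_ge0.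
Qed.

Definition core_constant : R :=
  #|{: {ffun 'I_l -> 'I_dL + 'I_dR}}|%:R * (@minor_constant R dL dR l * 2 ^+ (dL + dR - l)).

Lemma core_constant_ge0 : 0 <= core_constant.
Proof.
rewrite mulr_ge0// mulr_ge0 ?exprn_ge0//.
by rewrite divr_ge0 ?mulr_ge0 ?exprn_ge0 ?mulr_ge0.
Qed.

(** The pairs to be counted: M dyadic shells of outer radius T. *)
Definition core_set (T : R) (M : nat) (lam : R) (A : set 'rV[R]_l) :=
  [set p : 'rV[R]_dL * 'rV[R]_dR | [/\ psq p <= T ^+ 2, T ^+ 2 / 4 ^+ M < psq p,
    lam < Phi Q p.1 p.2 & A (Q p.1 p.2)]].

Lemma measurable_psq : measurable_fun setT psq.
Proof. by apply: measurable_funD; exact: measurable_sqnorm. Qed.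

Lemma measurable_core_set T M lam A : measurable A -> measurable (core_set T M lam A).
Proof.
move=> mA.
rewrite (_ : core_set _ _ _ _ = psq @^-1` `](T ^+ 2 / 4 ^+ M), (T ^+ 2)] `&`
  (fun p => Phi Q p.1 p.2) @^-1` `]lam, +oo[ `&` (fun p => Q p.1 p.2) @^-1` A); last first.
  apply/seteqP; split => p; rewrite /core_set/= !in_itv/= andbT; first by case=> -> ->.
  by move=> [[/andP[]]].
apply: measurableI; last by rewrite -[X in measurable X]setTI; apply: measurable_bilinear.
apply: measurableI; rewrite -[X in measurable X]setTI.
  by apply: measurable_psq => //; exact: measurable_itv.
by apply: (measurable_Phi Q measurable_fst measurable_snd) => //; exact: measurable_itv.
Qed.

(** On the shell of radius t the condition Phi > lambda forces a minor of size
    lambda t^(dL + dR - l), and [minor_sublevel] gives C t^(dL + dR) t^-l |A| divided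
    by it: the powers of t cancel, so every shell contributes the same. *)
Lemma core_estimate T M lam A : 0 < T -> 0 < lam -> measurable A ->
  ((leb dL \x leb dR) (core_set T M lam A) <= (core_constant * M%:R / lam)%:E * leb l A)%E.
Proof.
move=> T0 lam0 mA.
pose t (m : nat) := T / 2 ^+ m.
have t0 m : 0 < t m by rewrite divr_gt0// exprn_gt0.
pose k := (dL + dR - l)%N.
pose F (ms : 'I_M * {ffun 'I_l -> 'I_dL + 'I_dR}) :=
  minor_set Q ms.2 (t ms.1) (lam * t ms.1.+1 ^+ k) A.
have mF ms : measurable (F ms) by exact: measurable_minor_set.
have tE m : t m ^+ 2 = T ^+ 2 / 4 ^+ m.
  have -> : 4 = 2 ^+ 2 :> R by rewrite -natrX.
  by rewrite /t exprMn exprVn -!exprM mulnC.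
apply: (@le_trans _ _ (\sum_ms (leb dL \x leb dR)%E (F ms))).
  apply: le_measure_cover => //; first exact: measurable_core_set.
  move=> p [pT pM lamp Ap].
  have [m mM [pm pm1]] : exists2 m : nat, (m < M)%N & psq p <= t m ^+ 2 /\ t m.+1 ^+ 2 <= psq p.
    elim: {1 2}M pM => [|N IHN]; first by rewrite expr0 divr1 ltNge pT.
    move=> pN; have [pN'|pN'] := ltP (T ^+ 2 / 4 ^+ N) (psq p).
      by have [m mN ?] := IHN pN'; exists m => //; exact: ltnW.
    by exists N => //; rewrite !tE; split => //; exact: ltW.
  have [s ps] := @Vol_gt p.1 p.2 (lam * t m.+1 ^+ k)
    (mulr_ge0 (ltW lam0) (exprn_ge0 _ (ltW (t0 _)))) (Phi_gt (t0 m.+1) (ltW lam0) pm1 lamp).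
  exists (Ordinal mM, s) => //; split => //=; last exact: ltW.
    move=> i; apply: norm_coord_le; first exact/ltW.
    by apply: le_trans pm; apply: le_trans (coord_le_sqnorm _ i) _; rewrite lerDl sqnorm_ge0.
  move=> i; apply: norm_coord_le; first exact/ltW.
  by apply: le_trans pm; apply: le_trans (coord_le_sqnorm _ i) _; rewrite lerDr sqnorm_ge0.
have C0 : 0 <= (@minor_constant R dL dR l * 2 ^+ k / lam).
  rewrite divr_ge0 ?(ltW lam0)// mulr_ge0 ?exprn_ge0//.
  by rewrite divr_ge0 ?mulr_ge0 ?exprn_ge0 ?mulr_ge0.
apply: (@le_trans _ _ (\sum_(ms : 'I_M * {ffun 'I_l -> 'I_dL + 'I_dR})
   (@minor_constant R dL dR l * 2 ^+ k / lam)%:E * leb l A)%E).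
  apply: lee_sum => -[m s] _; rewrite /F/=.
  have lamt : 0 < lam * t m.+1 ^+ k by rewrite mulr_gt0// exprn_gt0.
  apply: le_trans (minor_sublevel Q s (t0 m) lamt mA) _.
  rewrite lee_wpmul2r// lee_fin le_eqVlt; apply/orP; left; apply/eqP.
  have tn0 : t m != 0 by rewrite gt_eqF.
  have -> : t m.+1 = t m / 2 by rewrite /t exprSr invfM mulrA.
  rewrite -[in t m ^+ (dL + dR)](subnKC hl) exprD -/k.
  move: (t m) tn0 => tm tn0; rewrite [(tm / 2) ^+ k]exprMn exprVn.
  move: (@minor_constant R dL dR l) (tm ^+ l) (expf_neq0 l tn0) (tm ^+ k) (expf_neq0 k tn0)
    (2 ^+ k) (expf_neq0 k (lt0r_neq0 (ltr0Sn R 1))) => mc tl tl0 tk tk0 b b0.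
  by field; rewrite tl0 tk0 b0 gt_eqF.
rewrite -ge0_sume_distrl//.
rewrite sumEFin sumr_const card_prod card_ord lee_wpmul2r// lee_fin le_eqVlt.
apply/orP; left; apply/eqP; rewrite /core_constant -[LHS]mulr_natr natrM -/k.
by rewrite -!mulrA; ring.
Qed.

End core_estimate.

(** * Tonelli for triple products, and thin fibres *)

Section coordinates.
Context {d1 d2 d3 : measure_display}.
Context {T1 : measurableType d1} {T2 : measurableType d2} {T3 : measurableType d3}.

Lemma measurable_fst_fst : measurable_fun setT (fun q : T1 * T2 * T3 => q.1.1).
Proof. exact: (measurableT_comp (@measurable_fst _ _ T1 T2) (@measurable_fst _ _ (T1 * T2)%type T3)). Qed.

Lemma measurable_snd_fst : measurable_fun setT (fun q : T1 * T2 * T3 => q.1.2).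
Proof. exact: (measurableT_comp (@measurable_snd _ _ T1 T2) (@measurable_fst _ _ (T1 * T2)%type T3)). Qed.

Lemma measurable_preimage d d' (T : measurableType d) (T' : measurableType d') (f : T -> T') A :
  measurable_fun setT f -> measurable A -> measurable (f @^-1` A).
Proof. by move=> mf mA; rewrite -[X in measurable X]setTI; exact: mf. Qed.

End coordinates.

Section fibers.
Local Open Scope ereal_scope.
Context {R : realType} {d1 d2 d3 : measure_display}.
Context {T1 : measurableType d1} {T2 : measurableType d2} {T3 : measurableType d3}.
Variable m1 : {sigma_finite_measure set T1 -> \bar R}.
Variable m2 : {sigma_finite_measure set T2 -> \bar R}.
Variable m3 : {sigma_finite_measure set T3 -> \bar R}.

Lemma product_measureA (A : set (T1 * T2 * T3)) : measurable A ->
  (m1 \x m2 \x m3) A = \int[m1]_x (m2 \x m3) [set q | A (x, q.1, q.2)].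
Proof.
move=> mA; rewrite [LHS](@fubini_tonelli1 _ _ _ _ _ m1 m2 (fun p => m3 (xsection A p)))//.
exact: measurable_fun_xsection.
Qed.

Lemma measurable_tripleA (A : set (T1 * T2 * T3)) : measurable A ->
  measurable [set q : T2 * T3 * T1 | A (q.2, q.1.1, q.1.2)].
Proof.
move=> mA; apply: (measurable_preimage (f := fun q : T2 * T3 * T1 => (q.2, q.1.1, q.1.2))) mA.
apply: measurable_fun_pair; last exact: measurable_snd_fst.
by apply: measurable_fun_pair; [exact: measurable_snd|exact: measurable_fst_fst].
Qed.

Lemma product_measure_rot (A : set (T1 * T2 * T3)) : measurable A ->
  (m1 \x m2 \x m3) A =
  (product_sf m2 m3 \x m1) [set q : T2 * T3 * T1 | A (q.2, q.1.1, q.1.2)].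
Proof.
move=> mA; apply: etrans (product_measureA mA) _; apply: esym.
apply: etrans (product_measureEy (product_sf m2 m3) m1 (measurable_tripleA mA)) _.
by apply: eq_integral => x _; rewrite ysection_set.
Qed.

Lemma product_measureC (A : set (T1 * T2)) : measurable A ->
  (m1 \x m2) A = (m2 \x m1) [set q : T2 * T1 | A (q.2, q.1)].
Proof.
move=> mA; apply: etrans (product_measureEy m1 m2 mA) _.
by apply: eq_integral => x _; rewrite ysection_set /= xsection_set.
Qed.

(** Points whose fibre over G is thin: there are few of them, by Tonelli. *)
Lemma measure_sparse_fibers (E : set (T1 * T2)) (G D : set T1) (c : R) :
  measurable E -> measurable G -> measurable D -> (0 <= c)%R ->
  (forall e, E e -> G e.1) -> (forall x, D x -> m2 (xsection E x) <= c%:E) ->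
  (m1 \x m2) (E `&` D `*` setT) <= c%:E * m1 G.
Proof.
move=> mE mG mD c0 EG Dc.
have mED : measurable (E `&` D `*` setT) by apply: measurableI => //; exact: measurableX.
rewrite -[X in _ <= _ * m1 X]setIT -[X in _ <= _ * X]integral_indic// -ge0_integralZl//; last first.
  by apply/measurable_EFinP; exact: measurable_indic.
apply: ge0_le_integral => //.
- exact: measurable_fun_xsection.
- by apply: measurable_funeM; apply/measurable_EFinP; exact: measurable_indic.
move=> x _ /=; have [Dx|nDx] := pselect (D x); last first.
  rewrite xsection_set (_ : [set _ | _] = set0) ?measure0 ?mule_ge0 ?lee_fin//.
  by apply/seteqP; split => // y [_ [/=]].
have [->|/set0P[y]] := eqVneq (xsection (E `&` D `*` setT) x) set0.
  by rewrite measure0 mule_ge0 ?lee_fin.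
rewrite {1}xsection_set => -[Exy _]; rewrite indicE mem_set; last exact: (EG _ Exy).
rewrite mule1; apply: le_trans (Dc _ Dx); apply: le_measure.
- exact/mem_set/measurable_xsection.
- exact/mem_set/measurable_xsection.
- by rewrite !xsection_set => z [].
Qed.

End fibers.

Lemma product_measure_swap23 (R : realType) (d1 d2 d3 : measure_display)
  (T1 : measurableType d1) (T2 : measurableType d2) (T3 : measurableType d3)
  (m1 : {sigma_finite_measure set T1 -> \bar R})
  (m2 : {sigma_finite_measure set T2 -> \bar R})
  (m3 : {sigma_finite_measure set T3 -> \bar R}) (A : set (T1 * T2 * T3)) :
  measurable A ->
  (m1 \x m2 \x m3)%E A = (product_sf m1 m3 \x m2)%E [set q | A (q.1.1, q.2, q.1.2)].
Proof.
move=> mA.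
have mA' : measurable [set q : T1 * T3 * T2 | A (q.1.1, q.2, q.1.2)].
  apply: (measurable_preimage (f := fun q : T1 * T3 * T2 => (q.1.1, q.2, q.1.2))) mA.
  apply: measurable_fun_pair; last exact: measurable_snd_fst.
  by apply: measurable_fun_pair; [exact: measurable_fst_fst|exact: measurable_snd].
apply: etrans (product_measureA m1 m2 m3 mA) _; apply: esym.
apply: etrans (product_measureA m1 m3 m2 mA') _; apply: esym.
apply: eq_integral => x _; apply: product_measureC.
apply: (measurable_preimage (f := fun q : T2 * T3 => (x, q.1, q.2))) mA.
apply: measurable_fun_pair; last exact: measurable_snd.
by apply: measurable_fun_pair; [exact: measurable_cst|exact: measurable_fst].
Qed.

(** * Counting paths from above *)

Section measurable_vectors.
Context {R : realType} {d : measure_display} {T : measurableType d} {n : nat}.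
Variables (f g : T -> 'rV[R]_n).
Hypotheses (mf : measurable_fun setT f) (mg : measurable_fun setT g).

Lemma measurable_rVD : measurable_fun setT (fun x => f x + g x).
Proof.
apply: measurable_fun_mxP => i j; under eq_fun do rewrite mxE.
by rewrite ord1; apply: measurable_funD; exact: measurable_coord.
Qed.

Lemma measurable_rVB : measurable_fun setT (fun x => f x - g x).
Proof.
apply: measurable_fun_mxP => i j; under eq_fun do rewrite !mxE.
by rewrite ord1; apply: measurable_funB; exact: measurable_coord.
Qed.

End measurable_vectors.

Section paths.
Context {R : realType} {dL dR l : nat}.
Variable Q : {bilinear 'rV[R]_dL -> 'rV[R]_dR -> 'rV[R]_l}.
Hypothesis hl : (l <= dL + dR)%N.
Let X := 'rV[R]_dL. Let Y := 'rV[R]_dR. Let Z := 'rV[R]_l.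
Variables (Om : set (X * Y * Z)) (F : set (Y * Z)) (G : set (X * Z)).
Hypotheses (mOm : measurable Om) (mF : measurable F) (mG : measurable G).

(** The product measures with their sigma-finiteness attached. *)
Definition mu2 : {sigma_finite_measure set (X * Y)%type -> \bar R} :=
  product_sf (leb dL) (leb dR).
Definition mu3 : {sigma_finite_measure set (X * Y * Z)%type -> \bar R} :=
  product_sf mu2 (leb l).

Definition incidences : set (X * Y * Z) :=
  [set e | [/\ Om e, F (e.1.2, e.2 + Q e.1.1 e.1.2) & G (e.1.1, e.2)]].

(** The points of Sigma with the same image in F as e. *)
Definition fiberL (e : X * Y * Z) : set X :=
  [set x | incidences (x, e.1.2, e.2 + Q e.1.1 e.1.2 - Q x e.1.2)].
(** The points of Sigma with the same image in G as e. *)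
Definition fiberR (e : X * Y * Z) : set Y := [set y | incidences (e.1.1, y, e.2)].

Lemma measurable_incidences : measurable incidences.
Proof.
rewrite (_ : incidences = Om `&` (fun e => (e.1.2, e.2 + Q e.1.1 e.1.2)) @^-1` F `&`
   (fun e => (e.1.1, e.2)) @^-1` G); last first.
  by apply/seteqP; split => e; [case|case=> -[]].
apply: measurableI; [apply: measurableI => //|]; apply: measurable_preimage => //.
  apply: measurable_fun_pair; first exact: measurable_snd_fst.
  apply: measurable_rVD; first exact: measurable_snd.
  by apply: measurable_bilinear; [exact: measurable_fst_fst|exact: measurable_snd_fst].
by apply: measurable_fun_pair; [exact: measurable_fst_fst|exact: measurable_snd].
Qed.

(** A path is stored as its middle point (x1, y1, z1) and the pair (x0, y2). *)
Definition path_set (T : R) (M : nat) (lam : R) : set (X * Y * Z * (X * Y)) :=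
  [set w | [/\ incidences w.1, fiberL w.1 w.2.1, fiberR w.1 w.2.2 &
    core_set Q T M lam setT (w.2.1 - w.1.1.1, w.2.2 - w.1.1.2)]].

Lemma measurable_path_set T M lam : measurable (path_set T M lam).
Proof.
have mI := measurable_incidences.
have m1 : measurable_fun setT (fun w : X * Y * Z * (X * Y) => w.1) by exact: measurable_fst.
have mx1 : measurable_fun setT (fun w : X * Y * Z * (X * Y) => w.1.1.1).
  exact: (measurableT_comp measurable_fst_fst m1).
have my1 : measurable_fun setT (fun w : X * Y * Z * (X * Y) => w.1.1.2).
  exact: (measurableT_comp measurable_snd_fst m1).
have mz1 : measurable_fun setT (fun w : X * Y * Z * (X * Y) => w.1.2).
  exact: (measurableT_comp measurable_snd m1).
have m2 : measurable_fun setT (fun w : X * Y * Z * (X * Y) => w.2) by exact: measurable_snd.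
have mx0 : measurable_fun setT (fun w : X * Y * Z * (X * Y) => w.2.1).
  exact: (measurableT_comp measurable_fst m2).
have my2 : measurable_fun setT (fun w : X * Y * Z * (X * Y) => w.2.2).
  exact: (measurableT_comp measurable_snd m2).
rewrite (_ : path_set _ _ _ = (fun w => w.1) @^-1` incidences `&`
  (fun w => (w.2.1, w.1.1.2, w.1.2 + Q w.1.1.1 w.1.1.2 - Q w.2.1 w.1.1.2)) @^-1` incidences `&`
  (fun w => (w.1.1.1, w.2.2, w.1.2)) @^-1` incidences `&`
  (fun w => (w.2.1 - w.1.1.1, w.2.2 - w.1.1.2)) @^-1` core_set Q T M lam setT); last first.
  by apply/seteqP; split => e; [case|case=> -[[]]].
apply: measurableI; [apply: measurableI; [apply: measurableI|]|]; apply: measurable_preimage => //.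
- apply: measurable_fun_pair; first exact: measurable_fun_pair.
  apply: measurable_rVB; last exact: measurable_bilinear.
  by apply: measurable_rVD => //; exact: measurable_bilinear.
- by apply: measurable_fun_pair => //; exact: measurable_fun_pair.
- by apply: measurable_fun_pair; exact: measurable_rVB.
- exact: measurable_core_set.
Qed.

Let path_ysection T M lam (q : X * Y) : 0 < T -> 0 < lam ->
  (mu3 (ysection (path_set T M lam) q) <=
   (@core_constant R dL dR l * M%:R / lam)%:E * leb l (xsection F q.2) * leb l (xsection G q.1))%E.
Proof.
move=> T0 lam0; set K := (_ / lam).
have K0 : 0 <= K by rewrite divr_ge0 ?(ltW lam0)// mulr_ge0// core_constant_ge0.
(* the third coordinate of a point of V is the z-coordinate of the end in G *)
pose V : set (X * Y * Z) := [set e | [/\ core_set Q T M lam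
   [set w : Z | F (q.2, e.2 + Q q.1 q.2 - w)] (q.1 - e.1.1, q.2 - e.1.2) & G (q.1, e.2)]].
have mV : measurable V.
  rewrite (_ : V = (fun e => (q.1 - e.1.1, q.2 - e.1.2)) @^-1` core_set Q T M lam setT `&`
     (fun e => (q.2, e.2 + Q q.1 q.2 - Q (q.1 - e.1.1) (q.2 - e.1.2))) @^-1` F `&`
     (fun e => (q.1, e.2)) @^-1` G); last first.
    by apply/seteqP; split => e; [case=> -[]|case=> -[[]]].
  have mu : measurable_fun setT (fun e : X * Y * Z => q.1 - e.1.1).
    by apply: measurable_rVB; [exact: measurable_cst|exact: measurable_fst_fst].
  have mv : measurable_fun setT (fun e : X * Y * Z => q.2 - e.1.2).
    by apply: measurable_rVB; [exact: measurable_cst|exact: measurable_snd_fst].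
  apply: measurableI; [apply: measurableI|]; apply: measurable_preimage => //.
  - exact: measurable_fun_pair.
  - exact: measurable_core_set.
  - apply: measurable_fun_pair; first exact: measurable_cst.
    apply: measurable_rVB; last exact: measurable_bilinear.
    by apply: measurable_rVD; [exact: measurable_snd|exact: measurable_cst].
  - by apply: measurable_fun_pair; [exact: measurable_cst|exact: measurable_snd].
apply: (@le_trans _ _ (mu3 V)).
  apply: ge0_le_integral => //.
  - by apply: measurable_fun_xsection; apply: measurable_ysection; exact: measurable_path_set.
  - exact: measurable_fun_xsection.
  move=> p _ /=.
  rewrite -[leRHS](@leb_affine R l 1 (Q (p.1 - q.1) p.2)) ?mulr1//; last exact: measurable_xsection.
  apply: le_measure.
  - apply/mem_set; apply: measurable_xsection; apply: measurable_ysection.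
    exact: measurable_path_set.
  - apply/mem_set; apply: (measurable_preimage (measurable_affine _ _)).
    exact: measurable_xsection.
  rewrite xsection_set ysection_set => z /= [] [_ _ _] [/= _ _ Gq] [/= _ Fq _] cq.
  rewrite xsection_set; rewrite /V/= scale1r.
  have e1 : Q (p.1 - q.1) p.2 + z = z + Q p.1 p.2 - Q q.1 p.2.
    by rewrite bilinearDl -scaleN1r bilinearZl scaleN1r addrC addrA.
  split; last by rewrite e1.
  case: cq => c1 c2 c3 _; split => //=.
  rewrite (_ : _ - Q _ _ = z + Q p.1 q.2)// e1.
  rewrite !(bilinearDl, bilinearDr) -![- p.1]scaleN1r -![- p.2]scaleN1r !(bilinearZl,bilinearZr).
  by apply/rowP => k; rewrite !mxE; ring.
have mFq : measurable (xsection F q.2) by exact: measurable_xsection.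
have mGq : measurable (xsection G q.1) by exact: measurable_xsection.
apply: le_trans (_ : (\int[leb l]_z mu2 (ysection V z) <= _)%E).
  by rewrite -(product_measureEy mu2 (leb l) mV).
rewrite -[X in (_ <= _ * leb l X)%E]setIT -[X in (_ <= _ * X)%E]integral_indic//.
have KF0 : (0 <= K%:E * leb l (xsection F q.2))%E by rewrite mule_ge0.
rewrite -ge0_integralZl//; last first.
  by apply/measurable_EFinP; exact: measurable_indic.
apply: ge0_le_integral => //.
- exact: measurable_fun_ysection.
- by apply: measurable_funeM; apply/measurable_EFinP; exact: measurable_indic.
move=> z _; rewrite indicE.
have [Gz|nGz] := pselect (G (q.1, z)); last first.
  rewrite (_ : ysection V z = set0) ?measure0 ?mule_ge0 ?lee_fin//.
  by rewrite ysection_set; apply/seteqP; split => // p [].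
rewrite mem_set; last by rewrite xsection_set.
rewrite mule1.
have AE : measurable [set w : Z | F (q.2, z + Q q.1 q.2 - w)].
  apply: (measurable_preimage (f := fun w : Z => (q.2, z + Q q.1 q.2 - w))) mF.
  apply: measurable_fun_pair; first exact: measurable_cst.
  by apply: measurable_rVB; first exact: measurable_cst.
have -> : leb l (xsection F q.2) = leb l [set w : Z | F (q.2, z + Q q.1 q.2 - w)].
  rewrite -[LHS](@leb_affine R l (-1) (z + Q q.1 q.2)) ?mulrNN ?mulr1//.
  congr (leb l _); apply/seteqP; split => w; rewrite xsection_set/= scaleN1r.
    by [].
  by [].
apply: le_trans (core_estimate Q hl M T0 lam0 AE).
rewrite -[leRHS](@product_leb_affine R dL dR (-1) (-1) q.1 q.2) ?mulrNN ?mulr1//; last first.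
  exact: measurable_core_set.
apply: le_measure.
- by apply/mem_set; exact: measurable_ysection.
- apply/mem_set.
  apply: (measurable_preimage (f := fun p : X * Y => (q.1 + -1 *: p.1, q.2 + -1 *: p.2))).
    by apply: measurable_fun_pair;
      [apply: (measurableT_comp (measurable_affine _ _)); exact: measurable_fst
      |apply: (measurableT_comp (measurable_affine _ _)); exact: measurable_snd].
  exact: measurable_core_set.
- by rewrite ysection_set => p [Vp _] /=; rewrite !scaleN1r.
Qed.

(** Fix (x0, y2) and replace z1 by the z-coordinate of the end in G, which is a
    translation for fixed (x1, y1).  Then (x1, y1) is constrained by the core set with
    A a reflected fibre of F, which depends on z0 by a translation only. *)
Lemma path_set_le T M lam : 0 < T -> 0 < lam ->
  ((mu3 \x mu2) (path_set T M lam) <=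
   (@core_constant R dL dR l * M%:R / lam)%:E * ((leb dR \x leb l) F * (leb dL \x leb l) G))%E.
Proof.
move=> T0 lam0; set K := (_ / lam).
have K0 : 0 <= K by rewrite divr_ge0 ?(ltW lam0)// mulr_ge0// core_constant_ge0.
rewrite (product_measureEy mu3 mu2 (measurable_path_set T M lam)).
have mf : measurable_fun setT (fun y => leb l (xsection F y)) by exact: measurable_fun_xsection.
have mg : measurable_fun setT (fun x => leb l (xsection G x)) by exact: measurable_fun_xsection.
apply: (@le_trans _ _ (\int[mu2]_q (K%:E * leb l (xsection F q.2) * leb l (xsection G q.1)))%E).
  apply: ge0_le_integral => //.
  - by apply: (measurable_fun_ysection mu3); exact: measurable_path_set.
  - apply: emeasurable_funM; last exact: (measurableT_comp mg measurable_fst).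
    by apply: measurable_funeM; exact: (measurableT_comp mf measurable_snd).
  by move=> q _; exact: path_ysection.
rewrite (@fubini_tonelli1 _ _ _ _ R (leb dL) (leb dR)
   (fun q => K%:E * leb l (xsection F q.2) * leb l (xsection G q.1))%E); last 2 first.
- apply: emeasurable_funM; last exact: (measurableT_comp mg measurable_fst).
  by apply: measurable_funeM; exact: (measurableT_comp mf measurable_snd).
- by move=> q; rewrite !mule_ge0.
rewrite [leLHS](_ : _ = \int[leb dL]_x (K%:E * (leb dR \x leb l) F * leb l (xsection G x)))%E; last first.
  apply: eq_integral => x _; rewrite /fubini_F/= muleC -ge0_integralZl//.
  rewrite -ge0_integralZl//; last 2 first.
  - by apply: measurable_funeM.
  - by move=> y _; rewrite mule_ge0.
  by apply: eq_integral => y _; rewrite muleC.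
by rewrite ge0_integralZl ?mule_ge0// muleA.
Qed.

End paths.

(** * Counting paths from below *)

Section good_pairs.
Context {R : realType} {dL dR l : nat}.
Variable Q : {bilinear 'rV[R]_dL -> 'rV[R]_dR -> 'rV[R]_l}.
Let X := 'rV[R]_dL. Let Y := 'rV[R]_dR.

(** The hypothesis on W for Borel sets of finite measure, as a bound for the measure
    of the sublevel set; ip and ir stand for 1/pl and 1/pr. *)
Definition borel_sublevel (U : set X) (V : set Y) (s ip ir C : R) : Prop :=
  forall (El : set X) (Er : set Y) (a al ar : R), measurable El -> measurable Er ->
    El `<=` U -> Er `<=` V -> 0 < a -> leb dL El = al%:E -> leb dR Er = ar%:E ->
    (mu2 ([set p | Phi Q p.1 p.2 <= a]%R `&` El `*` Er) <=
     (C * a `^ s * al `^ ip * ar `^ ir)%:E)%E.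

Lemma measurable_Phi_le (a : R) : measurable [set p : X * Y | Phi Q p.1 p.2 <= a].
Proof.
rewrite (_ : [set _ | _] = (fun p : X * Y => Phi Q p.1 p.2) @^-1` `]-oo, a]).
  apply: measurable_preimage; last exact: measurable_itv.
  exact: measurable_Phi.
by apply/seteqP; split => p; rewrite /= in_itv/=.
Qed.

Lemma psq_ball_le (rho : R) : 0 <= rho ->
  (mu2 [set p : X * Y | psq p <= rho ^+ 2]%R <= ((2 * rho) ^+ (dL + dR))%:E)%E.
Proof.
move=> r0; rewrite exprD EFinM.
apply: (@le_trans _ _ (mu2 ([set v : X | forall i, `|v 0 i| <= rho]%R `*`
                            [set v : Y | forall i, `|v 0 i| <= rho]%R))%E).
  apply: le_measure.
  - apply/mem_set; rewrite (_ : [set _ | _] = @psq R dL dR @^-1` `]-oo, (rho ^+ 2)]).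
      by apply: measurable_preimage; [exact: measurable_psq|exact: measurable_itv].
    by apply/seteqP; split => p; rewrite /= in_itv/=.
  - by apply/mem_set; apply: measurableX; exact: measurable_cube0.
  - move=> p /= pr; split => i; apply: norm_coord_le => //; apply: le_trans pr;
      apply: le_trans (coord_le_sqnorm _ i) _; rewrite /psq.
      by rewrite lerDl sqnorm_ge0.
    by rewrite lerDr sqnorm_ge0.
rewrite [leLHS](product_measure1E (leb dL) (leb dR)); [|exact: measurable_cube0|exact: measurable_cube0].
by apply: lee_pmul => //; rewrite le_eqVlt -(rwP orP); left; apply/eqP; exact: leb_cube.
Qed.

(** A pair in the product of El and Er is good, or has small Phi, or lies in the
    small ball below all the shells; the last two cases take at most a quarter each. *)
Lemma good_pairs (U : set X) (V : set Y) (s ip ir C T lam al ar : R) M El Er :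
  borel_sublevel U V s ip ir C ->
  0 < T -> 0 < lam -> measurable El -> measurable Er -> El `<=` U -> Er `<=` V ->
  leb dL El = al%:E -> leb dR Er = ar%:E ->
  (forall u v, El u -> Er v -> psq (u, v) <= T ^+ 2) ->
  C * lam `^ s * al `^ ip * ar `^ ir <= al * ar / 4 ->
  (2 * (T / 2 ^+ M)) ^+ (dL + dR) <= al * ar / 4 ->
  ((al * ar / 2)%:E <= mu2 (core_set Q T M lam setT `&` El `*` Er))%E.
Proof.
move=> sub T0 lam0 mEl mEr ElU ErV hal har ET hlam hrho.
set good := core_set _ _ _ _ _ `&` _.
pose bad := [set p : X * Y | Phi Q p.1 p.2 <= lam] `&` El `*` Er.
pose near0 := [set p : X * Y | psq p <= (T / 2 ^+ M) ^+ 2].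
have mgood : measurable good.
  by apply: measurableI; [exact: measurable_core_set|exact: measurableX].
have mbad : measurable bad.
  by apply: measurableI; [exact: measurable_Phi_le|exact: measurableX].
have mnear : measurable near0.
  rewrite (_ : near0 = @psq R dL dR @^-1` `]-oo, ((T / 2 ^+ M) ^+ 2)]).
    by apply: measurable_preimage; [exact: measurable_psq|exact: measurable_itv].
  by apply/seteqP; split => p; rewrite /= in_itv/=.
have cover : El `*` Er `<=` good `|` bad `|` near0.
  move=> [u v] [/= Eu Ev].
  have [h|h] := leP (psq (u, v)) ((T / 2 ^+ M) ^+ 2); first by right.
  have [h'|h'] := leP (Phi Q u v) lam; first by left; right.
  left; left; split => //; split => //; first exact: ET.
  apply: le_lt_trans h; rewrite exprMn exprVn -exprM mulnC exprM.
  by rewrite (_ : 2 ^+ 2 = 4)// expr2 -natrM.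
have : ((al * ar)%:E <= mu2 good + mu2 bad + mu2 near0)%E.
  have -> : (al * ar)%:E = mu2 (El `*` Er).
    by rewrite EFinM -hal -har; apply/esym; exact: product_measure1E.
  apply: (@le_trans _ _ (mu2 (good `|` bad `|` near0))).
    apply: le_measure => //; apply/mem_set; first exact: measurableX.
    by do 2 apply: measurableU => //.
  apply: le_trans (measureU2 _ _ _) _ => //; first exact: measurableU.
  by apply: leeD => //; exact: measureU2.
have hbad : (mu2 bad <= (al * ar / 4)%:E)%E.
  by apply: le_trans (sub _ _ _ _ _ mEl mEr ElU ErV lam0 hal har) _; rewrite lee_fin.
have hnear : (mu2 near0 <= (al * ar / 4)%:E)%E.
  apply: le_trans (psq_ball_le _) _; last by rewrite lee_fin.
  by rewrite divr_ge0 ?(ltW T0).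
move=> h; have {}h : ((al * ar)%:E <= mu2 good + (al * ar / 4)%:E + (al * ar / 4)%:E)%E.
  by apply: le_trans h _; rewrite leeD// leeD.
rewrite -addeA -EFinD -leeBlDr// -EFinB in h; apply: le_trans h; rewrite lee_fin; lra.
Qed.

End good_pairs.

Section refinement.
Context {R : realType} {dL dR l : nat}.
Variable Q : {bilinear 'rV[R]_dL -> 'rV[R]_dR -> 'rV[R]_l}.
Hypothesis hl : (l <= dL + dR)%N.
Let X := 'rV[R]_dL. Let Y := 'rV[R]_dR. Let Z := 'rV[R]_l.
Variables (Om : set (X * Y * Z)) (F : set (Y * Z)) (G : set (X * Z)).
Hypotheses (mOm : measurable Om) (mF : measurable F) (mG : measurable G).
Variables (U : set X) (V : set Y) (T : R).
Hypothesis T0 : 0 < T.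
Hypothesis OmT : forall e e', Om e -> Om e' ->
  sqnorm (e'.1.1 - e.1.1) <= T ^+ 2 / 2 /\ sqnorm (e'.1.2 - e.1.2) <= T ^+ 2 / 2.
Hypothesis OmU : forall e e', Om e -> Om e' -> U (e'.1.1 - e.1.1) /\ V (e'.1.2 - e.1.2).

Let I := incidences Q Om F G.
Let FL := fiberL Q Om F G.
Let FR := fiberR Q Om F G.
Let mI : measurable I. Proof. exact: measurable_incidences. Qed.

Lemma mu3_shear (A : set (X * Y * Z)) : measurable A ->
  mu3 A = mu3 [set e : X * Y * Z | A (e.1, e.2 - Q e.1.1 e.1.2)].
Proof.
move=> mA; apply: eq_integral => p _ /=.
rewrite -[LHS](@leb_affine R l 1 (- Q p.1 p.2)) ?mulr1//; last exact: measurable_xsection.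
by congr (leb l _); rewrite !xsection_set; apply/seteqP; split => z /=; rewrite scale1r addrC.
Qed.

(* E1 and E2 are Sigma fibred over G and over F; E2' uses the coordinate w = z + Q(x, y) *)
Let E1 : set (X * Z * Y) := [set q | I (q.1.1, q.2, q.1.2)].
Let E2' : set (X * Y * Z) := [set e | I (e.1, e.2 - Q e.1.1 e.1.2)].
Let E2 : set (Y * Z * X) := [set q | E2' (q.2, q.1.1, q.1.2)].

Let mE1 : measurable E1.
Proof.
apply: (measurable_preimage (f := fun q : X * Z * Y => (q.1.1, q.2, q.1.2))) mI.
apply: measurable_fun_pair; last exact: measurable_snd_fst.
by apply: measurable_fun_pair; [exact: measurable_fst_fst|exact: measurable_snd].
Qed.

Let mE2' : measurable E2'.
Proof.
apply: (measurable_preimage (f := fun e : X * Y * Z => (e.1, e.2 - Q e.1.1 e.1.2))) mI.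
apply: measurable_fun_pair; first exact: measurable_fst.
apply: measurable_rVB; first exact: measurable_snd.
by apply: measurable_bilinear; [exact: measurable_fst_fst|exact: measurable_snd_fst].
Qed.

Let mE2 : measurable E2. Proof. exact: measurable_tripleA. Qed.

Let mu3_I1 (D : set (X * Z)) : measurable D ->
  mu3 (I `&` [set e | D (e.1.1, e.2)]) =
  (product_sf (leb dL) (leb l) \x leb dR)%E (E1 `&` D `*` setT).
Proof.
move=> mD; have mID : measurable (I `&` [set e | D (e.1.1, e.2)]).
  apply: measurableI => //.
  apply: (measurable_preimage (f := fun e : X * Y * Z => (e.1.1, e.2))) mD.
  by apply: measurable_fun_pair; [exact: measurable_fst_fst|exact: measurable_snd].
rewrite [LHS](product_measure_swap23 (leb dL) (leb dR) (leb l) mID).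
apply: (congr1 (product_measure1 _ _)).
by apply/seteqP; split => -[[? ?] ?]; [case|case=> ? []].
Qed.

Let mu3_I2 (D : set (Y * Z)) : measurable D ->
  mu3 (I `&` [set e | D (e.1.2, e.2 + Q e.1.1 e.1.2)]) =
  (product_sf (leb dR) (leb l) \x leb dL)%E (E2 `&` D `*` setT).
Proof.
move=> mD; have mD1 : measurable [set e : X * Y * Z | D (e.1.2, e.2 + Q e.1.1 e.1.2)].
  apply: (measurable_preimage (f := fun e : X * Y * Z => (e.1.2, e.2 + Q e.1.1 e.1.2))) mD.
  apply: measurable_fun_pair; first exact: measurable_snd_fst.
  apply: measurable_rVD; first exact: measurable_snd.
  by apply: measurable_bilinear; [exact: measurable_fst_fst|exact: measurable_snd_fst].
have mD2 : measurable [set e : X * Y * Z | D (e.1.2, e.2)].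
  apply: (measurable_preimage (f := fun e : X * Y * Z => (e.1.2, e.2))) mD.
  by apply: measurable_fun_pair; [exact: measurable_snd_fst|exact: measurable_snd].
rewrite mu3_shear; last exact: measurableI.
have -> : [set e : X * Y * Z | (I `&` [set e | D (e.1.2, e.2 + Q e.1.1 e.1.2)])
    (e.1, e.2 - Q e.1.1 e.1.2)] = E2' `&` [set e | D (e.1.2, e.2)].
  by apply/seteqP; split => e []; rewrite /= subrK.
rewrite [LHS](product_measure_rot (leb dL) (leb dR) (leb l) (measurableI _ _ mE2' mD2)).
apply: (congr1 (product_measure1 _ _)).
by apply/seteqP; split => -[[? ?] ?]; [case|case=> ? []].
Qed.

Lemma cube_section_le n (A : set 'rV[R]_n) (c : 'rV[R]_n) : measurable A ->
  (forall v, A v -> sqnorm (v - c) <= T ^+ 2 / 2) -> (leb n A <= ((2 * T) ^+ n)%:E)%E.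
Proof.
move=> mA hA; rewrite -(leb_cube n (ltW T0)) -(@leb_affine R n 1 c)// ?mulr1//.
apply: le_measure.
- by apply/mem_set; apply: (measurable_preimage (measurable_affine _ _)).
- by apply/mem_set; exact: measurable_cube0.
- move=> v /hA; rewrite scale1r addrAC subrr add0r => hv i.
  apply: norm_coord_le; first exact: ltW.
  apply: le_trans (coord_le_sqnorm v i) _; apply: le_trans hv _.
  by rewrite ler_pdivrMr// ler_peMr ?sqr_ge0// ler1n.
Qed.

Lemma fiberR_le e : I e -> (leb dR (FR e) <= ((2 * T) ^+ dR)%:E)%E.
Proof.
move=> [Oe _ _]; apply: (@cube_section_le _ _ e.1.2).
  have := measurable_xsection (e.1.1, e.2) mE1; rewrite xsection_set; exact.
by move=> y [Oy _ _]; have [_] := OmT Oe Oy.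
Qed.

Lemma fiberL_le e : I e -> (leb dL (FL e) <= ((2 * T) ^+ dL)%:E)%E.
Proof.
move=> [Oe _ _]; apply: (@cube_section_le _ _ e.1.1).
  have := measurable_xsection (e.1.2, e.2 + Q e.1.1 e.1.2) mE2; rewrite xsection_set; exact.
by move=> y [Oy _ _]; have [] := OmT Oe Oy.
Qed.

(** All fibres over G lie in a ball of radius T. *)
Lemma incidences_leG : (mu3 I <= ((2 * T) ^+ dR)%:E * (leb dL \x leb l) G)%E.
Proof.
rewrite -[I]setIT -[setT](_ : [set e : X * Y * Z | [set: X * Z] (e.1.1, e.2)] = _); last exact/seteqP.
rewrite mu3_I1//; apply: measure_sparse_fibers => //.
- by rewrite exprn_ge0// mulr_ge0// ltW.
- by move=> [[? ?] ?] [].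
- move=> q _; have [->|/set0P[y]] := eqVneq (xsection E1 q) set0.
    by rewrite measure0 lee_fin exprn_ge0// mulr_ge0// ltW.
  by rewrite !xsection_set => Iy; exact: (fiberR_le Iy).
Qed.

Lemma incidences_leF : (mu3 I <= ((2 * T) ^+ dL)%:E * (leb dR \x leb l) F)%E.
Proof.
rewrite -[I]setIT -[setT](_ : [set e : X * Y * Z | [set: Y * Z] (e.1.2, e.2 + Q e.1.1 e.1.2)] = _);
  last exact/seteqP.
rewrite mu3_I2//; apply: measure_sparse_fibers => //.
- by rewrite exprn_ge0// mulr_ge0// ltW.
- by move=> [[? ?] ?] [] /=; rewrite subrK.
- move=> q _; have [->|/set0P[x]] := eqVneq (xsection E2 q) set0.
    by rewrite measure0 lee_fin exprn_ge0// mulr_ge0// ltW.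
  rewrite !xsection_set => Ix; have := fiberL_le Ix.
  by rewrite /FL/fiberL/= subrK; exact.
Qed.

(** Thin fibres over G carry at most |G| alpha / 4 = sigma / 4, and likewise over F. *)
Lemma popular_half (sg f0 g0 : R) : 0 < sg -> 0 < f0 -> 0 < g0 ->
  mu3 I = sg%:E -> (leb dR \x leb l)%E F = f0%:E -> (leb dL \x leb l)%E G = g0%:E ->
  exists2 J : set (X * Y * Z), measurable J /\ J `<=` I & ((sg / 2)%:E <= mu3 J)%E /\
   forall e, J e -> ((sg / f0 / 4)%:E <= leb dL (FL e))%E /\ ((sg / g0 / 4)%:E <= leb dR (FR e))%E.
Proof.
move=> sg0 f00 g00 hI hF hG.
pose D1 : set (X * Z) := [set q | leb dR (xsection E1 q) < (sg / g0 / 4)%:E]%E.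
pose D2 : set (Y * Z) := [set q | leb dL (xsection E2 q) < (sg / f0 / 4)%:E]%E.
have mD1 : measurable D1.
  rewrite -[D1]setTI; apply: emeasurable_fun_infty_o => //.
  exact: measurable_fun_xsection.
have mD2 : measurable D2.
  rewrite -[D2]setTI; apply: emeasurable_fun_infty_o => //.
  exact: measurable_fun_xsection.
pose B1 : set (X * Y * Z) := [set e | D1 (e.1.1, e.2)].
pose B2 : set (X * Y * Z) := [set e | D2 (e.1.2, e.2 + Q e.1.1 e.1.2)].
have mB1 : measurable B1.
  apply: (measurable_preimage (f := fun e : X * Y * Z => (e.1.1, e.2))) mD1.
  by apply: measurable_fun_pair; [exact: measurable_fst_fst|exact: measurable_snd].
have mB2 : measurable B2.
  apply: (measurable_preimage (f := fun e : X * Y * Z => (e.1.2, e.2 + Q e.1.1 e.1.2))) mD2.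
  apply: measurable_fun_pair; first exact: measurable_snd_fst.
  apply: measurable_rVD; first exact: measurable_snd.
  by apply: measurable_bilinear; [exact: measurable_fst_fst|exact: measurable_snd_fst].
pose J := I `\` (B1 `|` B2).
have mJ : measurable J by apply: measurableD => //; exact: measurableU.
exists J; first by split => // e [].
split; last first.
  move=> e [Ie nB]; split; rewrite leNgt; apply/negP => h; apply: nB.
    by right; rewrite /B2/D2/= xsection_set.
  by left; rewrite /B1/D1/= xsection_set.
have h1 : (mu3 (I `&` B1) <= (sg / 4)%:E)%E.
  rewrite mu3_I1//.
  apply: le_trans (measure_sparse_fibers (c := sg / g0 / 4) _ _ mG mD1 _ _ _) _ => //.
  - by rewrite !divr_ge0// ltW.
  - by move=> [[? ?] ?] [].
  - by move=> q /ltW.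
  - rewrite [X in (_ * X)%E](hG : product_sf (leb dL) (leb l) G = _) -EFinM lee_fin le_eqVlt; apply/orP; left; apply/eqP; field.
    by rewrite gt_eqF.
have h2 : (mu3 (I `&` B2) <= (sg / 4)%:E)%E.
  rewrite mu3_I2//.
  apply: le_trans (measure_sparse_fibers (c := sg / f0 / 4) _ _ mF mD2 _ _ _) _ => //.
  - by rewrite !divr_ge0// ltW.
  - by move=> [[? ?] ?] []; rewrite /= subrK.
  - by move=> q /ltW.
  - rewrite [X in (_ * X)%E](hF : product_sf (leb dR) (leb l) F = _) -EFinM lee_fin le_eqVlt; apply/orP; left; apply/eqP; field.
    by rewrite gt_eqF.
have : (sg%:E <= mu3 J + ((sg / 4)%:E + (sg / 4)%:E))%E.
  rewrite -hI.
  apply: (@le_trans _ _ (mu3 (J `|` ((I `&` B1) `|` (I `&` B2))))).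
    apply: le_measure; first exact/mem_set.
      by apply/mem_set; apply: measurableU => //; apply: measurableU; exact: measurableI.
    move=> e Ie; have [b1|b1] := pselect (B1 e); first by right; left.
    have [b2|b2] := pselect (B2 e); first by right; right.
    by left; split => // -[].
  apply: le_trans (measureU2 _ _ _) _ => //.
    by apply: measurableU; exact: measurableI.
  apply: leeD => //; apply: le_trans (measureU2 _ _ _) _ => //; try exact: measurableI.
  exact: leeD.
rewrite -EFinD -leeBlDr// -EFinB => h; apply: le_trans h; rewrite lee_fin; lra.
Qed.

(** The fibres of a popular point, translated to the origin, are fed into
    [good_pairs]; their differences are differences of points of Omega. *)
Lemma path_set_ge (s ip ir C lam sg f0 g0 : R) (M : nat) :
  borel_sublevel Q U V s ip ir C -> 0 < lam ->
  0 < sg -> 0 < f0 -> 0 < g0 ->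
  mu3 I = sg%:E -> (leb dR \x leb l)%E F = f0%:E -> (leb dL \x leb l)%E G = g0%:E ->
  (forall al ar : R, sg / f0 / 4 <= al -> sg / g0 / 4 <= ar ->
     C * lam `^ s * al `^ ip * ar `^ ir <= al * ar / 4) ->
  (2 * (T / 2 ^+ M)) ^+ (dL + dR) <= sg / f0 / 4 * (sg / g0 / 4) / 4 ->
  ((sg / f0 / 4 * (sg / g0 / 4) / 2 * (sg / 2))%:E <=
    (mu3 \x mu2) (path_set Q Om F G T M lam))%E.
Proof.
move=> sub lam0 sg0 f00 g00 hI hF hG hlam hrho.
have [J [mJ JI] [hJ Jpop]] := popular_half sg0 f00 g00 hI hF hG.
set c := sg / f0 / 4 * (sg / g0 / 4) / 2.
have be0 : 0 < sg / f0 / 4 by rewrite !divr_gt0.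
have al0 : 0 < sg / g0 / 4 by rewrite !divr_gt0.
have c0 : 0 <= c by rewrite divr_ge0// mulr_ge0// ltW.
have mP : measurable (path_set Q Om F G T M lam) by exact: measurable_path_set.
apply: (@le_trans _ _ (\int[mu3]_e (c%:E * (\1_J e)%:E))%E).
  rewrite ge0_integralZl//; last by apply/measurable_EFinP; exact: measurable_indic.
  by rewrite integral_indic// setIT EFinM lee_wpmul2l// lee_fin.
apply: ge0_le_integral => //.
- by move=> e _; rewrite -EFinM lee_fin mulr_ge0.
- by apply: measurable_funeM; apply/measurable_EFinP; exact: measurable_indic.
- exact: (measurable_fun_xsection mu2).
move=> e _ /=; have [Je|nJe] := pselect (J e); last first.
  by rewrite indicE memNset// mule0.
rewrite indicE mem_set// mule1; have Ie := JI _ Je; have Oe : Om e by case: Ie.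
have [hal har] := Jpop _ Je.
pose El : set X := [set u | FL e (e.1.1 + 1 *: u)].
pose Er : set Y := [set v | FR e (e.1.2 + 1 *: v)].
have mFL : measurable (FL e).
  by have := measurable_xsection (e.1.2, e.2 + Q e.1.1 e.1.2) mE2; rewrite xsection_set; exact.
have mFR : measurable (FR e).
  by have := measurable_xsection (e.1.1, e.2) mE1; rewrite xsection_set; exact.
have mEl : measurable El by apply: (measurable_preimage (measurable_affine _ _)).
have mEr : measurable Er by apply: (measurable_preimage (measurable_affine _ _)).
have lEl : leb dL El = (fine (leb dL (FL e)))%:E.
  rewrite leb_affine ?mulr1// fineK// ge0_fin_numE//.
  exact: le_lt_trans (fiberL_le Ie) (ltry _).
have lEr : leb dR Er = (fine (leb dR (FR e)))%:E.
  rewrite leb_affine ?mulr1// fineK// ge0_fin_numE//.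
  exact: le_lt_trans (fiberR_le Ie) (ltry _).
have alE : sg / f0 / 4 <= fine (leb dL (FL e)).
  by rewrite -lee_fin fineK// -(@leb_affine R dL 1 e.1.1) ?mulr1// lEl.
have arE : sg / g0 / 4 <= fine (leb dR (FR e)).
  by rewrite -lee_fin fineK// -(@leb_affine R dR 1 e.1.2) ?mulr1// lEr.
have hEl u : El u -> U u /\ sqnorm u <= T ^+ 2 / 2.
  move=> [Ou _ _]; have [/= + _] := OmT Oe Ou; have [/= + _] := OmU Oe Ou.
  by rewrite scale1r addrAC subrr add0r.
have hEr v : Er v -> V v /\ sqnorm v <= T ^+ 2 / 2.
  move=> [Ou _ _]; have [/= _ +] := OmT Oe Ou; have [/= _ +] := OmU Oe Ou.
  by rewrite scale1r addrAC subrr add0r.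
have := @good_pairs R dL dR l Q U V s ip ir C T lam _ _ M El Er sub T0 lam0 mEl mEr
  (fun u h => (hEl u h).1) (fun v h => (hEr v h).1) lEl lEr.
have h1 u v : El u -> Er v -> psq (u, v) <= T ^+ 2.
  move=> /hEl[_ hu] /hEr[_ hv]; rewrite /psq/=.
  by apply: le_trans (lerD hu hv) _; rewrite -splitr.
have prod_ge : sg / f0 / 4 * (sg / g0 / 4) <= fine (leb dL (FL e)) * fine (leb dR (FR e)).
  by rewrite ler_pM// ltW.
move=> /(_ h1 (hlam _ _ alE arE)).
have h2 : (2 * (T / 2 ^+ M)) ^+ (dL + dR) <= fine (leb dL (FL e)) * fine (leb dR (FR e)) / 4.
  by apply: le_trans hrho _; rewrite ler_pM2r.
move=> /(_ h2) good.
apply: (@le_trans _ _ (fine (leb dL (FL e)) * fine (leb dR (FR e)) / 2)%:E).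
  by rewrite lee_fin /c ler_pM2r.
apply: le_trans good _; rewrite -[leRHS](@product_leb_affine R dL dR 1 1 e.1.1 e.1.2) ?mulr1//; last first.
  exact: measurable_xsection.
apply: le_measure.
- apply/mem_set; apply: measurableI; first exact: measurable_core_set.
  exact: measurableX.
- apply/mem_set.
  apply: (measurable_preimage (f := fun p : X * Y => (e.1.1 + 1 *: p.1, e.1.2 + 1 *: p.2))).
    by apply: measurable_fun_pair;
      [apply: (measurableT_comp (measurable_affine _ _)); exact: measurable_fst
      |apply: (measurableT_comp (measurable_affine _ _)); exact: measurable_snd].
  exact: measurable_xsection.
move=> [u v] [hc [/= hu hv]]; rewrite xsection_set; split => //=.
by rewrite !scale1r ![_ + u]addrC ![_ + v]addrC !addrK.
Qed.

End refinement.

(** * The restricted estimate *)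

Section parameters.
Context {R : realType}.

Lemma powR_expR (x y : R) : expR x `^ y = expR (y * x).
Proof. by rewrite /powR gt_eqF ?expR_gt0// expRK. Qed.

(** M is taken minimal, so 2^M < 2z, and M (2^eps - 1) <= 2^(M eps) by Bernoulli. *)
Lemma dyadic_log_bound (eps : R) : 0 < eps -> exists2 c : R, 0 < c &
  forall z : R, 1 <= z -> exists2 M : nat, z <= 2 ^+ M & M%:R <= c * z `^ eps.
Proof.
move=> eps0; pose e : R := 2 `^ eps.
have e1 : 1 < e.
  by rewrite /e /powR ifF ?pnatr_eq0// expR_gt1 mulr_gt0// ln_gt0// ltr1n.
pose d := e - 1.
have d0 : 0 < d by rewrite subr_gt0.
have bern M : M%:R * d <= e ^+ M.
  have -> : e = 1 + d by rewrite /d addrC subrK.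
  suff : 1 + M%:R * d <= (1 + d) ^+ M by apply: le_trans; rewrite lerDr.
  elim: M => [|M IHM]; first by rewrite mul0r addr0 expr0.
  rewrite exprSr; apply: (@le_trans _ _ ((1 + M%:R * d) * (1 + d))).
    rewrite -natr1; have : 0 <= M%:R * d * d by rewrite !mulr_ge0// ltW.
    nra.
  by rewrite ler_wpM2r// addr_ge0// ltW.
exists (e / d); first by rewrite divr_gt0// (lt_trans ltr01).
move=> z z1.
have ex : exists M : nat, z <= 2 ^+ M.
  exists (Num.bound z).
  apply: (@le_trans _ _ (Num.bound z)%:R); first by rewrite ltW// archi_boundP// (le_trans ler01).
  by rewrite -natrX ler_nat ltnW// ltn_expl.
case: (ex_minnP ex) => -[|M] zM minM.
  by exists 0%N => //; rewrite mulr_ge0 ?powR_ge0// divr_ge0 ?ltW// (lt_trans ltr01).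
exists M.+1 => //.
have Mz : 2 ^+ M <= z.
  by rewrite leNgt; apply/negP => /ltW /minM; rewrite ltnn.
rewrite mulrAC ler_pdivlMr//; apply: le_trans (bern _) _.
rewrite exprS ler_pM2l ?(lt_trans ltr01)//.
rewrite /e -powR_mulrn ?powR_ge0// -powRrM mulrC powRrM powR_mulrn//.
by rewrite ge0_ler_powR ?nnegrE ?exprn_ge0 ?(ltW eps0)// (le_trans ler01).
Qed.

(** With be = sigma/|F| and al = sigma/|G|, lambda is c be^a al^b, so that
    lambda^s = c^s be^(1 - ip) al^(1 - ir), and M is such that 2^-M is of the order
    of be al, so that M is at most a constant times (be al)^-eps. *)
Lemma parameter_choice (s ip ir C T D eps cc : R) (N : nat) :
  0 < s -> 0 <= ip <= 1 -> 0 <= ir <= 1 -> 0 < C -> 0 < T -> 0 < D -> 0 < eps -> 0 <= cc ->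
  (0 < N)%N ->
  let a := (1 - ip) / s in let b := (1 - ir) / s in
  exists2 K : R, 0 < K & forall sg f0 g0 : R, 0 < sg -> 0 < f0 -> 0 < g0 ->
    sg <= D * f0 -> sg <= D * g0 ->
    exists (lam : R) (M : nat), [/\ 0 < lam,
      (forall x y : R, sg / f0 / 4 <= x -> sg / g0 / 4 <= y ->
         C * lam `^ s * x `^ ip * y `^ ir <= x * y / 4),
      (2 * (T / 2 ^+ M)) ^+ N <= sg / f0 / 4 * (sg / g0 / 4) / 4 &
      sg / f0 / 4 * (sg / g0 / 4) / 2 * (sg / 2) <= cc * M%:R / lam * (f0 * g0) ->
      sg `^ (3 + a + b + eps *+ 2) <= K * (f0 `^ (2 + a + eps) * g0 `^ (2 + b + eps))].
Proof.
move=> s0 /andP[ip0 ip1] /andP[ir0 ir1] C0 T0 D0 eps0 cc0 N0 a b.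
have [c c0 hc] := dyadic_log_bound eps0.
pose c1 := (1 / (64 * C)) `^ (s^-1).
have c10 : 0 < c1 by rewrite powR_gt0// divr_gt0// mulr_gt0.
(* large enough for the shells below T / 2^M to be negligible, and for z >= 1 *)
pose D' := 64 * (2 * T) ^+ N + D ^+ 2.
have T2 : 0 < (2 * T) ^+ N by rewrite exprn_gt0// mulr_gt0.
have D2 : 0 < D ^+ 2 by rewrite exprn_gt0.
have D'0 : 0 < D' by rewrite addr_gt0// mulr_gt0.
pose K := 64 * (cc + 1) * c * D' `^ eps / c1.
have cc1 : 0 < cc + 1 by rewrite ltr_wpDl.
have K0 : 0 < K by rewrite divr_gt0// !mulr_gt0// powR_gt0.
exists K => // sg f0 g0 sg0 f00 g00 sgf sgg.
pose be := sg / f0; pose al := sg / g0.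
have be0 : 0 < be by rewrite divr_gt0.
have al0 : 0 < al by rewrite divr_gt0.
have beD : be <= D by rewrite ler_pdivrMr.
have alD : al <= D by rewrite ler_pdivrMr.
pose z := D' / (be * al).
have beal0 : 0 < be * al by rewrite mulr_gt0.
have z1 : 1 <= z.
  rewrite ler_pdivlMr// mul1r; apply: (@le_trans _ _ (D ^+ 2)).
    by rewrite expr2 ler_pM// ltW.
  by rewrite lerDr ltW// mulr_gt0.
have [M zM Mz] := hc z z1.
pose lam := c1 * (be `^ a * al `^ b).
have lam0 : 0 < lam by rewrite !mulr_gt0// powR_gt0.
exists lam, M; split => //.
- move=> x y; rewrite -/be -/al => bex aly.
  have x0 : 0 < x by apply: lt_le_trans bex; rewrite divr_gt0.
  have y0 : 0 < y by apply: lt_le_trans aly; rewrite divr_gt0.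
  have lams : C * lam `^ s = be `^ (1 - ip) * al `^ (1 - ir) / 64.
    rewrite /lam [(c1 * _) `^ s]powRM ?mulr_ge0 ?powR_ge0 ?(ltW c10)//.
    rewrite [(be `^ a * _) `^ s]powRM ?powR_ge0//.
    rewrite /c1 -!powRrM mulVf ?gt_eqF// powRr1; last by rewrite divr_ge0// mulr_ge0// ltW.
    rewrite /a /b !divfK ?gt_eqF//; field; by rewrite gt_eqF.
  (* uses 1 - i >= 0: t^(1 - i) is at most (4 x')^(1 - i) *)
  have key (t x' i : R) : 0 < t -> 0 < x' -> 0 <= i -> i <= 1 -> t / 4 <= x' ->
      t `^ (1 - i) * x' `^ i <= 4 * x'.
    move=> t0 x'0 i0 i1 tx; have i1' : 0 <= 1 - i by rewrite subr_ge0.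
    apply: (@le_trans _ _ ((4 * x') `^ (1 - i) * x' `^ i)).
      rewrite ler_wpM2r ?powR_ge0// ge0_ler_powR ?nnegrE ?mulr_ge0 ?(ltW t0) ?(ltW x'0)//.
      by rewrite mulrC -ler_pdivrMr.
    rewrite powRM ?(ltW x'0)// -mulrA -powRD ?(gt_eqF x'0) ?implybT//.
    rewrite subrK powRr1 ?(ltW x'0)// ler_pM2r//.
    rewrite -[leRHS]powRr1// ler_powR// ?ler1n//; lra.
  have hx := key be x ip be0 x0 ip0 ip1 bex.
  have hy := key al y ir al0 y0 ir0 ir1 aly.
  rewrite lams.
  rewrite (_ : _ * _ = (be `^ (1 - ip) * x `^ ip) * (al `^ (1 - ir) * y `^ ir) / 64); last by ring.
  rewrite (_ : x * y / 4 = (4 * x) * (4 * y) / 64); last by field.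
  by rewrite ler_pM2r// ler_pM// mulr_ge0// powR_ge0.
- rewrite -/be -/al (_ : _ / 4 = be * al / 64); last by field.
  rewrite mulrA exprMn exprVn ler_pdivrMr ?exprn_gt0//.
  have zN : z <= (2 ^+ M) ^+ N.
    apply: le_trans zM _; case: N N0 {D' T2 D'0 K K0 z z1 Mz} => // N _.
    by rewrite exprS ler_peMr// exprn_ege1// exprn_ege1// ler1n.
  apply: (@le_trans _ _ (be * al / 64 * z)); last by rewrite ler_pM2l// divr_gt0.
  have -> : be * al / 64 * z = D' / 64.
    by rewrite /z mulrC mulrA divfK// gt_eqF.
  rewrite /D' ler_pdivlMr// mulrC; lra.
rewrite -/be -/al (_ : be / 4 * (al / 4) / 2 * (sg / 2) = be * al * sg / 64); last by field.
rewrite [X in _ <= X]mulrAC ler_pdivlMr// => h.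
have {}h : be * al * sg * lam <= 64 * (cc + 1) * c * z `^ eps * (f0 * g0).
  apply: (@le_trans _ _ (64 * (cc * M%:R * (f0 * g0)))).
    apply: le_trans (_ : 64 * (be * al * sg / 64 * lam) <= _); last by rewrite ler_pM2l.
    by rewrite le_eqVlt; apply/orP; left; apply/eqP; field.
  rewrite (_ : 64 * (cc + 1) * c * z `^ eps * _ = 64 * ((cc + 1) * (c * z `^ eps) * (f0 * g0)));
    last by ring.
  rewrite ler_pM2l// ler_pM2r ?mulr_gt0// ler_pM// lerDl//.
rewrite /z powRM ?(ltW D'0) ?invr_ge0 ?(ltW beal0)// in h.
set k0 := 64 * (cc + 1) * c * D' `^ eps.
have {}h : c1 * (be * al * sg * (be `^ a * al `^ b)) <= k0 * ((be * al)^-1 `^ eps * (f0 * g0)).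
  have -> : c1 * (be * al * sg * (be `^ a * al `^ b)) = be * al * sg * lam by rewrite /lam; ring.
  by apply: le_trans h _; rewrite le_eqVlt; apply/orP; left; apply/eqP; rewrite /k0; ring.
rewrite -[K]/(k0 / c1) [leRHS]mulrAC ler_pdivlMr// [leLHS]mulrC.
have [S eS] : exists S, sg = expR S by exists (ln sg); rewrite lnK.
have [f ef] : exists f, f0 = expR f by exists (ln f0); rewrite lnK.
have [g eg] : exists g, g0 = expR g by exists (ln g0); rewrite lnK.
have eb : be = expR (S - f) by rewrite /be eS ef -expRN -expRD.
have ea : al = expR (S - g) by rewrite /al eS eg -expRN -expRD.
rewrite eb ea eS ef eg -!expRD -!expRN !powR_expR -!expRD in h *.
(* in logarithms the conclusion is h multiplied by exp W *)
pose W := eps *+ 2 * S + (1 + a) * f + (1 + b) * g.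
move: h; rewrite -(ler_pM2r (expR_gt0 W)) -!mulrA -!expRD.
rewrite [X in c1 * expR X <= _](_ : _ = (3 + a + b + eps *+ 2) * S); last first.
  by rewrite /W /a /b; ring.
suff -> : eps * - (S - f + (S - g)) + (f + g) + W = (2 + a + eps) * f + (2 + b + eps) * g by [].
by rewrite /W; ring.
Qed.

End parameters.

Section geometric_mean.
Context {R : realType}.

Lemma geometric_mean (K sg f g p p1 p2 w1 w2 w3 : R) : 1 <= K ->
  0 < sg -> 0 < f -> 0 < g -> sg <= K * f -> sg <= K * g ->
  sg `^ p <= K * (f `^ p1 * g `^ p2) ->
  0 <= w1 -> 0 <= w2 -> 0 <= w3 -> 1 <= p -> w1 + w2 + w3 * p = 1 ->
  sg <= K * (f `^ (w1 + w3 * p1) * g `^ (w2 + w3 * p2)).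
Proof.
move=> K1 sg0 f0 g0 hf hg hp w10 w20 w30 p1' hw.
have K0 : 0 < K by exact: lt_le_trans K1.
have -> : sg = sg `^ w1 * sg `^ w2 * (sg `^ p) `^ w3.
  by rewrite -powRrM -!powRD ?(gt_eqF sg0) ?implybT// [p * _]mulrC hw powRr1 ?ltW.
apply: (@le_trans _ _ ((K * f) `^ w1 * (K * g) `^ w2 * (K * (f `^ p1 * g `^ p2)) `^ w3)).
  have mono x y w : 0 < x -> 0 <= w -> x <= y -> x `^ w <= y `^ w.
    move=> x0 w0 xy; rewrite ge0_ler_powR ?nnegrE ?(ltW x0)//.
    exact: le_trans (ltW x0) xy.
  by rewrite ler_pM ?mulr_ge0 ?powR_ge0 ?mono ?powR_gt0// ler_pM ?powR_ge0 ?mono.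
have [k eK] : exists k, K = expR k by exists (ln K); rewrite lnK.
have [x ex] : exists x, f = expR x by exists (ln f); rewrite lnK.
have [y ey] : exists y, g = expR y by exists (ln g); rewrite lnK.
have k0 : 0 <= k by rewrite -ler_expR expR0 -eK.
rewrite eK ex ey -!expRD !powR_expR -!expRD !powR_expR -!expRD ler_expR.
have : 0 <= w3 * (p - 1) * k by rewrite !mulr_ge0// subr_ge0.
have -> : w1 = 1 - w2 - w3 * p by rewrite -hw; ring.
nra.
Qed.

End geometric_mean.

Section restricted.
Context {R : realType} {dL dR l : nat}.
Variable Q : {bilinear 'rV[R]_dL -> 'rV[R]_dR -> 'rV[R]_l}.
Hypothesis hl : (l <= dL + dR)%N.
Let X := 'rV[R]_dL. Let Y := 'rV[R]_dR. Let Z := 'rV[R]_l.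

Lemma leb0_nonempty n m (A : set ('rV[R]_n * 'rV[R]_m)) : n = 0%N -> m = 0%N ->
  A !=set0 -> (leb n \x leb m)%E A = 1%E.
Proof.
move=> n0 m0; subst n m => -[q Aq]; have -> : A = setT `*` setT.
  apply/seteqP; split => // q' _; rewrite (_ : q' = q)//.
  by case: q q' {Aq} => [? ?] [? ?]; congr pair; apply/rowP => -[].
rewrite product_measure1E//.
have leb0T : @leb R 0 [set: 'rV[R]_0] = 1%E by rewrite /leb /= diracT.
by rewrite leb0T mule1.
Qed.

Variables (Om : set (X * Y * Z)).
Hypothesis mOm : measurable Om.
Variables (U : set X) (V : set Y) (T : R).
Hypothesis T0 : 0 < T.
Hypothesis OmT : forall e e', Om e -> Om e' ->
  sqnorm (e'.1.1 - e.1.1) <= T ^+ 2 / 2 /\ sqnorm (e'.1.2 - e.1.2) <= T ^+ 2 / 2.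
Hypothesis OmU : forall e e', Om e -> Om e' -> U (e'.1.1 - e.1.1) /\ V (e'.1.2 - e.1.2).
Variables (s ip ir C : R).
Hypotheses (s0 : 0 < s) (ip01 : 0 <= ip <= 1) (ir01 : 0 <= ir <= 1) (C0 : 0 < C).
Hypothesis sub : borel_sublevel Q U V s ip ir C.
Let a := (1 - ip) / s. Let b := (1 - ir) / s.

(** If dL + dR = 0 then l = 0, all spaces are points, and sigma, |F| and |G| are 0 or
    1.  Otherwise the two bounds for the paths are compared. *)
Lemma path_estimate (eps : R) : 0 < eps -> exists2 K : R, 0 < K &
  forall (F : set (Y * Z)) (G : set (X * Z)) (sg f0 g0 : R), measurable F -> measurable G ->
    0 < sg -> 0 < f0 -> 0 < g0 ->
    sg <= (2 * T) ^+ dL * f0 -> sg <= (2 * T) ^+ dR * g0 ->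
    mu3 (incidences Q Om F G) = sg%:E ->
    (leb dR \x leb l)%E F = f0%:E -> (leb dL \x leb l)%E G = g0%:E ->
    sg `^ (3 + a + b + eps *+ 2) <= K * (f0 `^ (2 + a + eps) * g0 `^ (2 + b + eps)).
Proof.
move=> eps0.
have ab0 : 0 <= a /\ 0 <= b.
  by split; rewrite divr_ge0 ?(ltW s0)// subr_ge0; [case/andP: ip01|case/andP: ir01].
have [N0|] := posnP (dL + dR)%N.
  exists 1 => // F G sg f0 g0 mF mG sg0 f00 g00 sgf sgg hI hF hG.
  have /andP[/eqP e1 /eqP e2] : (dL == 0%N) && (dR == 0%N) by rewrite -addn_eq0 N0.
  have e3 : l = 0%N by apply/eqP; rewrite -leqn0 -N0.
  have [h1 h2] : f0 = 1 /\ g0 = 1.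
    split; apply/EFin_inj; [rewrite -hF|rewrite -hG]; apply: leb0_nonempty => //.
      by apply/set0P/eqP => F0; move: hF f00; rewrite F0 measure0 => -[<-]; rewrite ltxx.
    by apply/set0P/eqP => G0; move: hG g00; rewrite G0 measure0 => -[<-]; rewrite ltxx.
  have sg1 : sg <= 1 by rewrite h1 mulr1 {1}e1 expr0 in sgf.
  have one_pow x : 1 `^ x = 1 :> R by rewrite powR1.
  rewrite h1 h2 !one_pow !mulr1 -[leRHS](one_pow (3 + a + b + eps *+ 2)).
  rewrite ge0_ler_powR ?nnegrE ?(ltW sg0)//; case: ab0 => *.
  by apply: addr_ge0; [rewrite !addr_ge0|rewrite mulrn_wge0// ltW].
move=> N0; pose D : R := (2 * T) ^+ dL + (2 * T) ^+ dR.
have D1 : 0 < (2 * T) ^+ dL by rewrite exprn_gt0// mulr_gt0.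
have D2 : 0 < (2 * T) ^+ dR by rewrite exprn_gt0// mulr_gt0.
have D0 : 0 < D by rewrite addr_gt0.
have [K K0 hK] := parameter_choice s0 ip01 ir01 C0 T0 D0 eps0 (@core_constant_ge0 R dL dR l) N0.
exists K => // F G sg f0 g0 mF mG sg0 f00 g00 sgf sgg hI hF hG.
have sgf' : sg <= D * f0 by apply: le_trans sgf _; rewrite ler_pM2r// lerDl ltW.
have sgg' : sg <= D * g0 by apply: le_trans sgg _; rewrite ler_pM2r// lerDr ltW.
have [lam [M [lam0 hlam hrho]]] := hK sg f0 g0 sg0 f00 g00 sgf' sgg'; apply.
have := path_set_ge mOm mF mG T0 OmT OmU sub lam0 sg0 f00 g00 hI hF hG hlam hrho.
move=> /le_trans /(_ (path_set_le Q hl mOm mF mG M T0 lam0)).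
by rewrite hF hG -!EFinM lee_fin.
Qed.

(** The weights of the three estimates are affine functions of (th1, th2); at an
    interior point they are positive, so they remain nonnegative for a small eps and
    after a small change of the exponents.  The weights add up to at most 1, so the
    constant does not depend on that change. *)
Lemma restricted_estimate (th1 th2 : R) :
  1 < th1 + th2 -> (th1 + th2 - 1) * (2 + a) < th1 -> (th1 + th2 - 1) * (2 + b) < th2 ->
  exists K d : R, [/\ 0 < K, 0 < d &
  forall (F : set (Y * Z)) (G : set (X * Z)) (f0 g0 : R), measurable F -> measurable G ->
    (leb dR \x leb l)%E F = f0%:E -> (leb dL \x leb l)%E G = g0%:E ->
    forall e1 e2 : R, `|e1| <= d -> `|e2| <= d ->
    (mu3 (incidences Q Om F G) <= (K * f0 `^ (th1 + e1) * g0 `^ (th2 + e2))%:E)%E].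
Proof.
move=> h1 h2 h3.
have [a0 b0] : 0 <= a /\ 0 <= b.
  by split; rewrite divr_ge0 ?(ltW s0)// subr_ge0; [case/andP: ip01|case/andP: ir01].
(* the smallest barycentric coordinate *)
pose m := Num.min (th1 + th2 - 1) (Num.min (th1 - (th1 + th2 - 1) * (2 + a))
   (th2 - (th1 + th2 - 1) * (2 + b))).
have m0 : 0 < m by rewrite !lt_min !subr_gt0 h1 h2 h3.
have [m1 m2 m3] : [/\ m <= th1 + th2 - 1, m <= th1 - (th1 + th2 - 1) * (2 + a) &
   m <= th2 - (th1 + th2 - 1) * (2 + b)].
  by rewrite /m; split; rewrite !ge_min lexx ?orbT.
clearbody m.
pose w := th1 + th2 - 1.
have w0 : 0 < w by rewrite subr_gt0.
pose eps := m / (2 * (w + 1)).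
have w1 : 0 < w + 1 by rewrite addr_gt0.
have eps0 : 0 < eps by rewrite divr_gt0// mulr_gt0.
have epsw : w * eps <= m / 2.
  by rewrite /eps mulrA ler_pdivrMr ?mulr_gt0//; nra.
pose B := 5 + 2 * a + 2 * b + 2 * eps.
have B5 : 5 <= B by rewrite /B; lra.
have B0 : 0 < B by apply: lt_le_trans B5.
pose d := m / (4 * B).
have d0 : 0 < d by rewrite divr_gt0// mulr_gt0.
have dB : d * B = m / 4 by rewrite /d; field; rewrite gt_eqF.
have [K K0 hK] := path_estimate eps0.
pose K' := 1 + K + (2 * T) ^+ dL + (2 * T) ^+ dR.
have D1 : 0 < (2 * T) ^+ dL by rewrite exprn_gt0// mulr_gt0.
have D2 : 0 < (2 * T) ^+ dR by rewrite exprn_gt0// mulr_gt0.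
exists K', d; split => //; first by rewrite !addr_gt0.
move=> F G f0 g0 mF mG hF hG e1 e2; rewrite !ler_norml => /andP[e1l e1r] /andP[e2l e2r].
have := incidences_leG Q mOm mF mG T0 OmT; rewrite hG -EFinM => hIG.
have := incidences_leF Q mOm mF mG T0 OmT; rewrite hF -EFinM => hIF.
move: hIG hIF; have : (0 <= mu3 (incidences Q Om F G))%E by [].
case E : (mu3 (incidences Q Om F G)) => [sg| |] //.
rewrite !lee_fin le_eqVlt => /predU1P[<- _ _|sg0 hIG hIF].
  by rewrite !mulr_ge0 ?powR_ge0// !addr_ge0// ltW.
have f00 : 0 < f0 by rewrite -(pmulr_rgt0 _ D1); exact: lt_le_trans hIF.
have g00 : 0 < g0 by rewrite -(pmulr_rgt0 _ D2); exact: lt_le_trans hIG.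
have hp := hK F G sg f0 g0 mF mG sg0 f00 g00 hIF hIG E hF hG.
(* weights of the path estimate and of the two trivial bounds *)
pose w3 := w + e1 + e2.
have dm : d * 5 <= m / 4 by rewrite -dB ler_pM2l.
have w3E : 0 <= w3 by rewrite /w3; rewrite -/w in m1; lra.
have ad : 0 <= a * d by rewrite mulr_ge0// ltW.
have bd : 0 <= b * d by rewrite mulr_ge0// ltW.
rewrite /B in dB; have e12 : e1 + e2 <= 2 * d by lra.
have ae0 : 0 <= 2 + a + eps by rewrite !addr_ge0// ltW.
have be0 : 0 <= 2 + b + eps by rewrite !addr_ge0// ltW.
have ea := ler_wpM2r ae0 e12; have eb := ler_wpM2r be0 e12.
rewrite -/w in m2 m3.
pose u1 := th1 + e1 - w3 * (2 + a + eps).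
pose u2 := th2 + e2 - w3 * (2 + b + eps).
have u1E : 0 <= u1 by rewrite /u1 /w3; lra.
have u2E : 0 <= u2 by rewrite /u2 /w3; lra.
have eu1 : u1 + w3 * (2 + a + eps) = th1 + e1 by rewrite /u1 subrK.
have eu2 : u2 + w3 * (2 + b + eps) = th2 + e2 by rewrite /u2 subrK.
rewrite -mulrA -eu1 -eu2; apply: (@geometric_mean R K' sg f0 g0 (3 + a + b + eps *+ 2)) => //.
- by rewrite /K' -!addrA lerDl !addr_ge0// ltW.
- by apply: le_trans hIF _; rewrite ler_pM2r// /K'; lra.
- by apply: le_trans hIG _; rewrite ler_pM2r// /K'; lra.
- by apply: le_trans hp _; rewrite ler_pM2r ?mulr_gt0 ?powR_gt0// /K'; lra.
- by lra.
- by rewrite /u1 /u2 /w3 /w; ring.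
Qed.

End restricted.

(** * Lebesgue measurable and Borel sets *)

Section completion.
Local Open Scope ereal_scope.
Context {d : measure_display} {T : measurableType d} {R : realType}.
Variable mu : {measure set T -> \bar R}.

Lemma borel_completed_measurable (A : set T) : measurable A -> completed_measurable mu A.
Proof. by move=> mA; apply: sub_caratheodory; exact: sub_sigma_algebra. Qed.

Lemma completed_borelE (A : set T) : measurable A -> completed mu A = mu A.
Proof. exact: measurable_mu_extE. Qed.

(** Intersect countable Borel covers of almost optimal measure. *)
Lemma borel_hull (A : set T) : exists B : set T,
  [/\ measurable B, A `<=` B & mu B = completed mu A].
Proof.
have le_c : forall B C : set T, B `<=` C -> completed mu B <= completed mu C.
  by move=> B C BC; exact: le_mu_ext.
have [Aoo|] := eqVneq (completed mu A) +oo.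
  exists setT; split => //; rewrite Aoo -completed_borelE//; apply/eqP.
  by rewrite -leye_eq -Aoo; exact: le_c.
move=> Aoo; have Afin : completed mu A \is a fin_num by rewrite ge0_fin_numE// ltey.
have inv0 n : (0 < n.+1%:R^-1 :> R)%R by rewrite invr_gt0.
have /choice[F hF] : forall n : nat, exists B : set T, [/\ measurable B, A `<=` B &
    mu B <= completed mu A + (n.+1%:R^-1)%:E].
  move=> n; have [_ [G [mG AG] <-] hG] := lb_ereal_inf_adherent (inv0 n) Afin.
  exists (\bigcup_k G k); split => //; first exact: bigcupT_measurable.
  apply: le_trans (ltW hG); apply: measure_sigma_subadditive => //.
  exact: bigcupT_measurable.
exists (\bigcap_n F n); split.
- by apply: bigcapT_measurable => n; case: (hF n).
- by move=> x Ax n _; case: (hF n) => _ + _; exact.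
have mF : measurable (\bigcap_n F n) by apply: bigcapT_measurable => n; case: (hF n).
apply/eqP; rewrite eq_le -{2}completed_borelE//; apply/andP; split; last first.
  by apply: le_c => x Ax n _; case: (hF n) => _ + _; exact.
apply/lee_addgt0Pr => /= _/posnumP[e].
near \oo => n; have [mFn _ hn] := hF n.
apply: (@le_trans _ _ (mu (F n))).
  by apply: le_measure; [exact/mem_set|exact/mem_set|exact: bigcap_inf].
apply: le_trans hn _; rewrite leeD// lee_fin ltW//.
by near: n; exact: near_infty_natSinv_lt.
Unshelve. all: by end_near. Qed.

Lemma completed_null (A N : set T) : measurable N -> mu N = 0 -> A `<=` N ->
  completed_measurable mu A.
Proof.
move=> mN N0 AN; apply: (@measure_is_complete_caratheodory R T (mu^*)%mu).
exists N; split => //; first exact: borel_completed_measurable.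
by have := completed_borelE mN; rewrite N0.
Qed.

End completion.

Section completion_sigma_finite.
Local Open Scope ereal_scope.
Context {d : measure_display} {T : measurableType d} {R : realType}.
Variable mu : {sigma_finite_measure set T -> \bar R}.

(** On pieces of finite measure, a hull B of A exceeds A by a null set. *)
Lemma completed_borel_sandwich (A : set T) : completed_measurable mu A ->
  exists B N : set T, [/\ measurable B, measurable N, mu N = 0, A `<=` B & B `\` A `<=` N].
Proof.
move=> mA; have /sigma_finiteP[F [TF ndF Foo]] := sigma_finiteT mu.
have /choice[BN hBN] : forall n : nat, exists BN : set T * set T,
    [/\ measurable BN.1, measurable BN.2, mu BN.2 = 0, A `&` F n `<=` BN.1 &
    BN.1 `\` (A `&` F n) `<=` BN.2].
  move=> n; have [mF Fn] := Foo n.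
  have mAF : completed_measurable mu (A `&` F n).
    by apply: measurableI => //; exact: borel_completed_measurable.
  have cF : completed mu (A `&` F n) < +oo.
    apply: le_lt_trans (le_mu_ext mu (@subIsetr _ A (F n))) _.
    by rewrite [ltLHS](completed_borelE mu mF).
  have [B [mB AB muB]] := borel_hull mu (A `&` F n).
  have [N [mN AN muN]] := borel_hull mu (B `\` (A `&` F n)).
  exists (B, N); split => //=; rewrite muN measureD//=; last 2 first.
  - exact: borel_completed_measurable.
  - by rewrite completed_borelE// muB.
  rewrite setIidr//.
  have -> : completed mu B = completed mu (A `&` F n) by rewrite completed_borelE.
  by rewrite subee// ge0_fin_numE.
exists (\bigcup_n (BN n).1), (\bigcup_n (BN n).2); split.
- by apply: bigcupT_measurable => n; case: (hBN n).
- by apply: bigcupT_measurable => n; case: (hBN n).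
- apply/eqP; rewrite eq_le measure_ge0 andbT.
  apply: (@le_trans _ _ (\sum_(n <oo) mu (BN n).2)).
    apply: measure_sigma_subadditive => //; first by move=> n; case: (hBN n).
    by apply: bigcupT_measurable => n; case: (hBN n).
  by rewrite eseries0// => n _ _; case: (hBN n).
- move=> x Ax; have [n _ Fx] : (\bigcup_n F n) x by rewrite -TF.
  by exists n => //; case: (hBN n) => _ _ _ + _; exact.
- move=> x [[n _ Bx] nAx]; exists n => //; case: (hBN n) => _ _ _ _; apply.
  by split => // -[].
Qed.

Lemma completed_preimage d' (T' : measurableType d')
    (mu' : {measure set T' -> \bar R}) (h : T' -> T) :
  measurable_fun setT h ->
  (forall N, measurable N -> mu N = 0 -> mu' (h @^-1` N) = 0) ->
  forall A, completed_measurable mu A -> completed_measurable mu' (h @^-1` A).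
Proof.
move=> mh h0 A /completed_borel_sandwich[B [N [mB mN N0 AB BAN]]].
have -> : h @^-1` A = (h @^-1` B) `\` (h @^-1` (B `\` A)).
  apply/seteqP; split => x /=; first by move=> Ax; split; [exact: AB|case].
  by move=> [Bx nBA]; apply: contrapT => nA; exact: nBA.
apply: measurableD.
  by apply: borel_completed_measurable; exact: measurable_preimage.
apply: (@completed_null _ _ _ mu' _ (h @^-1` N)).
- exact: measurable_preimage.
- exact: h0.
- by move=> x /BAN.
Qed.

End completion_sigma_finite.

(** * The hypothesis and the exponents *)

Section sublevel_borel.
Context {R : realType} {dL dR l : nat}.
Variable Q : {bilinear 'rV[R]_dL -> 'rV[R]_dR -> 'rV[R]_l}.

Lemma sublevel_estimate_borel U V s pl pr C0 :
  sublevel_estimate Q U V s pl pr C0 ->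
  borel_sublevel Q U V s (fine pl^-1)%E (fine pr^-1)%E (`|C0| + 1).
Proof.
move=> sub El Er a al ar mEl mEr ElU ErV a0 hal har.
have := sub El Er a (borel_completed_measurable _ mEl) (borel_completed_measurable _ mEr) ElU ErV a0.
have -> : W Q a \1_El \1_Er = mu2 ([set p | Phi Q p.1 p.2 <= a] `&` El `*` Er).
  rewrite /W -[RHS](completed_borelE mu2); last first.
    by apply: measurableI; [exact: measurable_Phi_le|exact: measurableX].
  rewrite setIC -integral_indic.
  - by apply: eq_integral => -[x y] _; rewrite !indicE -natrM mulnb in_setX.
  - by apply: borel_completed_measurable; exact: measurable_Phi_le.
  - by apply: borel_completed_measurable; exact: measurableX.
move=> /le_trans; apply.
have -> : completed (leb dL) El = al%:E by rewrite -hal; exact: completed_borelE.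
have -> : completed (leb dR) Er = ar%:E by rewrite -har; exact: completed_borelE.
rewrite !poweR_EFin -!EFinM lee_fin.
by rewrite !ler_wpM2r ?powR_ge0// (le_trans (ler_norm _))// lerDl.
Qed.

End sublevel_borel.

Section exponents.
Context {R : realType}.

(** 1/(s p') = (1 - 1/p)/s, including the endpoints p = 1 and p = +oo. *)
Lemma conjugate_exponent (s : R) (p : \bar R) : 0 < s -> (1 <= p)%E ->
  fine (s%:E * hoelder_conjugate p)^-1%E = (1 - fine p^-1%E) / s /\ 0 <= fine p^-1%E <= 1.
Proof.
move=> s0; case: p => [p| |] //.
  rewrite lee_fin => p1; have p0 : 0 < p by exact: lt_le_trans p1.
  rewrite inver gt_eqF//=; split; last first.
    by rewrite invr_ge0 (ltW p0)/= invf_le1.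
  have [->|pn1] := eqVneq p 1.
    by rewrite hoelder_conjugate1 gt0_muley ?lte_fin// invey/= invr1 subrr mul0r.
  have p1' : 0 < p - 1 by rewrite subr_gt0 lt_neqAle eq_sym pn1.
  rewrite /hoelder_conjugate/= eqe gt_eqF// -EFinD inver gt_eqF// -!EFinM inver.
  rewrite gt_eqF ?mulr_gt0 ?invr_gt0//=; field; rewrite !gt_eqF//.
move=> _; rewrite hoelder_conjugatey mule1 invey/= inver gt_eqF//= subr0 div1r.
by split => //; rewrite lexx ler01.
Qed.

(** Barycentric coordinates: the weight of the third vertex is a multiple of
    t1 + t2 - 1, and the other two are t1 - (t1 + t2 - 1)(2 + a) and
    t2 - (t1 + t2 - 1)(2 + b).  In the interior they are positive, as moving the point
    in the directions (-1, -1), (-1, 1) and (1, -1) shows. *)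
Lemma interior_exponents (a b t1 t2 : R) : 0 <= a -> 0 <= b ->
  interior (triangle (1, 0) (0, 1) ((2 + a) / (3 + a + b), (2 + b) / (3 + a + b))) (t1, t2) ->
  [/\ 1 < t1 + t2, (t1 + t2 - 1) * (2 + a) < t1 & (t1 + t2 - 1) * (2 + b) < t2].
Proof.
move=> a0 b0; set Tr := triangle _ _ _.
have TrP u v : Tr (u, v) ->
    [/\ 1 <= u + v, (u + v - 1) * (2 + a) <= u & (u + v - 1) * (2 + b) <= v].
  move=> [x [y [z [x0 y0 z0 xyz [-> ->]]]]]; rewrite /= !mulr0 !mulr1 !addr0 !add0r.
  have n0 : 3 + a + b != 0 by rewrite gt_eqF// !ltr_wpDr.
  pose w := z / (3 + a + b).
  have w0 : 0 <= w by rewrite divr_ge0// !addr_ge0.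
  have zE : z = w * (3 + a + b) by rewrite /w divfK.
  have -> : z * ((2 + a) / (3 + a + b)) = w * (2 + a) by rewrite /w; field.
  have -> : z * ((2 + b) / (3 + a + b)) = w * (2 + b) by rewrite /w; field.
  have -> : x + w * (2 + a) + (y + w * (2 + b)) = 1 + w.
    have -> : x = 1 - y - w * (3 + a + b) by rewrite -zE; lra.
    by ring.
  rewrite addrAC subrr add0r; split; lra.
move=> /nbhs_ballP[e /= e0 he].
pose r := e / 2.
have r0 : 0 < r by rewrite divr_gt0.
have re : `|r| < e by rewrite gtr0_norm// /r ltr_pdivrMr// ltr_pMr// ltr1n.
have near u v : `|u| <= r -> `|v| <= r -> Tr (t1 - u, t2 - v).
  move=> ur vr; apply: he; split; rewrite /ball/= opprB addrC subrK; apply: le_lt_trans re;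
  by rewrite (gtr0_norm r0).
have rr : `|r| <= r by rewrite gtr0_norm.
have [h1 _ _] := TrP _ _ (near r r rr rr).
have [_ h2 _] := TrP _ _ (near r (- r) rr (eq_ind_r (fun x => x <= r) rr (normrN r))).
have [_ _ h3] := TrP _ _ (near (- r) r (eq_ind_r (fun x => x <= r) rr (normrN r)) rr).
rewrite opprK in h2 h3.
have e1 : t1 - r + (t2 + r) = t1 + t2 by ring.
have e2 : t1 + r + (t2 - r) = t1 + t2 by ring.
rewrite e1 in h2; rewrite e2 in h3; split; lra.
Qed.

End exponents.

(** * From level sets to functions *)

Section dyadic_levels.
Context {R : realType}.

(** All powers of 2, enumerated by natural numbers: 2^n is number 2n and 2^-(n+1) is
    number 2n + 1. *)
Definition level (k : nat) : R := if odd k then (2 ^+ k./2.+1)^-1 else 2 ^+ k./2.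

Lemma level_gt0 k : 0 < level k.
Proof. by rewrite /level; case: ifP => _; rewrite ?invr_gt0 exprn_gt0. Qed.

Lemma level_cover (t : R) : 0 < t -> exists k, level k < t /\ t <= 2 * level k.
Proof.
move=> t0; have [t1|t1] := ltP 1 t.
  have ex : exists n : nat, t <= 2 ^+ n.+1.
    exists (Num.bound t); apply: (@le_trans _ _ (Num.bound t)%:R).
      by rewrite ltW// archi_boundP// ltW.
    by rewrite -natrX ler_nat (leq_trans (ltnW (ltn_expl _ (ltnSn 1))))// leq_exp2l.
  case: (ex_minnP ex) => n tn nmin; exists n.*2.
  rewrite /level odd_double doubleK -exprS; split => //.
  case: n tn nmin => [|n] tn nmin; first by rewrite expr0.
  by rewrite ltNge; apply/negP => /nmin; rewrite ltnn.
have ex : exists n : nat, (2 ^+ n.+1)^-1 < t.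
  exists (Num.bound t^-1); rewrite invf_plt ?posrE ?exprn_gt0//.
  apply: (@lt_le_trans _ _ (Num.bound t^-1)%:R).
    by rewrite archi_boundP// invr_ge0 ltW.
  by rewrite -natrX ler_nat (leq_trans (ltnW (ltn_expl _ (ltnSn 1))))// leq_exp2l.
case: (ex_minnP ex) => n tn nmin; exists n.*2.+1.
rewrite /level /= odd_double /= uphalf_double; split => //.
rewrite exprS invfM mulrA divff// mul1r.
case: n tn nmin => [|n] tn nmin; first by rewrite expr0 invr1.
by rewrite leNgt; apply/negP => /nmin; rewrite ltnn.
Qed.

(** Since level k is 2^j or 2^-j with j >= k/2, an exponent of the right sign turns it
    into a quantity that decays geometrically in k. *)
Lemma level_exponent (c : R) k : 0 < c -> exists2 e : R, `|e| <= c &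
  level k `^ (- e) <= expR (- (c * ln 2 / 2)) ^+ k.
Proof.
move=> c0; have ln20 : 0 < ln 2 :> R by rewrite ln_gt0// ltr1n.
have lv n : 2 ^+ n = expR (n%:R * ln 2) :> R by rewrite expRM_natl lnK// posrE.
rewrite -expRM_natl -mulr_natl /level; case: ifPn => ok.
  exists (- c); first by rewrite normrN gtr0_norm.
  rewrite lv -expRN powR_expR ler_expR opprK.
  have hk : k%:R <= 2 * k./2.+1%:R :> R.
    rewrite -natrM ler_nat -[X in (X <= _)%N](odd_double_half k) ok -mul2n; lia.
  have : 0 <= c * ln 2 by rewrite mulr_ge0// ltW.
  by nra.
exists c; first by rewrite gtr0_norm.
rewrite lv powR_expR ler_expR.
have hk : k%:R = 2 * k./2%:R :> R.
  by rewrite -natrM -[X in X%:R = _](odd_double_half k) (negbTE ok) -mul2n.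
by rewrite hk le_eqVlt; apply/orP; left; apply/eqP; field.
Qed.

Lemma geometric_eseries_le (r : R) : 0 <= r < 1 ->
  (\sum_(0 <= n <oo) (r ^+ n)%:E <= ((1 - r)^-1)%:E)%E.
Proof.
move=> /andP[r0 r1]; apply: lime_le.
  by apply: is_cvg_nneseries => n _ _; rewrite lee_fin exprn_ge0.
apply: nearW => n; rewrite sumEFin lee_fin.
have -> : \sum_(0 <= i < n) r ^+ i = series (geometric 1 r) n.
  by apply: eq_bigr => i _; rewrite /geometric/= mul1r.
rewrite geometric_seriesE ?lt_eqF//= mul1r -[leRHS]mul1r ler_wpM2r//.
  by rewrite invr_ge0 subr_ge0 ltW.
by rewrite gerBl exprn_ge0.
Qed.

End dyadic_levels.

Section strong_type.
Local Open Scope ereal_scope.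
Context {d : measure_display} {T : measurableType d} {R : realType}.
Variable nu : {measure set T -> \bar R}.
Variables (D : set T) (F G : T -> R) (nf ng K r1 r2 : R).
Hypotheses (mD : measurable D) (mF : measurable_fun setT F) (mG : measurable_fun setT G).
Hypotheses (F0 : forall x, (0 <= F x)%R) (G0 : forall x, (0 <= G x)%R).
Hypotheses (nf0 : (0 < nf)%R) (ng0 : (0 < ng)%R) (K0 : (0 <= K)%R).
Hypotheses (r10 : (0 <= r1 < 1)%R) (r20 : (0 <= r2 < 1)%R).

Let A k := [set x | nf * level k < F x]%R.
Let B k := [set x | ng * level k < G x]%R.

Hypothesis hK : forall k m,
  nu (D `&` A k `&` B m) <= (K * (r1 ^+ k / level k) * (r2 ^+ m / level m))%:E.

(** Where F is positive it is at most twice the largest level below it, hence at most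
    the sum over all levels of twice the level on the set where F exceeds it. *)
Lemma strong_type_of_levels :
  \int[nu]_(x in D) (F x * G x)%:E <= (4 * K * nf * ng / (1 - r1) / (1 - r2))%:E.
Proof.
have mA k : measurable (A k).
  rewrite /A (_ : [set x | _] = F @^-1` `]nf * level k, +oo[)%R.
    by apply: measurable_preimage => //; exact: measurable_itv.
  by apply/seteqP; split => x /=; rewrite in_itv/= andbT.
have mB k : measurable (B k).
  rewrite /B (_ : [set x | _] = G @^-1` `]ng * level k, +oo[)%R.
    by apply: measurable_preimage => //; exact: measurable_itv.
  by apply/seteqP; split => x /=; rewrite in_itv/= andbT.
pose u k x := (2 * nf * level k * \1_(A k) x)%:E.
pose v k x := (2 * ng * level k * \1_(B k) x)%:E.
have u0 k x : 0 <= u k x by rewrite lee_fin !mulr_ge0// ltW// level_gt0.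
have v0 k x : 0 <= v k x by rewrite lee_fin !mulr_ge0// ltW// level_gt0.
have mu_ k : measurable_fun setT (u k).
  by apply/measurable_EFinP; apply: measurable_funM; [exact: measurable_cst|exact: measurable_indic].
have mv_ k : measurable_fun setT (v k).
  by apply/measurable_EFinP; apply: measurable_funM; [exact: measurable_cst|exact: measurable_indic].
have layer (H : T -> R) (n : R) x : (0 < n)%R -> (0 <= H x)%R -> H x != 0%R ->
    exists k, (n * level k < H x)%R /\ (H x <= 2 * n * level k)%R.
  move=> n0 H0 Hx.
  have Hn : (0 < H x / n)%R by rewrite divr_gt0// lt_neqAle eq_sym Hx.
  have [k [k1 k2]] := level_cover Hn; exists k.
  by rewrite -ltr_pdivlMl// mulrC k1 -mulrA mulrCA mulrC -ler_pdivrMr.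
have fub : \int[nu]_(x in D) (F x * G x)%:E <=
    \sum_(0 <= k <oo) \sum_(0 <= m <oo) \int[nu]_(x in D) (u k x * v m x).
  rewrite (eq_eseriesr (g := fun k => \int[nu]_(x in D) (\sum_(0 <= m <oo) (u k x * v m x)))); last first.
    move=> k _; rewrite integral_nneseries//.
    - by move=> m; apply: emeasurable_funM; apply: measurable_funTS.
    - by move=> m x _; rewrite mule_ge0.
  rewrite -integral_nneseries//; last 2 first.
  - move=> k; apply: ge0_emeasurable_sum => //.
      by move=> m x _ _; rewrite mule_ge0.
    by move=> m _; apply: emeasurable_funM; apply: measurable_funTS.
  - by move=> k x _; apply: nneseries_ge0 => m _ _; rewrite mule_ge0.
  apply: ge0_le_integral => //.
  - by move=> x _; rewrite lee_fin mulr_ge0.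
  - by apply/measurable_EFinP; apply: measurable_funTS; exact: measurable_funM.
  - apply: ge0_emeasurable_sum => //.
      by move=> k x _ _; apply: nneseries_ge0 => m _ _; rewrite mule_ge0.
    move=> k _; apply: ge0_emeasurable_sum => //.
      by move=> m x _ _; rewrite mule_ge0.
    by move=> m _; apply: emeasurable_funM; apply: measurable_funTS.
  move=> x _.
  have uv0 k m : 0 <= u k x * v m x by rewrite mule_ge0.
  have [Fx|Fx] := eqVneq (F x) 0%R.
    by rewrite Fx mul0r; do 2 (apply: nneseries_ge0 => ? _ _).
  have [Gx|Gx] := eqVneq (G x) 0%R.
    by rewrite Gx mulr0; do 2 (apply: nneseries_ge0 => ? _ _).
  have [k [k1 k2]] := layer F nf x nf0 (F0 x) Fx.
  have [m [m1 m2]] := layer G ng x ng0 (G0 x) Gx.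
  apply: (@le_trans _ _ (u k x * v m x)).
    rewrite /u /v !indicE !mem_set// !mulr1 -EFinM lee_fin ler_pM//.
  have term (f : nat -> \bar R) k' : (forall n, 0 <= f n) -> f k' <= \sum_(0 <= n <oo) f n.
    move=> f0; apply: le_trans (nneseries_lim_ge k'.+1 _) => [|? _ _]; last exact: f0.
    by rewrite big_nat_recr//= leeDr// sume_ge0.
  apply: (@le_trans _ _ (\sum_(0 <= m <oo) (u k x * v m x))).
    exact: (term (fun m => u k x * v m x)).
  apply: (term (fun k => \sum_(0 <= m <oo) (u k x * v m x))) => n.
  by apply: nneseries_ge0.
apply: le_trans fub _.
have cell k m : \int[nu]_(x in D) (u k x * v m x) <=
    (4 * K * nf * ng * r1 ^+ k)%:E * (r2 ^+ m)%:E.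
  have -> : \int[nu]_(x in D) (u k x * v m x) =
      (4 * nf * ng * level k * level m)%:E * nu (D `&` A k `&` B m).
    rewrite -setIA setIC -integral_indic//; last exact: measurableI.
    rewrite -ge0_integralZl//; last 2 first.
    - by apply/measurable_EFinP; apply: measurable_indic; exact: measurableI.
    - by rewrite lee_fin !mulr_ge0 ?(ltW (level_gt0 _)) ?(ltW nf0) ?(ltW ng0).
    apply: eq_integral => x _; rewrite /u /v -!EFinM indicI; congr EFin.
    have -> : (\1_(A k) \* \1_(B m))%R x = (\1_(A k) x * \1_(B m) x)%R :> R by [].
    by move: (\1_(A k) x : R) (\1_(B m) x : R) => a b; ring.
  apply: le_trans (lee_wpmul2l _ (hK k m)) _.
    by rewrite lee_fin !mulr_ge0 ?(ltW (level_gt0 _)) ?(ltW nf0) ?(ltW ng0).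
  rewrite -!EFinM lee_fin le_eqVlt; apply/orP; left; apply/eqP; field.
  by rewrite !gt_eqF// level_gt0.
have r1k k : (0 <= r1 ^+ k)%R by rewrite exprn_ge0//; case/andP: r10.
have r2k k : (0 <= r2 ^+ k)%R by rewrite exprn_ge0//; case/andP: r20.
have c0 : (0 <= 4 * K * nf * ng)%R by rewrite !mulr_ge0// ltW.
apply: (@le_trans _ _ (\sum_(0 <= k <oo) ((4 * K * nf * ng / (1 - r2))%:E * (r1 ^+ k)%:E))).
  apply: lee_nneseries => [k _ _|k _].
    by apply: nneseries_ge0 => m _ _; apply: integral_ge0 => x _; rewrite mule_ge0.
  apply: (@le_trans _ _ (\sum_(0 <= m <oo) ((4 * K * nf * ng * r1 ^+ k)%:E * (r2 ^+ m)%:E))).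
    apply: lee_nneseries => [m _ _|m _]; last exact: cell.
    by apply: integral_ge0 => x _; rewrite mule_ge0.
  rewrite nneseriesZl => [|i _]; last by rewrite lee_fin.
  apply: le_trans (lee_wpmul2l _ (geometric_eseries_le r20)) _.
    by rewrite lee_fin mulr_ge0.
  by rewrite -!EFinM lee_fin mulrAC.
rewrite nneseriesZl => [|i _]; last by rewrite lee_fin.
have i2 : (0 <= (1 - r2)^-1)%R by rewrite invr_ge0 subr_ge0 ltW//; case/andP: r20.
apply: le_trans (lee_wpmul2l _ (geometric_eseries_le r10)) _.
  by rewrite lee_fin mulr_ge0.
by rewrite -EFinM lee_fin mulrAC.
Qed.

End strong_type.

Section complex_norm.
Context {R : realType}.
Implicit Type z : R[i].

Lemma normcE z : Normc.normc z = Num.sqrt (complex.Re z ^+ 2 + complex.Im z ^+ 2).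
Proof. by case: z. Qed.

Lemma normc_ge0 z : 0 <= Normc.normc z.
Proof. by rewrite normcE sqrtr_ge0. Qed.

Lemma Re_le_normc z : `|complex.Re z| <= Normc.normc z.
Proof. by rewrite normcE -sqrtr_sqr ler_wsqrtr// lerDl sqr_ge0. Qed.

Lemma Im_le_normc z : `|complex.Im z| <= Normc.normc z.
Proof. by rewrite normcE -sqrtr_sqr ler_wsqrtr// lerDr sqr_ge0. Qed.

Lemma normc_le_ReIm z : Normc.normc z <= `|complex.Re z| + `|complex.Im z|.
Proof.
have h : 0 <= `|complex.Re z| + `|complex.Im z| by rewrite addr_ge0.
rewrite normcE -[leRHS](ger0_norm h) -sqrtr_sqr ler_wsqrtr//.
rewrite sqrrD !real_normK ?num_real// addrAC lerDl.
by rewrite mulrn_wge0// mulr_ge0.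
Qed.

Lemma complex_ReM z w : complex.Re (z * w) = complex.Re z * complex.Re w - complex.Im z * complex.Im w.
Proof. by case: z; case: w. Qed.

Lemma complex_ImM z w : complex.Im (z * w) = complex.Re z * complex.Im w + complex.Im z * complex.Re w.
Proof. by case: z; case: w. Qed.

Lemma measurable_normc d (T : measurableType d) (f : T -> R[i]) :
  measurable_fun setT (fun x => complex.Re (f x)) ->
  measurable_fun setT (fun x => complex.Im (f x)) ->
  measurable_fun setT (fun x => Normc.normc (f x)).
Proof.
move=> mr mi.
rewrite (_ : (fun x => _) = (fun x => (complex.Re (f x) ^+ 2 + complex.Im (f x) ^+ 2) `^ 2^-1)).
  apply: (measurableT_comp (measurable_powR _)).
  by apply: measurable_funD; exact: measurable_funX.
by apply/funext => x; rewrite normcE powR12_sqrt// addr_ge0// sqr_ge0.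
Qed.

End complex_norm.

Section chebyshev.
Local Open Scope ereal_scope.
Context {d : measure_display} {T : measurableType d} {R : realType}.
Variable mu : {measure set T -> \bar R}.
Variable F : T -> R.
Hypotheses (mF : measurable_fun setT F) (F0 : forall x, (0 <= F x)%R).

Lemma Lnorm_chebyshev (q n t : R) : (0 < q)%R -> (0 < n)%R -> (0 < t)%R ->
  Lnorm mu q%:E (fun x => (F x)%:E) <= n%:E ->
  mu [set x | n * t < F x]%R <= (t `^ (- q))%:E.
Proof.
move=> q0 n0 t0 hn.
have nt0 : (0 < n * t)%R by rewrite mulr_gt0.
set A := [set _ | _].
have mA : measurable A.
  rewrite /A (_ : [set x | _] = F @^-1` `]n * t, +oo[)%R.
    by apply: measurable_preimage => //; exact: measurable_itv.
  by apply/seteqP; split => x /=; rewrite in_itv/= andbT.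
have h : ((n * t) `^ q)%:E * mu A <= (n `^ q)%:E.
  apply: (@le_trans _ _ (Lnorm mu q%:E (fun x => (F x)%:E) `^ q)); last first.
    by rewrite -poweR_EFin; apply: gt0_ler_poweR => //;
      rewrite ?in_itv/= ?leey ?andbT ?Lnorm_ge0 ?lee_fin ?ltW.
  rewrite poweR_Lnorm ?gt_eqF// -[X in _ * mu X]setIT -integral_indic// -ge0_integralZl//; last 2 first.
  - by apply/measurable_EFinP; exact: measurable_indic.
  - by rewrite lee_fin powR_ge0.
  apply: ge0_le_integral => //.
  - by move=> x _; rewrite mule_ge0// lee_fin powR_ge0.
  - by apply: measurable_funeM; apply/measurable_EFinP; exact: measurable_indic.
  - under eq_fun do rewrite /abse poweR_EFin.
    apply/measurable_EFinP; apply: (measurableT_comp (measurable_powR _)).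
    by apply: (measurableT_comp (@normr_measurable R setT)).
  move=> x _; rewrite /abse poweR_EFin -EFinM lee_fin indicE.
  have [Ax|nAx] := pselect (A x); last by rewrite memNset// mulr0 powR_ge0.
  rewrite mem_set// mulr1 ge0_ler_powR ?nnegrE ?(ltW q0) ?(ltW nt0)//.
  by rewrite ger0_norm// ltW.
rewrite powRM ?(ltW n0) ?(ltW t0)// in h.
have tq : (0 < t `^ q)%R by rewrite powR_gt0.
have nq : (0 < n `^ q)%R by rewrite powR_gt0.
rewrite powRN -[leLHS]mul1e -[1](_ : ((t `^ q)^-1)%:E * (t `^ q)%:E = _); last first.
  by rewrite -EFinM mulVf ?gt_eqF.
rewrite -muleA -[leRHS]mule1 lee_wpmul2l ?lee_fin ?invr_ge0 ?(ltW tq)//.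
rewrite EFinM -muleA in h; rewrite -(@lee_pmul2l _ (n `^ q)%:E)// ?mule1//.
Qed.

Lemma Lnorm0_null (q : R) : (0 < q)%R ->
  Lnorm mu q%:E (fun x => (F x)%:E) = 0 ->
  exists2 A, measurable A /\ mu A = 0 & [set x | F x != 0%R] `<=` A.
Proof.
move=> q0 h; have /(_ _ _ h) := @Lnorm_eq0_eq0 _ _ _ mu (fun x => (F x)%:E) q%:E.
case=> //; first exact/measurable_EFinP.
move=> A [mA A0 hA]; exists A => // x Fx; apply: hA => /= /(_ I)[] Fx0.
by move: Fx; rewrite /= Fx0 eqxx.
Qed.

End chebyshev.

Section Lp_bound.
Context {R : realType} {dL dR l : nat}.
Variable Q : {bilinear 'rV[R]_dL -> 'rV[R]_dR -> 'rV[R]_l}.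
Let X := 'rV[R]_dL. Let Y := 'rV[R]_dR. Let Z := 'rV[R]_l.
Local Notation nu := (@leb R dL \x @leb R dR \x @leb R l)%E.
Local Notation muF := (@leb R dR \x @leb R l)%E.
Local Notation muG := (@leb R dL \x @leb R l)%E.

Definition map_f (e : X * Y * Z) : Y * Z := (e.1.2, e.2 + Q e.1.1 e.1.2).
Definition map_g (e : X * Y * Z) : X * Z := (e.1.1, e.2).

Lemma measurable_map_f : measurable_fun setT map_f.
Proof.
apply: measurable_fun_pair; first exact: measurable_snd_fst.
apply: measurable_rVD; first exact: measurable_snd.
by apply: measurable_bilinear; [exact: measurable_fst_fst|exact: measurable_snd_fst].
Qed.

Lemma measurable_map_g : measurable_fun setT map_g.
Proof. by apply: measurable_fun_pair; [exact: measurable_fst_fst|exact: measurable_snd]. Qed.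

(** For fixed (x, y) the map is a translation in z, and it does not depend on x
    otherwise. *)
Lemma null_map_f N : measurable N -> muF N = 0%E -> mu3 (map_f @^-1` N) = 0%E.
Proof.
move=> mN N0; have mP := measurable_preimage measurable_map_f mN.
apply: etrans (product_measureA (leb dL) (leb dR) (leb l) mP) _.
rewrite -[RHS](integral0 (leb dL) setT); apply: eq_integral => x _; rewrite -N0.
apply: eq_integral => y _ /=.
rewrite -[RHS](@leb_affine R l 1 (Q x y)) ?mulr1//; last exact: measurable_xsection.
by congr (leb l _); rewrite !xsection_set; apply/seteqP; split => z /=; rewrite /map_f /= scale1r addrC.
Qed.

(** The preimage is the product of N with all of R^dR. *)
Lemma null_map_g N : measurable N -> muG N = 0%E -> mu3 (map_g @^-1` N) = 0%E.
Proof.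
move=> mN N0; have mP := measurable_preimage measurable_map_g mN.
apply: etrans (product_measure_swap23 (leb dL) (leb dR) (leb l) mP) _.
rewrite (_ : [set _ | _] = N `*` setT); last first.
  by apply/seteqP; split => -[[x z] y] /=; [|case].
apply: etrans (product_measure1E (product_sf (leb dL) (leb l)) (leb dR) mN measurableT) _.
by rewrite [X in (X * _)%E](N0 : product_sf (leb dL) (leb l) N = _) mul0e.
Qed.

Let cnu := completed nu.
Let cF := completed muF.
Let cG := completed muG.

Let TF := caratheodory_type (muF^*)%mu.
Let TG := caratheodory_type (muG^*)%mu.
Let TN := caratheodory_type (nu^*)%mu.

Lemma measurable_comp_f (h : TF -> R) : measurable_fun setT h ->
  measurable_fun setT ((h \o map_f) : TN -> R).
Proof.
move=> mh _ B mB; rewrite setTI comp_preimage.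
apply: (completed_preimage (mu := product_sf (leb dR) (leb l)) (mu' := mu3) measurable_map_f null_map_f).
by rewrite -[X in completed_measurable _ X]setTI; exact: mh.
Qed.

Lemma measurable_comp_g (h : TG -> R) : measurable_fun setT h ->
  measurable_fun setT ((h \o map_g) : TN -> R).
Proof.
move=> mh _ B mB; rewrite setTI comp_preimage.
apply: (completed_preimage (mu := product_sf (leb dL) (leb l)) (mu' := mu3) measurable_map_g null_map_g).
by rewrite -[X in completed_measurable _ X]setTI; exact: mh.
Qed.

Variable Om : set (X * Y * Z).
Hypothesis mOm : measurable Om.
Variables (qL qR K d : R).
Hypotheses (qL0 : 0 < qL) (qR0 : 0 < qR) (K0 : 0 < K) (d0 : 0 < d).
Hypotheses (dL' : d <= qL^-1) (dR' : d <= qR^-1).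
Hypothesis restricted :
  forall (F : set (Y * Z)) (G : set (X * Z)) (f0 g0 : R), measurable F -> measurable G ->
    muF F = f0%:E -> muG G = g0%:E ->
    forall e1 e2 : R, `|e1| <= d -> `|e2| <= d ->
    (mu3 (incidences Q Om F G) <= (K * f0 `^ (qL^-1 + e1) * g0 `^ (qR^-1 + e2))%:E)%E.

Let ratio (q : R) := expR (- (q * d * ln 2 / 2)).

Let ratio01 q : 0 < q -> 0 <= ratio q < 1.
Proof.
move=> q0; rewrite expR_ge0 -expR0 ltr_expR oppr_lt0.
by rewrite divr_gt0// mulr_gt0 ?ln_gt0 ?ltr1n// mulr_gt0.
Qed.

Let level_hull d' (T : measurableType d') (mu : {measure set T -> \bar R})
    (F : caratheodory_type (mu^*)%mu -> R) (q n : R) k :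
  measurable_fun setT F -> (forall x, 0 <= F x) -> 0 < q -> 0 < n -> d <= q^-1 ->
  (Lnorm (completed mu) q%:E (fun x => (F x)%:E) <= n%:E)%E ->
  exists (B : set T) (f0 e : R), [/\ measurable B, [set x | n * level k < F x] `<=` B,
    mu B = f0%:E, `|e| <= d & f0 `^ (q^-1 + e) <= ratio q ^+ k / level k].
Proof.
move=> mF F0 q0 n0 dq hn.
have [B [mB AB muB]] := borel_hull mu [set x | n * level k < F x].
have lk0 := @level_gt0 R k.
have hB := Lnorm_chebyshev mF F0 q0 n0 lk0 hn.
have Bfin : mu B \is a fin_num.
  by rewrite ge0_fin_numE// muB; apply: le_lt_trans hB (ltry _).
have [e ed he] := level_exponent k (mulr_gt0 q0 d0).
exists B, (fine (mu B)), (e / q); split => //.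
- by rewrite fineK.
- by rewrite normrM normfV (gtr0_norm q0) ler_pdivrMr// mulrC.
have ed' : `|e / q| <= d.
  by rewrite normrM normfV (gtr0_norm q0) ler_pdivrMr// mulrC.
have qe0 : 0 <= q^-1 + e / q.
  by move: ed'; rewrite ler_norml => /andP[+ _]; lra.
rewrite ler_pdivlMr//; apply: le_trans he.
(* the exponent of level k is -1 - e, and the -1 cancels the factor level k *)
apply: (@le_trans _ _ ((level k `^ (- q)) `^ (q^-1 + e / q) * level k)).
  rewrite ler_wpM2r ?(ltW lk0)// ge0_ler_powR ?nnegrE ?powR_ge0 ?fine_ge0//.
  by rewrite -lee_fin fineK// muB.
rewrite -powRrM -{2}[level k]powRr1 ?(ltW lk0)// -powRD ?(gt_eqF lk0) ?implybT//.
rewrite (_ : - q * _ + 1 = - e)//; field; rewrite gt_eqF//.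
Qed.

Section functions.
Variables (f : Y * Z -> R[i]) (g : X * Z -> R[i]).
Hypotheses (mf : completed_measurable_fun muF f) (mg : completed_measurable_fun muG g).

Let nf : TF -> R := fun p => Normc.normc (f p).
Let ng : TG -> R := fun p => Normc.normc (g p).
Let mnf : measurable_fun setT nf. Proof. by case: mf => *; exact: measurable_normc. Qed.
Let mng : measurable_fun setT ng. Proof. by case: mg => *; exact: measurable_normc. Qed.
Let h : TN -> R := fun e => nf (map_f e) * ng (map_g e).
Let mh : measurable_fun setT h.
Proof. by apply: measurable_funM; [exact: measurable_comp_f|exact: measurable_comp_g]. Qed.
Let h0 e : 0 <= h e. Proof. by rewrite mulr_ge0 ?normc_ge0. Qed.
Let cmOm : measurable (Om : set TN).
Proof. exact: (borel_completed_measurable mu3 mOm). Qed.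

Definition Lp_constant := 4 * K / (1 - ratio qL) / (1 - ratio qR).

Lemma Lp_constant_ge0 : 0 <= Lp_constant.
Proof.
have /andP[_ r1] := ratio01 qL0; have /andP[_ r2] := ratio01 qR0.
by rewrite /Lp_constant !divr_ge0 ?mulr_ge0 ?subr_ge0 ?ltW.
Qed.

Let norm_integral_lt (n m : R) : 0 < n -> 0 < m ->
  (cLnorm cF qL%:E f <= n%:E)%E -> (cLnorm cG qR%:E g <= m%:E)%E ->
  (\int[cnu]_(e in Om) (h e)%:E <= (Lp_constant * n * m)%:E)%E.
Proof.
move=> n0 m0 hn hm.
have := @strong_type_of_levels _ TN R cnu Om (nf \o map_f) (ng \o map_g) n m K (ratio qL) (ratio qR)
  cmOm (measurable_comp_f mnf) (measurable_comp_g mng) (fun=> normc_ge0 _) (fun=> normc_ge0 _)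
  n0 m0 (ltW K0) (ratio01 qL0) (ratio01 qR0).
rewrite (_ : 4 * K * n * m / _ / _ = Lp_constant * n * m); last first.
  by rewrite /Lp_constant; ring.
apply => j k.
have [F [f0 [e1 [mF AF hF e1d hf]]]] := level_hull j mnf (fun=> normc_ge0 _) qL0 n0 dL' hn.
have [G [g0 [e2 [mG AG hG e2d hg]]]] := level_hull k mng (fun=> normc_ge0 _) qR0 m0 dR' hm.
apply: (@le_trans _ _ (mu3 (incidences Q Om F G))).
  rewrite -(completed_borelE mu3); last exact: measurable_incidences.
  by apply: le_mu_ext => e [[Oe Ae] Be]; split => //; [exact: AF|exact: AG].
apply: le_trans (restricted mF mG hF hG e1d e2d) _; rewrite lee_fin.
by rewrite ler_pM ?mulr_ge0 ?powR_ge0 ?(ltW K0)// ler_pM2l.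
Qed.

Let norm_integral0 : cLnorm cF qL%:E f = 0%E \/ cLnorm cG qR%:E g = 0%E ->
  (\int[cnu]_(e in Om) (h e)%:E = 0)%E.
Proof.
move=> hN; suff [N [mN N0] hN'] : exists2 N, measurable N /\ mu3 N = 0%E &
    forall e, ~ N e -> h e = 0.
  have cN0 : cnu N = 0%E by rewrite -N0; exact: (completed_borelE mu3).
  have cmN : measurable (N : set TN) by exact: (borel_completed_measurable mu3 mN).
  rewrite (ge0_negligible_integral cmN cmOm) => [|||]//; last 2 first.
  - by apply/measurable_EFinP; exact: measurable_funTS.
  - by move=> e _; rewrite lee_fin.
  by apply: integral0_eq => e [_ Ne]; rewrite hN'.
case: hN => hN.
  have [A [mA A0] hA] := Lnorm0_null mnf qL0 hN.
  have [N [mN AN N0]] := borel_hull muF A.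
  exists (map_f @^-1` N).
    split; first exact: measurable_preimage measurable_map_f mN.
    by apply: null_map_f => //; rewrite N0.
  move=> e Ne; rewrite /h; have [->|ne0] := eqVneq (nf (map_f e)) 0; first by rewrite mul0r.
  by case: Ne; apply: AN; exact: hA.
have [A [mA A0] hA] := Lnorm0_null mng qR0 hN.
have [N [mN AN N0]] := borel_hull muG A.
exists (map_g @^-1` N).
  split; first exact: measurable_preimage measurable_map_g mN.
  by apply: null_map_g => //; rewrite N0.
move=> e Ne; rewrite /h; have [->|ne0] := eqVneq (ng (map_g e)) 0; first by rewrite mulr0.
by case: Ne; apply: AN; exact: hA.
Qed.

(** If one norm vanishes, the function vanishes off a null set, and so does the
    product, even if the other norm is infinite. *)
Lemma norm_integral_le :
  (\int[cnu]_(e in Om) (Normc.normc (BQ_integrand Q f g e))%:E <=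
   Lp_constant%:E * cLnorm cF qL%:E f * cLnorm cG qR%:E g)%E.
Proof.
rewrite (_ : (\int[cnu]_(e in Om) _)%E = (\int[cnu]_(e in Om) (h e)%:E)%E); last first.
  by apply: eq_integral => -[[x y] z] _; rewrite /= Normc.normcM.
have Nf0 : (0 <= cLnorm cF qL%:E f)%E by exact: Lnorm_ge0.
have Ng0 : (0 <= cLnorm cG qR%:E g)%E by exact: Lnorm_ge0.
have C0 : 0 < Lp_constant.
  have /andP[_ r1] := ratio01 qL0; have /andP[_ r2] := ratio01 qR0.
  by rewrite /Lp_constant !divr_gt0 ?mulr_gt0 ?subr_gt0.
have [Nfe|Nfn] := eqVneq (cLnorm cF qL%:E f) 0%E.
  by rewrite (norm_integral0 (or_introl Nfe)) Nfe mule0 mul0e.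
have [Nge|Ngn] := eqVneq (cLnorm cG qR%:E g) 0%E.
  by rewrite (norm_integral0 (or_intror Nge)) Nge mule0.
have {}Nf0 : (0 < cLnorm cF qL%:E f)%E by rewrite lt_neqAle eq_sym Nfn.
have {}Ng0 : (0 < cLnorm cG qR%:E g)%E by rewrite lt_neqAle eq_sym Ngn.
move: (@norm_integral_lt) Nf0 Ng0 {Nfn Ngn}.
case: (cLnorm cF qL%:E f) => [n| |]; last by [].
  case: (cLnorm cG qR%:E g) => [m| |] H n0 m0; last by [].
    by rewrite -!EFinM; apply: H.
  by rewrite -EFinM gt0_muley ?leey// lte_fin mulr_gt0.
move=> H _ m0; rewrite gt0_muley ?lte_fin// gt0_mulye ?leey//.
Qed.

Lemma Lp_bound_pair :
  let Nf := cLnorm cF qL%:E f in let Ng := cLnorm cG qR%:E g in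
  ((Nf < +oo)%E -> (Ng < +oo)%E -> cintegrable cnu Om (BQ_integrand Q f g)) /\
  ((Normc.normc (BQ Q Om f g))%:E <= (2 * Lp_constant)%:E * Nf * Ng)%E.
Proof.
move=> Nf Ng; case: mf => mfr mfi; case: mg => mgr mgi.
have mr : measurable_fun (Om : set TN) (fun e => complex.Re (BQ_integrand Q f g e)).
  apply: measurable_funTS.
  rewrite (_ : (fun e => _) = (fun e : TN =>
      ((fun p => complex.Re (f p)) \o map_f) e * ((fun p => complex.Re (g p)) \o map_g) e -
      ((fun p => complex.Im (f p)) \o map_f) e * ((fun p => complex.Im (g p)) \o map_g) e)).
    by apply: measurable_funB; apply: measurable_funM;
      [exact: measurable_comp_f|exact: measurable_comp_g
      |exact: measurable_comp_f|exact: measurable_comp_g].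
  by apply/funext => -[[x y] z]; exact: complex_ReM.
have mi : measurable_fun (Om : set TN) (fun e => complex.Im (BQ_integrand Q f g e)).
  apply: measurable_funTS.
  rewrite (_ : (fun e => _) = (fun e : TN =>
      ((fun p => complex.Re (f p)) \o map_f) e * ((fun p => complex.Im (g p)) \o map_g) e +
      ((fun p => complex.Im (f p)) \o map_f) e * ((fun p => complex.Re (g p)) \o map_g) e)).
    by apply: measurable_funD; apply: measurable_funM;
      [exact: measurable_comp_f|exact: measurable_comp_g
      |exact: measurable_comp_f|exact: measurable_comp_g].
  by apply/funext => -[[x y] z]; exact: complex_ImM.
have mn : measurable_fun (Om : set TN) (fun e => (Normc.normc (BQ_integrand Q f g e))%:E).
  apply/measurable_EFinP; apply: measurable_funTS; rewrite (_ : (fun e => _) = h)//.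
  by apply/funext => -[[x y] z]; rewrite /= Normc.normcM.
have part (p : R[i] -> R) : (forall z, `|p z| <= Normc.normc z) ->
    measurable_fun (Om : set TN) (fun e => p (BQ_integrand Q f g e)) ->
    (\int[cnu]_(e in Om) `|(p (BQ_integrand Q f g e))%:E| <= Lp_constant%:E * Nf * Ng)%E.
  move=> hp mp; apply: le_trans norm_integral_le; apply: ge0_le_integral.
  - exact: cmOm.
  - by move=> e _; exact: abse_ge0.
  - apply: (measurableT_comp (@abse_measurable R setT)).
    by apply/measurable_EFinP; exact: mp.
  - exact: mn.
  - by move=> e _; rewrite lee_fin; exact: hp.
have hr := part _ Re_le_normc mr; have hi := part _ Im_le_normc mi.
split.
  move=> Nfoo Ngoo.
  have RHS : (Lp_constant%:E * Nf * Ng < +oo)%E.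
    by rewrite lte_mul_pinfty ?mule_ge0 ?lee_fin ?Lp_constant_ge0 ?Lnorm_ge0//
      ge0_fin_numE ?mule_ge0 ?lee_fin ?Lp_constant_ge0 ?Lnorm_ge0// lte_mul_pinfty
      ?lee_fin ?Lp_constant_ge0.
  by split; apply/integrableP; split; [exact/measurable_EFinP|exact: le_lt_trans RHS
    |exact/measurable_EFinP|exact: le_lt_trans RHS].
have fine_le (u : \bar R) : ((`|fine u|)%:E <= `|u|)%E.
  by case: u => [r| |] //=; rewrite normr0 leey.
have Rint (p : R[i] -> R) : measurable_fun (Om : set TN) (fun e => p (BQ_integrand Q f g e)) ->
    ((`|\int[cnu]_(e in Om) p (BQ_integrand Q f g e)|)%:E <=
     \int[cnu]_(e in Om) `|(p (BQ_integrand Q f g e))%:E|)%E.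
  move=> /measurable_EFinP mp.
  exact: (le_trans (fine_le _) (le_abse_integral cnu cmOm mp)).
rewrite (_ : (2 * Lp_constant)%:E * Nf * Ng =
    Lp_constant%:E * Nf * Ng + Lp_constant%:E * Nf * Ng)%E; last first.
  rewrite mulr_natl mulr2n EFinD !ge0_muleDl// ?mule_ge0 ?lee_fin ?Lp_constant_ge0//;
  exact: Lnorm_ge0.
apply: le_trans (_ : _ <= (`|complex.Re (BQ Q Om f g)| + `|complex.Im (BQ Q Om f g)|)%:E)%E _.
  by rewrite lee_fin normc_le_ReIm.
rewrite EFinD; apply: leeD.
  exact: le_trans (Rint _ mr) hr.
exact: le_trans (Rint _ mi) hi.
Qed.

End functions.

Lemma Lp_bounded_of_restricted : Lp_bounded Q Om qL qR.
Proof. by exists (2 * Lp_constant) => f g mf mg; exact: Lp_bound_pair. Qed.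

End Lp_bound.

(** * The theorem *)

Section compact_sets.
Context {R : realType}.

Lemma coord_le_mx_norm n (v : 'rV[R]_n) i : `|v 0 i| <= `|v|.
Proof.
rewrite [leRHS](_ : _ = mx_norm v)// mx_normrE.
exact: (le_bigmax_cond 0 (fun ij : 'I_1 * 'I_n => `|v ij.1 ij.2|) (j := (0, i))).
Qed.

Context {dL dR l : nat}.
Variable Om : set ('rV[R]_dL * 'rV[R]_dR * 'rV[R]_l).
Hypothesis cOm : compact Om.

Lemma compact_measurable_prod3 : measurable Om.
Proof.
have [F [finF ->]] := compact_bigcap_balls cOm; apply: bigcapT_measurable => k.
apply: fin_bigcup_measurable => // -[[x y] z] _.
rewrite (_ : ball _ _ = ball x k.+1%:R^-1 `*` ball y k.+1%:R^-1 `*` ball z k.+1%:R^-1).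
  by apply: measurableX; [apply: measurableX|]; exact: measurable_ball_mx.
by apply/seteqP; split => -[[x' y'] z'] [[]].
Qed.

Lemma compact_diameter : exists2 T : R, 0 < T & forall e e', Om e -> Om e' ->
  sqnorm (e'.1.1 - e.1.1) <= T ^+ 2 / 2 /\ sqnorm (e'.1.2 - e.1.2) <= T ^+ 2 / 2.
Proof.
have [M [_ hM]] := compact_bounded cOm.
pose B := `|M| + 1.
have B0 : 0 < B by rewrite ltr_wpDl.
have hB e : Om e -> `|e| <= B.
  by move=> Oe; apply: (hM B _ e Oe); rewrite (le_lt_trans (ler_norm M))// ltrDl.
pose N : R := (dL + dR).+1%:R.
have N1 : 1 <= N by rewrite ler1n.
have sq n (v w : 'rV[R]_n) : (n <= dL + dR)%N -> `|v| <= B -> `|w| <= B ->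
    sqnorm (w - v) <= (4 * N * B) ^+ 2 / 2.
  move=> nN vB wB; apply: (@le_trans _ _ (\sum_(i < n) (2 * B) ^+ 2)).
    apply: ler_sum => i _; rewrite -[X in X <= _]real_normK ?num_real//.
    rewrite ler_pXn2r ?nnegrE// ?mulr_ge0 ?(ltW B0)// !mxE.
    apply: le_trans (ler_normB _ _) _; rewrite mulr_natl mulr2n lerD//.
      exact: le_trans (coord_le_mx_norm _ _) _.
    exact: le_trans (coord_le_mx_norm _ _) _.
  rewrite sumr_const card_ord -[leLHS]mulr_natl.
  have nN' : n%:R <= N by rewrite ler_nat ltnW.
  have B2 : 0 <= (2 * B) ^+ 2 by exact: sqr_ge0.
  apply: (@le_trans _ _ (N * (2 * B) ^+ 2)); first by rewrite ler_wpM2r.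
  have NB : N * B ^+ 2 <= N ^+ 2 * B ^+ 2.
    by rewrite ler_wpM2r ?sqr_ge0// expr2 ler_peMr// (le_trans ler01).
  have NB0 : 0 <= N * B ^+ 2 by rewrite mulr_ge0 ?sqr_ge0// (le_trans ler01).
  rewrite !exprMn; lra.
exists (4 * N * B); first by rewrite !mulr_gt0// (lt_le_trans ltr01).
move=> [[x y] z] [[x' y'] z'] /hB h /hB h' /=.
move: h h'; rewrite /Num.norm/= !ge_max => /andP[/andP[hx hy] _] /andP[/andP[hx' hy'] _].
by split; apply: sq => //; rewrite (leq_addr, leq_addl).
Qed.

End compact_sets.

Section boundedness.
Context {R : realType} {dL dR l : nat}.
Variable Q : {bilinear 'rV[R]_dL -> 'rV[R]_dR -> 'rV[R]_l}.
Hypothesis hl : (l <= dL + dR)%N.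

Lemma Lp_bounded_of_sublevel (s : R) (pl pr : \bar R) (C0 : R) (U : set 'rV[R]_dL)
    (V : set 'rV[R]_dR) (Om : set ('rV[R]_dL * 'rV[R]_dR * 'rV[R]_l)) (qL qR : R) :
  0 < s -> (1 <= pl)%E -> (1 <= pr)%E -> sublevel_estimate Q U V s pl pr C0 ->
  compact Om ->
  (forall e e', Om e -> Om e' -> U (e'.1.1 - e.1.1) /\ V (e'.1.2 - e.1.2)) ->
  interior (exponent_triangle s pl pr) (qL^-1, qR^-1) ->
  Lp_bounded Q Om qL qR.
Proof.
move=> s0 hpl hpr sub cOm OmUV.
have [ea ip01] := conjugate_exponent s0 hpl; have [eb ir01] := conjugate_exponent s0 hpr.
rewrite /exponent_triangle /third_vertex ea eb => hint.
have a0 : 0 <= (1 - fine pl^-1%E) / s.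
  by rewrite divr_ge0 ?(ltW s0)// subr_ge0; case/andP: ip01.
have b0 : 0 <= (1 - fine pr^-1%E) / s.
  by rewrite divr_ge0 ?(ltW s0)// subr_ge0; case/andP: ir01.
have [h1 h2 h3] := interior_exponents a0 b0 hint.
have [T T0 OmT] := compact_diameter cOm.
have mOm := compact_measurable_prod3 cOm.
have C1 : 0 < `|C0| + 1 by rewrite ltr_wpDl.
have [K [d [K0 d0 hK]]] := restricted_estimate hl mOm T0 OmT OmUV s0 ip01 ir01 C1
  (sublevel_estimate_borel sub) h1 h2 h3.
have w0 : 0 < qL^-1 + qR^-1 - 1 by rewrite subr_gt0.
have pL : 0 < qL^-1 by apply: lt_trans h2; rewrite mulr_gt0// ltr_wpDr.
have pR : 0 < qR^-1 by apply: lt_trans h3; rewrite mulr_gt0// ltr_wpDr.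
pose d' := Num.min d (Num.min qL^-1 qR^-1).
have d'0 : 0 < d' by rewrite !lt_min d0 pL pR.
have [dd dL' dR'] : [/\ d' <= d, d' <= qL^-1 & d' <= qR^-1].
  by rewrite /d'; split; rewrite !ge_min lexx ?orbT.
apply: (@Lp_bounded_of_restricted _ _ _ _ Q Om mOm qL qR K d') => //.
- by rewrite -invr_gt0.
- by rewrite -invr_gt0.
move=> F G f0 g0 mF mG hF hG e1 e2 h h'.
by apply: hK => //; apply: le_trans dd.
Qed.

Lemma nbhs0_sqnorm n (U : set 'rV[R]_n) : nbhs (0 : 'rV[R]_n) U ->
  exists2 r : R, 0 < r & forall v, sqnorm v < r ^+ 2 -> U v.
Proof.
move=> /nbhs_ballP[r /= r0 rU]; exists r => // v vr; apply: rU; split => // i j.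
rewrite ord1 /ball/= mxE sub0r normrN -(@ltr_pXn2r _ 2) ?nnegrE ?(ltW r0)//.
rewrite real_normK ?num_real//; apply: le_lt_trans vr; exact: coord_le_sqnorm.
Qed.

Lemma lt_diameter (Om : set ('rV[R]_dL * 'rV[R]_dR * 'rV[R]_l)) (delta : R) e e' :
  0 < delta -> (diameter Om < delta%:E)%E -> Om e -> Om e' ->
  sqnorm (e'.1.1 - e.1.1) < delta ^+ 2 /\ sqnorm (e'.1.2 - e.1.2) < delta ^+ 2.
Proof.
move=> d0 hd Oe Oe'.
have : ((dist3 e' e)%:E < delta%:E)%E.
  by apply: le_lt_trans hd; apply: ereal_sup_ubound; exists (e', e).
rewrite lte_fin -(@ltr_pXn2r _ 2) ?nnegrE ?sqrtr_ge0 ?(ltW d0)//.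
have := sqnorm_ge0 (e'.1.1 - e.1.1); have := sqnorm_ge0 (e'.1.2 - e.1.2).
have := sqnorm_ge0 (e'.2 - e.2) => h1 h2 h3.
by rewrite sqr_sqrtr ?addr_ge0// => h; split; lra.
Qed.

End boundedness.

Theorem theorem4 (R : realType) (dL dR l : nat)
  (Q : {bilinear 'rV[R]_dL -> 'rV[R]_dR -> 'rV[R]_l})
  (hl : (l <= dL + dR)%N)
  (s : R) (pl pr : \bar R) (C0 : R)
  (hs : 0 < s) (hpl : (1 <= pl)%E) (hpr : (1 <= pr)%E) :
  (sublevel_estimate Q setT setT s pl pr C0 ->
   forall Omega : set ('rV[R]_dL * 'rV[R]_dR * 'rV[R]_l), compact Omega ->
   forall qL qR : R, interior (exponent_triangle s pl pr) (qL^-1, qR^-1) ->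
   Lp_bounded Q Omega qL qR)
  /\
  (forall (U : set 'rV[R]_dL) (V : set 'rV[R]_dR),
   nbhs (0 : 'rV[R]_dL) U -> nbhs (0 : 'rV[R]_dR) V ->
   sublevel_estimate Q U V s pl pr C0 ->
   exists2 delta : R, 0 < delta &
   forall Omega : set ('rV[R]_dL * 'rV[R]_dR * 'rV[R]_l), compact Omega ->
   (diameter Omega < delta%:E)%E ->
   forall qL qR : R, interior (exponent_triangle s pl pr) (qL^-1, qR^-1) ->
   Lp_bounded Q Omega qL qR).
Proof.
split=> [sub Om cOm qL qR hint|U V U0 V0 sub].
  exact: (Lp_bounded_of_sublevel hl hs hpl hpr sub cOm).
have [u u0 hU] := nbhs0_sqnorm U0; have [v v0 hV] := nbhs0_sqnorm V0.
exists (Num.min u v); first by rewrite lt_min u0 v0.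
have m0 : 0 < Num.min u v by rewrite lt_min u0 v0.
move=> Om cOm hd qL qR hint.
apply: (Lp_bounded_of_sublevel hl hs hpl hpr sub cOm) => // e e' Oe Oe'.
have [h1 h2] := lt_diameter m0 hd Oe Oe'.
have mono w : Num.min u v <= w -> (Num.min u v) ^+ 2 <= w ^+ 2.
  by move=> mw; rewrite ler_pXn2r ?nnegrE ?(ltW m0)// (le_trans (ltW m0)).
split; [apply: hU|apply: hV]; [apply: lt_le_trans h1 _|apply: lt_le_trans h2 _];
  by apply: mono; rewrite ge_min lexx ?orbT.
Qed.
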